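(* We have \begin{align*} &\sum_{i,j,k\geq 0} \frac{q^{\frac{3}{2}i^2+\frac{7}{2}j^2+4k^2-4ij-3ik+4jk+\frac{1}{2}i-\frac{3}{2}j+2k}}{(q^5;q^5)_i(q^5;q^5)_j(q^5;q^5)_k} \\ &=2\frac{J_{50}^{11}}{J_{5,50}^4J_{10,50}J_{15,50}^3J_{20,50}^2J_{25}}+q\frac{J_{50}^{11}J_{10,50}}{J_{5,50}^5J_{15,50}^2J_{20,50}^4J_{25}} +4q^2\frac{J_{50}^{12}}{J_{5,50}^3J_{10,50}^2J_{15,50}^3J_{20,50}J_{25}^3} \end{align*} and \begin{align*} &\sum_{i,j,k\geq 0} \frac{q^{\frac{3}{2}i^2+\frac{7}{2}j^2+4k^2-4ij-3ik+4jk+\frac{5}{2}i-\frac{5}{2}j}}{(q^5;q^5)_i(q^5;q^5)_j(q^5;q^5)_k} \\ &=\frac{J_{20,50}J_{50}^{11}}{J_{5,50}^2J_{10,50}^4J_{15,50}^5J_{25}}+2q\frac{J_{50}^{11}}{J_{5,50}^3J_{10,50}^2J_{15,50}^4J_{20,50}J_{25}} +4q^4\frac{J_{50}^{12}}{J_{5,50}^3J_{10,50}J_{15,50}^3J_{20,50}^2J_{25}^3}. \end{align*}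
   Context: Throughout $|q|<1$. Notation: $(a;q)_n=\prod_{k=0}^{n-1}(1-aq^k)$, $(a;q)_\infty=\prod_{k\ge0}(1-aq^k)$, $(a_1,\dots,a_r;q)_\infty=\prod_s(a_s;q)_\infty$; $J_m:=(q^m;q^m)_\infty$ and $J_{a,m}:=(q^a,q^{m-a},q^m;q^m)_\infty$. *)

(* Defs.v *)
From mathcomp Require Import all_boot all_order all_algebra finmap zify ring lra.
From mathcomp Require Import complex.
From mathcomp Require Import all_classical all_reals topology normedtype sequences.
From mathcomp Require Import summability.

Set Implicit Arguments.
Unset Strict Implicit.
Unset Printing Implicit Defensive.

Import Order.TTheory GRing.Theory Num.Theory numFieldNormedType.Exports.

Local Open Scope classical_set_scope.
Local Open Scope ring_scope.

Definition qpoch (F : pzRingType) (a q : F) (n : nat) : F :=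
  \prod_(k < n) (1 - a * q ^+ k).

Section QProducts.
Variable R : realType.
Implicit Types a q : R[i].

(* The type annotation R[i]^o selects the norm topology of the complex numbers.
   For `|q| < 1 the limit exists, so lim is not a default value there. *)
Definition qpoch_inf a q : R[i] :=
  lim ((qpoch a q : nat -> R[i]^o) @ \oo).

Definition J (m : nat) q : R[i] := qpoch_inf (q ^+ m) (q ^+ m).

(* J_{a,m}; only used with a < m, so that m - a is a genuine subtraction. *)
Definition J2 (a m : nat) q : R[i] :=
  qpoch_inf (q ^+ a) (q ^+ m) * qpoch_inf (q ^+ (m - a)) (q ^+ m)
  * qpoch_inf (q ^+ m) (q ^+ m).

(* [has_sum3 f s]: the triple series of f over i, j, k >= 0 converges
   unconditionally (along the directed set of finite sets of indices) to s;
   over R[i] this is the same as absolute convergence with sum s. *)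
Definition has_sum3 (f : nat -> nat -> nat -> R[i]) (s : R[i]) : Prop :=
  partial_sum (fun t : nat * nat * nat => f t.1.1 t.1.2 t.2 : R[i]^o)
    @ totally --> (s : R[i]^o).

End QProducts.

(* The exponents, written over the common denominator 2.  The numerators are
   even and nonnegative (lemmas below), so the integer divisions are exact and
   no negative power of q occurs, even for q = 0. *)
Definition exponent1 (i j k : int) : int :=
  ((3 * i ^+ 2 + 7 * j ^+ 2 + 8 * k ^+ 2 - 8 * i * j - 6 * i * k + 8 * j * k
    + i - 3 * j + 4 * k) %/ 2)%Z.

Definition exponent2 (i j k : int) : int :=
  ((3 * i ^+ 2 + 7 * j ^+ 2 + 8 * k ^+ 2 - 8 * i * j - 6 * i * k + 8 * j * k
    + 5 * i - 5 * j) %/ 2)%Z.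

Lemma double_halfz (x w : int) : x = 2 * w -> 2 * (x %/ 2)%Z = x.
Proof. lia. Qed.

Lemma sqrz_subl_even (x : int) : exists t : int, x ^+ 2 = 2 * t + x.
Proof.
suff [t Ht] : exists t : int, x ^+ 2 - x = 2 * t by exists t; lra.
have [e [-> | ->]] : exists e : int, x = 2 * e \/ x = 2 * e + 1.
  by exists (x %/ 2)%Z; lia.
- by exists (2 * e ^+ 2 - e); ring.
- by exists (2 * e ^+ 2 + e); ring.
Qed.

Lemma double_exponent1 (i j k : int) :
  2 * exponent1 i j k = 3 * i ^+ 2 + 7 * j ^+ 2 + 8 * k ^+ 2
    - 8 * i * j - 6 * i * k + 8 * j * k + i - 3 * j + 4 * k.
Proof.
have [t Ht] := sqrz_subl_even i; have [u Hu] := sqrz_subl_even j.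
apply: (@double_halfz _ (3 * t + 2 * i + 7 * u + 2 * j + 4 * k ^+ 2
  - 4 * i * j - 3 * i * k + 4 * j * k + 2 * k)).
rewrite Ht Hu; ring.
Qed.

Lemma double_exponent2 (i j k : int) :
  2 * exponent2 i j k = 3 * i ^+ 2 + 7 * j ^+ 2 + 8 * k ^+ 2
    - 8 * i * j - 6 * i * k + 8 * j * k + 5 * i - 5 * j.
Proof.
have [t Ht] := sqrz_subl_even i; have [u Hu] := sqrz_subl_even j.
apply: (@double_halfz _ (3 * t + 4 * i + 7 * u + j + 4 * k ^+ 2
  - 4 * i * j - 3 * i * k + 4 * j * k)).
rewrite Ht Hu; ring.
Qed.

Lemma exponent1E (i j k : int) :
  (exponent1 i j k)%:Q =
  3 / 2 * i%:Q ^+ 2 + 7 / 2 * j%:Q ^+ 2 + 4 * k%:Q ^+ 2 - 4 * i%:Q * j%:Q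
  - 3 * i%:Q * k%:Q + 4 * j%:Q * k%:Q + 1 / 2 * i%:Q - 3 / 2 * j%:Q + 2 * k%:Q.
Proof.
have := congr1 (fun z : int => z%:Q) (double_exponent1 i j k).
rewrite !(rmorphD, rmorphN, rmorphM, rmorphXn) /=; lra.
Qed.

Lemma exponent2E (i j k : int) :
  (exponent2 i j k)%:Q =
  3 / 2 * i%:Q ^+ 2 + 7 / 2 * j%:Q ^+ 2 + 4 * k%:Q ^+ 2 - 4 * i%:Q * j%:Q
  - 3 * i%:Q * k%:Q + 4 * j%:Q * k%:Q + 5 / 2 * i%:Q - 5 / 2 * j%:Q.
Proof.
have := congr1 (fun z : int => z%:Q) (double_exponent2 i j k).
rewrite !(rmorphD, rmorphN, rmorphM, rmorphXn) /=; lra.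
Qed.

Lemma exponent1_ge0 (i j k : nat) : 0 <= exponent1 i j k.
Proof.
have consec (x : int) : 0 <= x * (x + 1) by nia.
have H : 6 * exponent1 i j k =
    (3 * Posz i - 4 * Posz j - 3 * Posz k)
      * ((3 * Posz i - 4 * Posz j - 3 * Posz k) + 1)
    + 5 * ((Posz j - 1) * (Posz j - 1 + 1)) + 15 * (Posz k * (Posz k + 1)).
  by rewrite (_ : 6 = 3 * 2) // -mulrA double_exponent1; ring.
suff : 0 <= 6 * exponent1 i j k by clear; lia.
by rewrite H !addr_ge0 // ?consec // mulr_ge0 // consec.
Qed.

Lemma exponent2_ge0 (i j k : nat) : 0 <= exponent2 i j k.
Proof.
have H : 6 * exponent2 i j k =
    (3 * Posz i - 4 * Posz j - 3 * Posz k)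
      * ((3 * Posz i - 4 * Posz j - 3 * Posz k) + 5)
    + 5 * (Posz j * (Posz j + 1)) + 15 * (Posz k * (Posz k + 1)).
  by rewrite (_ : 6 = 3 * 2) // -mulrA double_exponent2; ring.
have lo (x : int) : -6 <= x * (x + 5).
  suff : 0 <= (x + 2) * (x + 3) by clear; nia.
  have [x_le | x_ge] : x <= -3 \/ -2 <= x by clear; lia.
    by clear - x_le; nia.
  by clear - x_ge; nia.
have up (n : nat) : 2 * Posz n <= Posz n * (Posz n + 1) by clear; nia.
have [jk0 | jk_gt0] : (j + k = 0)%N \/ (0 < j + k)%N by clear; lia.
  have [-> ->] : j = 0%N /\ k = 0%N by clear - jk0; lia.
  suff : 0 <= 2 * exponent2 i 0 0 by clear; move: (exponent2 _ _ _) => e; lia.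
  have -> : 2 * exponent2 i 0 0 = Posz i * (3 * Posz i + 5).
    by rewrite double_exponent2; ring.
  by clear; nia.
have := up j; have := up k; move: H (lo (3 * Posz i - 4 * Posz j - 3 * Posz k)).
move: jk_gt0; clear.
move: (exponent2 i j k) (_ * (_ + 5)) (_ * (Posz j + 1)) (_ * (Posz k + 1)).
move=> *; lia.
Qed.

(* Main.v *)
(* Put Q = q^5.  Writing 1/(Q;Q)_i as the sum over s + 2r = i of
   Q^(s(s-1)/2) / ((Q;Q)_s (Q^2;Q^2)_r) and summing over k at fixed M = i + 2j - k
   (Durfee rectangles) leaves a sum over M, j, r whose exponent is a complete square
   in M plus a part in j, r.  By Euler, the sum over a parity class of j is half of
   (-Q^-r;Q)_oo, because (Q^-r;Q)_oo = 0 for r >= 0.  Hence the first sum is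
     (-Q;Q)_oo / (Q;Q)_oo * ( sum_n q^(n^2-n) * sum_n Q^(n^2) / (Q;Q)_(2n)
                              + q sum_n q^(n^2) * sum_n Q^(n^2+n) / (Q;Q)_(2n+1) )
   with n over Z in the theta series, and similarly for the second one.  The
   single sums over (Q;Q)_(2n) and (Q;Q)_(2n+1) reduce, through Gauss's
   evaluations of alternating q-binomial sums, to the Rogers-Ramanujan functions
   at Q^4 and -Q.  Splitting the theta series by n mod 5 gives the three summands
   of the right-hand side; each is a combination of two theta products which
   collapses to one product, either trivially or by splitting a double theta
   series over (u, v) according to the parity of u + v. *)

Require Import Defs.
From mathcomp Require Import all_boot all_order all_algebra finmap zify ring lra.
From mathcomp Require Import complex.
From mathcomp Require Import all_classical all_reals topology normedtype sequences.
From mathcomp Require Import summability.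

Set Implicit Arguments.
Unset Strict Implicit.
Unset Printing Implicit Defensive.

Import Order.TTheory GRing.Theory Num.Theory numFieldNormedType.Exports.

Local Open Scope fset_scope.
Local Open Scope ring_scope.

(** Why the steps fit together: with i = M - 2j + k the exponent satisfies E(M - 2j + k, j, k) = E(M
    - 2j, j, 0) + 5k(k+1)/2. A Durfee sum in base Q needs 5k^2, and the factor Q^(s(s-1)/2) created
    by splitting 1/(Q;Q)_i supplies the missing half. The square left in M is centred near 5j +
    5r/2, so r is split by parity and M is traded for an integer n tied to j only by a parity
    condition. That condition is the one obstacle to separating the theta series from the rest, and
    the vanishing alternating sum removes it. Sums run over all of Z, with 1/(q;q)_n = 0 for n < 0:
    shifts and reflections are then bijections of the index set and recurrences have no boundary
    terms. Most series identities compare two evaluations of one unconditional sum, so absolute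
    summability is settled before each resummation. Generating functions occur only through their
    coefficients or their functional equations. Negative powers of q appear throughout, which
    excludes q = 0; there the sums just count the zeros of the exponents. In the end every product
    is a monomial in (x^k;x^10)_oo and (-x^k;x^10)_oo with x = Q. *)

Section ComplexNorm.
Variable R : realType.
Implicit Types x y : R[i].

(** The norm of [R[i]] takes values in [R[i]]; a copy with values in [R] lets estimates be carried
    out in a real field. *)
Definition cnorm x : R := Normc.normc x.

Lemma normE x : `|x| = (cnorm x)%:C%C. Proof. by []. Qed.
Lemma cnorm0 : cnorm 0 = 0. Proof. exact: Normc.normc0. Qed.
Lemma cnorm1 : cnorm 1 = 1. Proof. exact: Normc.normc1. Qed.
Lemma cnormM x y : cnorm (x * y) = cnorm x * cnorm y. Proof. exact: Normc.normcM. Qed.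
Lemma cnormV x : cnorm x^-1 = (cnorm x)^-1. Proof. exact: Normc.normcV. Qed.
Lemma cnormD x y : cnorm (x + y) <= cnorm x + cnorm y. Proof. exact: le_normcD. Qed.
Lemma cnormN x : cnorm (- x) = cnorm x. Proof. exact: normcN. Qed.
Lemma cnorm_ge0 x : 0 <= cnorm x. Proof. by rewrite /cnorm /Normc.normc; case: x => a b;
  exact: sqrtr_ge0. Qed.
Lemma cnorm_eq0 x : cnorm x = 0 -> x = 0. Proof. exact: Normc.eq0_normc. Qed.
Lemma cnorm_gt0 x : x != 0 -> 0 < cnorm x.
Proof.
move=> x0; rewrite lt_def cnorm_ge0 andbT; apply: contra x0 => /eqP/cnorm_eq0 ->; exact: eqxx.
Qed.
Lemma cnormX x n : cnorm (x ^+ n) = cnorm x ^+ n.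
Proof. by elim: n => [|n IH]; rewrite ?expr0 ?cnorm1 // !exprS cnormM IH. Qed.
Lemma cnormXz x (n : int) : cnorm (x ^ n) = cnorm x ^ n.
Proof. by case: n => n; rewrite ?NegzE -?exprnN ?cnormV -?exprnP ?cnormX. Qed.
Lemma cnorm_sum (I : Type) (r : seq I) (F : I -> R[i]) :
  cnorm (\sum_(i <- r) F i) <= \sum_(i <- r) cnorm (F i).
Proof.
elim: r => [|a r IH]; first by rewrite !big_nil cnorm0.
by rewrite !big_cons (le_trans (cnormD _ _)) // lerD2l.
Qed.
Lemma cnorm_lt1 x : `|x| < 1 -> cnorm x < 1.
Proof. by rewrite normE -[1]/(1%:C%C) ltcR. Qed.
End ComplexNorm.

(** * Unconditional sums of complex families *)

Section UnorderedSums.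
Variable R : realType.
Local Notation C := R[i].
Implicit Types T U V : choiceType.

Definition has_sum T (f : T -> C) (s : C) : Prop :=
  (partial_sum (f : T -> C^o) @ totally --> (s : C^o))%classic.

Lemma partial_sumE T (f : T -> C) (A : {fset T}) :
  partial_sum (f : T -> C^o) A = \sum_(x <- A) f x.
Proof. by rewrite /partial_sum big_seq_fsetE. Qed.

Lemma has_sumP T (f : T -> C) s : has_sum f s <->
  forall e : R, 0 < e -> exists A : {fset T}, forall B : {fset T}, A `<=` B ->
    cnorm (\sum_(x <- B) f x - s) < e.
Proof.
split.
- move=> /(@cvgrPdist_lt _ C^o _ _ (@totally_filter T)) H e e0.
  have eC : 0 < e%:C%C by rewrite ltcR.
  have [A _ HA] := H _ eC.
  exists A => B /HA; rewrite /= partial_sumE distrC normE ltcR.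
  by [].
- move=> H; apply/(@cvgrPdist_lt _ C^o _ _ (@totally_filter T)) => e e0.
  have eE : e = (complex.Re e)%:C%C by rewrite RRe_real // gtr0_real.
  have /H[A HA] : 0 < complex.Re e by move: e0; rewrite eE ltcR.
  exists A => // B /HA; rewrite /= partial_sumE distrC normE [in X in _ -> X]eE ltcR.
  by [].
Qed.

Lemma small_dist_eq (x y : C) : (forall e : R, 0 < e -> cnorm (x - y) <= e) -> x = y.
Proof.
move=> H; apply/eqP; rewrite -subr_eq0; apply/negPn/negP => /cnorm_gt0 xy0.
have := H (cnorm (x - y) / 2) ltac:(by rewrite divr_gt0). lra.
Qed.

Lemma has_sum_uniq T (f : T -> C) s t : has_sum f s -> has_sum f t -> s = t.
Proof.
move=> /has_sumP Hs /has_sumP Ht; apply: small_dist_eq => e e0.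
have e2 : 0 < e / 2 by rewrite divr_gt0.
have [A HA] := Hs _ e2; have [B HB] := Ht _ e2.
have := HA _ (fsubsetUl A B); have := HB _ (fsubsetUr A B).
set u := \sum_(_ <- _) _ => h1 h2.
have -> : s - t = (u - t) - (u - s) by ring.
have := cnormD (u - t) (- (u - s)); rewrite cnormN; lra.
Qed.

Lemma has_sumD T (f g : T -> C) s t :
  has_sum f s -> has_sum g t -> has_sum (fun x => f x + g x) (s + t).
Proof.
move=> /has_sumP Hs /has_sumP Ht; apply/has_sumP => e e0.
have e2 : 0 < e / 2 by rewrite divr_gt0.
have [A HA] := Hs _ e2; have [B HB] := Ht _ e2.
exists (A `|` B) => D; rewrite fsubUset => /andP[/HA hA /HB hB].
rewrite big_split /=; move: hA hB; set u := \sum_(_ <- _) f _; set v := \sum_(_ <- _) _.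
have -> : u + v - (s + t) = (u - s) + (v - t) by ring.
have := cnormD (u - s) (v - t); lra.
Qed.

Lemma has_sumZ T (f : T -> C) (c : C) s : has_sum f s -> has_sum (fun x => c * f x) (c * s).
Proof.
move=> /has_sumP Hs; apply/has_sumP => e e0.
have c0 : 0 < cnorm c + 1 by have := cnorm_ge0 c; lra.
have [A HA] := Hs _ (divr_gt0 e0 c0).
exists A => B /HA; rewrite -mulr_sumr -mulrBr cnormM ltr_pdivlMr // => h.
apply: le_lt_trans h; rewrite mulrC ler_wpM2l ?cnorm_ge0 //; lra.
Qed.

Arguments has_sumZ {T f} c {s}.

Lemma has_sumZr T (f : T -> C) (c : C) s : has_sum f s -> has_sum (fun x => f x * c) (s * c).
Proof.
by move=> /(has_sumZ c); rewrite mulrC; under [X in has_sum X]eq_fun do rewrite mulrC.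
Qed.

Arguments has_sumZr {T f} c {s}.

Lemma has_sumN T (f : T -> C) s : has_sum f s -> has_sum (fun x => - f x) (- s).
Proof.
by move=> /(has_sumZ (-1)); rewrite mulN1r; under [X in has_sum X]eq_fun do rewrite mulN1r.
Qed.

Lemma has_sumB T (f g : T -> C) s t :
  has_sum f s -> has_sum g t -> has_sum (fun x => f x - g x) (s - t).
Proof. by move=> Hf /has_sumN Hg; exact: has_sumD Hf Hg. Qed.

Lemma has_sum_finite T (r : seq T) (f : T -> C) :
  uniq r -> (forall x, x \notin r -> f x = 0) -> has_sum f (\sum_(x <- r) f x).
Proof.
move=> Ur Hr; apply/has_sumP => e e0; exists [fset x in r] => B /fsubsetP rB.
suff -> : \sum_(x <- B) f x = \sum_(x <- r) f x by rewrite subrr cnorm0.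
rewrite (bigID (mem r)) /= [X in _ + X]big1 ?addr0 => [|x /Hr //].
rewrite -big_filter; apply: perm_big; apply: uniq_perm => //.
  by rewrite filter_uniq // fset_uniq.
move=> x; rewrite mem_filter; case xr : (x \in r) => //=.
by apply: rB; rewrite !inE.
Qed.

(** Change of index and extension by zero in one statement. Finite subsets of the two index types
    are matched through a partial inverse [pre] of [h]; points outside the range contribute
    nothing. *)
Lemma has_sum_inj V T (h : V -> T) (f : T -> C) s : injective h ->
  (forall t, (forall v, t <> h v) -> f t = 0) ->
  has_sum f s <-> has_sum (fun v => f (h v)) s.
Proof.
move=> hI f0.
have imE (A : {fset V}) (B : {fset T}) : [fset h v | v in A] `<=` B ->
    exists2 A' : {fset V}, A `<=` A' & \sum_(x <- B) f x = \sum_(v <- A') f (h v).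
  move=> AB.
  pose pre t : option V :=
    if pselect (exists v, t = h v) is left e then Some (projT1 (cid e)) else None.
  have preK v : pre (h v) = Some v.
    rewrite /pre; case: pselect => [e|]; last by case; exists v.
    by case: cid => w /= /hI ->.
  exists [fset v in pmap pre B].
    apply/fsubsetP => v vA; rewrite inE mem_pmap; apply/mapP; exists (h v) => //.
    by apply: (fsubsetP AB); apply/imfsetP; exists v.
  have Ur : uniq (pmap pre B).
    apply: (@pmap_uniq _ _ pre (fun v => h v)) (fset_uniq B).
    move=> t; rewrite /pre; case: pselect => //= e; by case: cid.
  transitivity (\sum_(v <- pmap pre B) f (h v)); last first.
    by apply: perm_big; apply: uniq_perm; rewrite ?Ur ?fset_uniq // => v; rewrite inE.
  elim: (enum_fset B) => [|t r IH] /=; first by rewrite !big_nil.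
  rewrite big_cons IH; case E: (pre t) => [v|] /=.
    rewrite big_cons; move: E; rewrite /pre; case: pselect => // e [<-].
    by case: cid => w /= <-.
  rewrite f0 ?add0r // => v tv; move: E; rewrite /pre.
  by case: pselect => // ne; case: ne; exists v.
split=> /has_sumP H; apply/has_sumP => e e0; have [A HA] := H e e0.
- have [A' AA'] : exists A' : {fset V}, forall v, h v \in A -> v \in A'.
    pose pre t : option V :=
      if pselect (exists v, t = h v) is left e then Some (projT1 (cid e)) else None.
    exists [fset v in pmap pre A] => v vA; rewrite inE mem_pmap; apply/mapP.
    exists (h v) => //; rewrite /pre; case: pselect => [e1|]; last by case; exists v.
    by case: cid => w /= /hI ->.
  exists A' => B A'B.
  (* The set [A] is enlarged by the image of [B]. A point of [A] outside that image is off the range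
     of [h], since [A'] already contains every preimage of a point of [A]. *)
  have /HA : A `<=` A `|` [fset h v | v in B] by rewrite fsubsetUl.
  suff -> : \sum_(x <- A `|` [fset h v | v in B]) f x = \sum_(v <- B) f (h v) by [].
  have /imE : [fset h v | v in B] `<=` A `|` [fset h v | v in B] by rewrite fsubsetUr.
  rewrite (bigID (mem [fset h v | v in B])) /=.
  rewrite [X in _ + X]big_seq_cond [X in _ + X]big1 => [_|x].
    rewrite addr0 -big_filter.
    rewrite (perm_big (map h B)) ?big_map //.
    apply: uniq_perm; first by rewrite filter_uniq // fset_uniq.
      by rewrite map_inj_uniq // fset_uniq.
    move=> t; rewrite mem_filter inE; apply/andP/mapP.
      by case=> /imfsetP[v /= vB ->] _; exists v.
    move=> [v vB ->]; have vI : h v \in [fset h v | v in B].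
      by apply/imfsetP; exists v.
    by rewrite vI orbT.
  case/andP; rewrite inE => /orP[xA xB|->//]; apply: f0 => v xv.
  move/negP: xB; apply; apply/imfsetP; exists v => //.
  by apply: (fsubsetP A'B); apply: AA'; rewrite -xv.
- exists [fset h v | v in A] => B /imE[A' /HA + ->].
  by [].
Qed.

Lemma has_sum_bij V T (h : V -> T) (h' : T -> V) (f : T -> C) s :
  cancel h h' -> cancel h' h -> has_sum f s <-> has_sum (fun v => f (h v)) s.
Proof.
move=> hK h'K; apply: has_sum_inj; first exact: can_inj hK.
by move=> t /(_ (h' t)); rewrite h'K.
Qed.

(** That [g] is summable is a conclusion. The joint sum is compared with a finite rectangle over
    [B], whose second side [W] is large enough to make each of its rows accurate to e/(2n). *)
Lemma has_sum_fubini T U (F : T * U -> C) (g : T -> C) s :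
  has_sum F s -> (forall t, has_sum (fun u => F (t, u)) (g t)) -> has_sum g s.
Proof.
move=> /has_sumP HF Hg; apply/has_sumP => e e0.
have e2 : 0 < e / 2 by rewrite divr_gt0.
have [A HA] := HF _ e2.
exists [fset x.1 | x in A] => B AB.
(* The [+ 1] keeps the divisor positive when [B] is empty. *)
pose n : R := (#|` B|)%:R + 1.
have n0 : 0 < n by rewrite ltr_wpDl.
have en : 0 < e / 2 / n by rewrite divr_gt0.
have /choice[D HD] : forall t, exists D : {fset U}, forall D' : {fset U}, D `<=` D' ->
    cnorm (\sum_(u <- D') F (t, u) - g t) < e / 2 / n.
  by move=> t; have /has_sumP /(_ _ en) := Hg t.
pose W : {fset U} := [fset x.2 | x in A] `|` \bigcup_(t <- B) D t.
have /HA : A `<=` B `*` W.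
  apply/fsubsetP => -[t u] tuA; rewrite inE /=; apply/andP; split.
    by apply: (fsubsetP AB); apply/imfsetP; exists (t, u).
  by rewrite inE; apply/orP; left; apply/imfsetP; exists (t, u).
have -> : \sum_(x <- B `*` W) F x = \sum_(t <- B) \sum_(u <- W) F (t, u).
  rewrite eq_big_imfset2 ?big_allpairs_dep //=; last by move=> [? ?] [? ?] _ _ /= [-> ->].
move=> h1.
have h2 : cnorm (\sum_(t <- B) g t - \sum_(t <- B) \sum_(u <- W) F (t, u)) <= e / 2.
  rewrite -sumrB (le_trans (cnorm_sum _ _)) //.
  apply: (@le_trans _ _ (\sum_(t <- B) e / 2 / n)).
    rewrite big_seq [leRHS]big_seq; apply: ler_sum => t tB.
    rewrite -cnormN opprB ltW // HD //.
    by rewrite /W fsubsetU // orbC bigfcup_sup.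
  rewrite big_const_seq iter_addr_0 count_predT -(mulr_natr _ (size _)).
  by rewrite -[leRHS](@divfK _ n) ?gt_eqF // ler_wpM2l ?ltW // /n ltrDl.
have -> : \sum_(t <- B) g t - s = (\sum_(t <- B) g t - \sum_(t <- B) \sum_(u <- W) F (t, u))
   + (\sum_(t <- B) \sum_(u <- W) F (t, u) - s) by ring.
by have := cnormD (\sum_(t <- B) g t - \sum_(t <- B) \sum_(u <- W) F (t, u)) (\sum_(t <- B)
  \sum_(u <- W) F (t, u) - s); lra.
Qed.

End UnorderedSums.
Arguments has_sumZ {R T f} c {s}.
Arguments has_sumZr {R T f} c {s}.

(** * Absolute summability and its criteria *)

Section AbsoluteSummability.
Variable R : realType.
Local Notation C := R[i].
Implicit Types T U V : choiceType.

Definition abs_summable T (f : T -> C) : Prop :=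
  exists B : R, forall A : {fset T}, \sum_(x <- A) cnorm (f x) <= B.

Lemma cnorm_ge_Re (x : C) : `|complex.Re x| <= cnorm x.
Proof. by have := normc_ge_Re x; rewrite normE lecR. Qed.

Lemma cnorm_ge_Im (x : C) : `|complex.Im x| <= cnorm x.
Proof.
have := cnorm_ge_Re (x * 'i%C); rewrite ReiNIm normrN cnormM.
suff -> : cnorm ('i%C : C) = 1 by rewrite mulr1.
by rewrite /cnorm /Normc.normc /= expr0n expr1n add0r sqrtr1.
Qed.

Lemma cnorm_real (x : R) : cnorm x%:C%C = `|x|.
Proof. by rewrite /cnorm /Normc.normc /= expr0n addr0 sqrtr_sqr. Qed.

Lemma sum_fset_incl T (g : T -> R) (A B : {fset T}) : A `<=` B ->
  (forall x, 0 <= g x) -> \sum_(x <- A) g x <= \sum_(x <- B) g x.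
Proof.
move=> /fsubsetP AB g0; rewrite [leRHS](bigID (mem A)) /= -[in leRHS]big_filter.
rewrite (_ : \sum_(x <- [seq x <- B | x \in A]) g x = \sum_(x <- A) g x); last first.
  apply: perm_big.
  apply: uniq_perm; rewrite ?filter_uniq ?fset_uniq // => x.
  by rewrite mem_filter; apply/andP/idP => [[]//|xA]; split=> //; exact: AB.
by rewrite lerDl sumr_ge0.
Qed.

Lemma has_sum_nonneg T (g : T -> R) (B : R) : (forall x, 0 <= g x) ->
  (forall A : {fset T}, \sum_(x <- A) g x <= B) -> exists s, has_sum (fun x => (g x)%:C%C) s.
Proof.
move=> g0 gB.
pose E := [set y : R | exists A : {fset T}, y = \sum_(x <- A) g x]%classic.
have hE : has_sup E.
  split; first by exists (\sum_(x <- fset0) g x); exists fset0.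
  by exists B => y [A ->].
exists (sup E)%:C%C; apply/has_sumP => e e0.
have [y [A ->] yE] := sup_adherent e0 hE.
exists A => D AD; rewrite -raddf_sum -rmorphB cnorm_real /=.
have le1 : \sum_(x <- D) g x <= sup E by apply: ub_le_sup; [case: hE|exists D].
have le2 := sum_fset_incl AD g0.
by rewrite ltr_norml; apply/andP; split; lra.
Qed.

(** Reduction to nonnegative families, where the supremum is the sum: |f|, |f| + Re f and |f| + Im f
    are nonnegative with bounded partial sums, and f is a combination of the three. *)
Lemma abs_summable_has_sum T (f : T -> C) : abs_summable f -> exists s, has_sum f s.
Proof.
case=> B fB; have f0 x := cnorm_ge0 (f x).
have [a Ha] := has_sum_nonneg f0 fB.
have part (p : C -> R) : (forall x, `|p x| <= cnorm x) ->
    exists s, has_sum (fun x => (cnorm (f x) + p (f x))%:C%C) s.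
  move=> p_le; apply: (@has_sum_nonneg _ _ (2 * B)) => [x|A].
    have := p_le (f x); rewrite ler_norml; move=> /andP[]; lra.
  have := fB A; have : \sum_(x <- A) p (f x) <= \sum_(x <- A) cnorm (f x).
    by apply: ler_sum => x _; apply: le_trans (p_le _); exact: ler_norm.
  rewrite big_split /=; lra.
have [b Hb] := part _ cnorm_ge_Re; have [c Hc] := part _ cnorm_ge_Im.
exists (b - a + 'i%C * (c - a)).
have := has_sumD (has_sumB Hb Ha) (has_sumZ 'i%C (has_sumB Hc Ha)).
congr has_sum; apply/funext => x; rewrite [RHS]complexE -!rmorphB.
by congr (_%:C%C + _ * _%:C%C); ring.
Qed.

Lemma abs_summable_le T (f g : T -> C) (c : R) :
  (forall x, cnorm (f x) <= c * cnorm (g x)) -> abs_summable g -> abs_summable f.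
Proof.
move=> fg [B gB]; exists (`|c| * B) => A.
apply: (@le_trans _ _ (`|c| * \sum_(x <- A) cnorm (g x))); last by rewrite ler_wpM2l.
rewrite mulr_sumr; apply: ler_sum => x _; apply: le_trans (fg x) _.
by rewrite ler_wpM2r ?cnorm_ge0 ?ler_norm.
Qed.

Lemma abs_summable_inj V T (h : V -> T) (f : T -> C) : injective h -> abs_summable f ->
  abs_summable (fun v => f (h v)).
Proof.
move=> hI [B fB]; exists B => A; apply: le_trans (fB [fset h v | v in A]).
by rewrite eq_big_imfset /= ?big_map //; move=> x y _ _; exact: hI.
Qed.

Lemma abs_summable_prod T U (f : T -> C) (g : U -> C) : abs_summable f -> abs_summable g ->
  abs_summable (fun x : T * U => f x.1 * g x.2).
Proof.
move=> [B fB] [D gD]; exists (B * D) => A.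
pose A1 := [fset x.1 | x in A]; pose A2 := [fset x.2 | x in A].
have AA : A `<=` A1 `*` A2.
  apply/fsubsetP => x xA; rewrite inE /=; apply/andP.
  by split; apply/imfsetP; exists x.
apply: le_trans (sum_fset_incl AA _) _ => [x|]; first exact: cnorm_ge0.
rewrite eq_big_imfset2 ?big_allpairs_dep //=; last by move=> [? ?] [? ?] _ _ /= [-> ->].
apply: (@le_trans _ _ ((\sum_(x <- A1) cnorm (f x)) * \sum_(y <- A2) cnorm (g y))).
  rewrite mulr_suml; apply: ler_sum => x _; rewrite mulr_sumr.
  by apply: ler_sum => y _; rewrite cnormM.
have D0 : 0 <= D by have := gD fset0; rewrite big_seq_fset0.
apply: ler_pM => //; by apply: sumr_ge0 => *; exact: cnorm_ge0.
Qed.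

Lemma has_sum_nm_le T (f : T -> C) (B : R) s : has_sum f s ->
  (forall A : {fset T}, \sum_(x <- A) cnorm (f x) <= B) -> cnorm s <= B.
Proof.
move=> /has_sumP Hf fB; apply/ler_addgt0Pr => e e0.
have [A /(_ A (fsubset_refl _))] := Hf _ e0.
have := le_trans (cnorm_sum A f) (fB A); set t := \sum_(_ <- _) _ => tB h.
have := cnormD t (- (t - s)); rewrite cnormN; have -> : t - (t - s) = s by ring.
lra.
Qed.

Lemma abs_summable_nat_geom (r : R) : 0 <= r -> r < 1 -> abs_summable (fun n : nat => (r ^+
  n)%:C%C : C).
Proof.
move=> r0 r1; exists (1 - r)^-1 => A.
have [N AN] : exists N, forall n, n \in A -> (n < N)%N.
  exists (\max_(n <- A) n).+1 => n nA; rewrite ltnS.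
  by rewrite (big_rem n) //= leq_maxl.
apply: (@le_trans _ _ (\sum_(n <- [fset n in iota 0 N]) r ^+ n)).
  under eq_bigr do rewrite cnorm_real ger0_norm ?exprn_ge0 //.
  apply: sum_fset_incl => [|n]; last exact: exprn_ge0.
  by apply/fsubsetP => n /AN; rewrite inE mem_iota.
have -> : \sum_(n <- [fset n in iota 0 N]) r ^+ n = \sum_(n <- iota 0 N) r ^+ n.
  apply: perm_big.
  by apply: uniq_perm; rewrite ?fset_uniq ?iota_uniq // => n; rewrite !inE.
have -> : iota 0 N = index_iota 0 N by rewrite /index_iota subn0.
rewrite big_mkord; have r10 : 0 < 1 - r by lra.
rewrite -(ler_pM2l r10) divff ?gt_eqF // mulrC.
have -> : (\sum_(i < N) r ^+ i) * (1 - r) = 1 - r ^+ N.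
  by rewrite -opprB mulrN mulrC -subrX1 opprB.
by have := exprn_ge0 N r0; lra.
Qed.

Lemma abs_summable_int_geom (r : R) : 0 <= r -> r < 1 ->
  abs_summable (fun n : int => (r ^+ `|n|%N)%:C%C : C).
Proof.
move=> r0 r1; have [B HB] := abs_summable_nat_geom r0 r1.
exists (B + B) => A.
rewrite (bigID (fun n : int => (0 <= n)%R)) /=.
have half (P : pred int) : {in P &, injective (fun n : int => `|n|%N)} ->
    \sum_(n <- A | P n) cnorm ((r ^+ `|n|%N)%:C%C : C) <= B.
  move=> PI; rewrite -big_filter.
  pose A' := [fset `|n|%N | n in [fset n in A | P n]].
  apply: le_trans (HB A'); rewrite eq_big_imfset /=; last first.
    by move=> x y; rewrite !inE /= => /andP[_ Px] /andP[_ Py]; exact: PI.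
  rewrite big_map le_eqVlt; apply/orP; left; apply/eqP.
  apply: perm_big; apply: uniq_perm; rewrite ?filter_uniq ?fset_uniq // => n.
  by rewrite mem_filter !inE /= andbC.
apply: lerD; apply: half => x y; rewrite /in_mem /= ?/in_mem /= -?ltNge.
  by lia.
by lia.
Qed.
End AbsoluteSummability.
Arguments abs_summable_le {R T f} g c.

(** * Limits of sequences and a lower bound for products *)

Section ComplexSequences.
Variable R : realType.
Local Notation C := R[i].
Implicit Types (u v : nat -> C) (r : R).

Definition tends u (l : C) : Prop :=
  forall e : R, 0 < e -> exists N, forall n, (N <= n)%N -> cnorm (u n - l) < e.

Lemma tends_uniq u l l' : tends u l -> tends u l' -> l = l'.
Proof.
move=> H H'; apply: small_dist_eq => e e0.
have e2 : 0 < e / 2 by rewrite divr_gt0.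
have [N HN] := H _ e2; have [N' HN'] := H' _ e2.
have := HN _ (leq_maxl N N'); have := HN' _ (leq_maxr N N').
set x := u _ => h1 h2; have -> : l - l' = (x - l') - (x - l) by ring.
have := cnormD (x - l') (- (x - l)); rewrite cnormN; lra.
Qed.

Lemma tends_cst (l : C) : tends (fun=> l) l.
Proof. by move=> e e0; exists 0%N => n _; rewrite subrr cnorm0. Qed.

Lemma tends_small u (w : nat -> R) l :
  (forall n, cnorm (u n - l) <= w n) -> (forall e, 0 < e -> exists N, forall n, (N <= n)%N -> w n
    < e) ->
  tends u l.
Proof.
by move=> uw Hw e /Hw[N HN]; exists N => n /HN; apply: le_lt_trans.
Qed.

Lemma tends_bounded u l : tends u l -> exists N, forall n, (N <= n)%N -> cnorm (u n) <= cnorm l + 1.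
Proof.
move=> /(_ 1 ltr01)[N HN]; exists N => n /HN h.
have -> : u n = (u n - l) + l by ring.
by have := cnormD (u n - l) l; lra.
Qed.

Lemma tendsM u v k l : tends u k -> tends v l -> tends (fun n => u n * v n) (k * l).
Proof.
move=> H H' e e0.
have [M HM] := tends_bounded H.
have k1 : 0 < cnorm k + 1 by have := cnorm_ge0 k; lra.
have l1 : 0 < cnorm l + 1 by have := cnorm_ge0 l; lra.
have [N HN] := H _ (divr_gt0 (divr_gt0 e0 (ltr0n _ 2)) l1).
have [N' HN'] := H' _ (divr_gt0 (divr_gt0 e0 (ltr0n _ 2)) k1).
exists (maxn M (maxn N N')) => n.
rewrite !geq_max => /andP[/HM h0 /andP[/HN + /HN' ]].
rewrite !ltr_pdivlMr // => h1 h2.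
have -> : u n * v n - k * l = u n * (v n - l) + (u n - k) * l by ring.
apply: le_lt_trans (cnormD _ _) _; rewrite !cnormM.
have := cnorm_ge0 (v n - l); have := cnorm_ge0 (u n - k); nra.
Qed.

Lemma tends_shift u l k : tends u l -> tends (fun n => u (n + k)%N) l.
Proof.
move=> H e /H[N HN]; exists N => n Nn; apply: HN.
by rewrite (leq_trans Nn) ?leq_addr.
Qed.

Lemma tends_sub u l (h : nat -> nat) : (forall n, (n <= h n)%N) ->
  tends u l -> tends (fun n => u (h n)) l.
Proof.
move=> hh H e /H[N HN]; exists N => n Nn; apply: HN.
exact: leq_trans (hh n).
Qed.

Lemma tends_lim u l : tends u l -> lim ((u : nat -> C^o) @ \oo)%classic = l.
Proof.
move=> H; apply: (@cvg_lim C^o); first exact: norm_hausdorff.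
apply/(@cvgrPdist_lt _ C^o) => e e0.
have eE : e = (complex.Re e)%:C%C by rewrite RRe_real // gtr0_real.
have /H[N HN] : 0 < complex.Re e by move: e0; rewrite eE ltcR.
exists N => // n /HN; rewrite /= distrC normE [in X in _ -> X]eE ltcR.
by [].
Qed.

Lemma expr_small r (e : R) : 0 <= r -> r < 1 -> 0 < e ->
  exists N, forall n, (N <= n)%N -> r ^+ n < e.
Proof.
move=> r0 r1 e0; have /(@cvg_expr R) : `|r| < 1 by rewrite ger0_norm.
move=> /cvgrPdist_lt /(_ _ e0)[N _ HN]; exists N => n /HN /=.
by rewrite sub0r normrN ger0_norm ?exprn_ge0.
Qed.

(** A finite head is positive, and the tail is at least one minus the corresponding tail of the
    geometric series. *)
Lemma prod_lower_bound r y : 0 <= r -> r < 1 -> 0 <= y -> y < 1 ->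
  exists2 c : R, 0 < c & forall n, c <= \prod_(k < n) (1 - y * r ^+ k).
Proof.
move=> r0 r1 y0 y1.
have rk k : 0 <= y * r ^+ k by rewrite mulr_ge0 ?exprn_ge0.
have rk1 k : y * r ^+ k < 1.
  by apply: le_lt_trans y1; rewrite ler_piMr // exprn_ile1 // ltW.
(* With r^K below (1 - r)/2 the geometric tail r^K/(1 - r) is at most 1/2, so the tail product keeps
   at least half of its value. *)
have s0 : 0 < (1 - r) / 2 by lra.
have [K HK] := expr_small r0 r1 s0; have {HK} HK := HK K (leqnn K).
have pos n : 0 < \prod_(k < n) (1 - y * r ^+ k).
  by apply: prodr_gt0 => k _; rewrite subr_gt0.
have tail n : 1 - (\sum_(k < n) r ^+ (K + k)) <= \prod_(k < n) (1 - y * r ^+ (K + k)).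
  elim: n => [|n IH]; first by rewrite !big_ord0 subr0.
  rewrite !big_ord_recr /=.
  have P1 : \prod_(k < n) (1 - y * r ^+ (K + k)) <= 1.
    by apply: prodr_ile1 => k _; rewrite gerBl rk subr_ge0 (ltW (rk1 _)).
  have r_ge := exprn_ge0 (K + n) r0.
  have yr : y * r ^+ (K + n) <= r ^+ (K + n) by rewrite ler_piMl // ltW.
  move: IH P1 yr (rk (K + n)%N) r_ge.
  set p := \prod_(k < n) _; set s := \sum_(k < n) _; set x := y * _; set z := r ^+ _.
  nra.
have tail2 n : \sum_(k < n) r ^+ (K + k) <= 1 / 2.
  have -> : \sum_(k < n) r ^+ (K + k) = r ^+ K * \sum_(k < n) r ^+ k.
    by rewrite mulr_sumr; apply: eq_bigr => k _; rewrite exprD.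
  have g : (1 - r) * \sum_(k < n) r ^+ k = 1 - r ^+ n.
    by rewrite -opprB mulNr -subrX1 opprB.
  have := exprn_ge0 n r0; have := exprn_ge0 K r0.
  move: g HK; set s := \sum_(k < n) _ => g HK rK rn.
  have s_ge : 0 <= s by apply: sumr_ge0 => k _; exact: exprn_ge0.
  have := ler_wpM2r s_ge (ltW HK); lra.
exists (\prod_(k < K) (1 - y * r ^+ k) / 2) => [|n]; first by rewrite divr_gt0.
apply: (@le_trans _ _ (\prod_(k < K + n) (1 - y * r ^+ k))).
  rewrite big_split_ord /= ler_wpM2l ?(ltW (pos _)) //.
  apply: le_trans (tail n); have := tail2 n; set s := \sum_(_ < _) _; lra.
rewrite addnC big_split_ord /= ler_piMr ?(ltW (pos _)) //.
by apply: prodr_ile1 => k _; rewrite gerBl rk subr_ge0 (ltW (rk1 _)).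
Qed.
End ComplexSequences.

(** * q-Pochhammer symbols and quadratic exponents *)

Section QPochhammer.
Variable R : realType.
Local Notation C := R[i].
Implicit Types (a q : C).

Lemma qpochS (F : pzRingType) (a q : F) n :
  qpoch a q n.+1 = qpoch a q n * (1 - a * q ^+ n).
Proof. by rewrite /qpoch big_ord_recr. Qed.

Lemma qpoch0 (F : pzRingType) (a q : F) : qpoch a q 0 = 1.
Proof. by rewrite /qpoch big_ord0. Qed.

Lemma qpoch_lower_bound a q : cnorm a < 1 -> cnorm q < 1 ->
  exists2 c : R, 0 < c & forall n, c <= cnorm (qpoch a q n).
Proof.
move=> a1 q1; have [c c0 Hc] := prod_lower_bound (cnorm_ge0 q) q1 (cnorm_ge0 a) a1.
exists c => // n; apply: le_trans (Hc n) _.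
elim: n => [|n IH]; first by rewrite qpoch0 big_ord0 cnorm1.
rewrite qpochS cnormM big_ord_recr /=.
have aq : cnorm a * cnorm q ^+ n <= 1.
  by rewrite -[leRHS]mulr1 ler_pM ?cnorm_ge0 ?exprn_ge0 ?cnorm_ge0 ?exprn_ile1 ?cnorm_ge0 ?ltW.
apply: ler_pM => //.
- apply: prodr_ge0 => k _; rewrite subr_ge0 -[leRHS]mulr1 ler_pM //;
  by rewrite ?cnorm_ge0 ?exprn_ge0 ?cnorm_ge0 ?exprn_ile1 ?cnorm_ge0 ?ltW.
- by rewrite subr_ge0.
- have := cnormD (1 - a * q ^+ n) (a * q ^+ n); rewrite subrK cnorm1 cnormM cnormX; lra.
Qed.

Lemma qpoch_neq0 a q n : cnorm a < 1 -> cnorm q < 1 -> qpoch a q n != 0.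
Proof.
move=> a1 q1; have [c c0 Hc] := qpoch_lower_bound a1 q1.
by apply/eqP => E; have := Hc n; rewrite E cnorm0; lra.
Qed.

Lemma qpoch_inf_lim a q l : tends (qpoch a q) l -> qpoch_inf a q = l.
Proof. exact: tends_lim. Qed.

Lemma tends_neq0 a q l : cnorm a < 1 -> cnorm q < 1 -> tends (qpoch a q) l -> l != 0.
Proof.
move=> a1 q1 H; have [c c0 Hc] := qpoch_lower_bound a1 q1.
apply/eqP => l0; have [N /(_ N (leqnn N))] := H _ c0.
by rewrite l0 subr0; have := Hc N; lra.
Qed.

(* 1/(q;q)_n, extended by 0 to negative n *)
Definition rq q (n : int) : C := if n is Posz m then (qpoch q q m)^-1 else 0.

(** The binomial coefficient n choose 2, extended to negative n; the division is exact. *)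
Definition tri (n : int) : int := ((n ^+ 2 - n) %/ 2)%Z.

Lemma tri2 n : 2 * tri n = n ^+ 2 - n.
Proof.
have [t Ht] := sqrz_subl_even n.
by apply: (@double_halfz _ t); rewrite Ht addrK.
Qed.

(** A quadratic dominates |n| up to a constant, so theta-like series are compared with a geometric
    series over Z. *)
Lemma tri_growth (K n : int) : Posz `|n|%N - (Posz `|K|%N + 2) ^+ 2 <= tri n + K * n.
Proof. have := tri2 n; nia. Qed.

Variable q : C.
Hypotheses (q0 : q != 0) (q1 : cnorm q < 1).

Lemma nmq_gt0 : 0 < cnorm q. Proof. exact: cnorm_gt0. Qed.

Lemma rq_neg n : n < 0 -> rq q n = 0.
Proof. by case: n. Qed.

Lemma rq0 : rq q 0 = 1.
Proof. by rewrite /rq /= qpoch0 invr1. Qed.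

Lemma rq_bounded : exists B : R, forall n, cnorm (rq q n) <= B.
Proof.
have [c c0 Hc] := qpoch_lower_bound q1 q1.
exists c^-1 => -[n|n]; rewrite /rq; last by rewrite cnorm0 invr_ge0 ltW.
by rewrite cnormV lef_pV2 ?posrE ?(lt_le_trans c0).
Qed.

Lemma oneBq_neq0 n : (0 < n)%N -> 1 - q ^+ n != 0.
Proof.
move=> n0; apply/eqP => E; have : q ^+ n = 1 by apply/eqP; rewrite eq_sym -subr_eq0 E.
move/(congr1 (@cnorm R)); rewrite cnormX cnorm1 => qn.
have : cnorm q ^+ n < 1 by rewrite exprn_ilt1 ?cnorm_ge0 // -lt0n.
by rewrite qn ltxx.
Qed.

(** At n = 0 the factor 1 - q^0 vanishes and so does 1/(q;q)_(-1); for n < 0 both sides are 0. The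
    recurrence thus holds on all of Z. *)
Lemma rqS n : rq q (n - 1) = (1 - q ^ n) * rq q n.
Proof.
case: n => [[|n]|n]; first by rewrite expr0z subrr mul0r.
  rewrite (_ : Posz n.+1 - 1 = n); last by lia.
  rewrite /rq qpochS -exprS invfM [RHS]mulrC -mulrA mulVf ?mulr1 //.
  exact: oneBq_neq0.
by rewrite !rq_neg ?mulr0 //; lia.
Qed.

Lemma qexpD m n : q ^ (m + n) = q ^ m * q ^ n.
Proof. exact: expfzDr. Qed.

Lemma cnorm_exp_le (m n : int) : m <= n -> cnorm (q ^ n) <= cnorm (q ^ m).
Proof.
move=> mn; rewrite (_ : n = m + (n - m)); last by lia.
rewrite qexpD cnormM ler_piMr ?cnorm_ge0 //.
have [k ->] : exists k : nat, n - m = k by exists `|n - m|%N; lia.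
by rewrite -exprnP cnormX exprn_ile1 ?cnorm_ge0 // ltW.
Qed.

Lemma abs_summable_int_bound (f : int -> C) (c : R) (K : int) :
  (forall n, cnorm (f n) <= c * cnorm (q ^ (Posz `|n|%N - K))) -> abs_summable f.
Proof.
move=> fc; apply: (abs_summable_le (fun n : int => (cnorm q ^+ `|n|%N)%:C%C) (c * cnorm (q ^ (-
  K)))).
  move=> n; apply: le_trans (fc n) _.
  by rewrite qexpD cnormM -exprnP cnormX cnorm_real ger0_norm ?exprn_ge0 ?cnorm_ge0 // mulrCA mulrC.
by apply: abs_summable_int_geom => //; exact: cnorm_ge0.
Qed.

Lemma abs_summable_theta (K : int) : abs_summable (fun n => q ^ (tri n + K * n)).
Proof.
apply: (@abs_summable_int_bound _ 1 ((Posz `|K|%N + 2) ^+ 2)) => n.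
by rewrite mul1r cnorm_exp_le // tri_growth.
Qed.

(** Replaces an arbitrary z by a power of q, so that Euler's series in z is dominated by a theta
    series. *)
Lemma exp_dominates (z : C) : exists K : int, cnorm z <= cnorm (q ^ K).
Proof.
have z1 : 0 < (cnorm z + 1)^-1 by rewrite invr_gt0; have := cnorm_ge0 z; lra.
have [N /(_ N (leqnn N))] := expr_small (cnorm_ge0 q) q1 z1.
move=> h; exists (- N%:Z); rewrite cnormXz -exprnN.
have qN : 0 < cnorm q ^+ N by rewrite exprn_gt0 ?nmq_gt0.
apply: (@le_trans _ _ (cnorm z + 1)); first by rewrite lerDl.
by rewrite ltW // -[ltLHS]invrK ltf_pV2 ?posrE.
Qed.
End QPochhammer.

Lemma has_sum_prod (R : realType) (T U : choiceType) (f : T -> R[i]) (g : U -> R[i]) a b :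
  abs_summable f -> abs_summable g -> has_sum f a -> has_sum g b -> has_sum (fun x : T * U => f
    x.1 * g x.2) (a * b).
Proof.
move=> sf sg Hf Hg; have [s Hs] := abs_summable_has_sum (abs_summable_prod sf sg).
suff -> : a * b = s by [].
apply: (has_sum_uniq (has_sumZr b Hf)).
by apply: (has_sum_fubini Hs) => t /=; exact: has_sumZ.
Qed.

Lemma triB1 n : tri n = tri (n - 1) + (n - 1).
Proof. have := tri2 n; have := tri2 (n - 1); lia. Qed.

Lemma tri_reflect n : tri (- n) = tri n + n.
Proof. have := tri2 n; have := tri2 (- n); lia. Qed.

Lemma triD m n : tri (m + n) = tri m + tri n + m * n.
Proof. have := tri2 m; have := tri2 n; have := tri2 (m + n); lia. Qed.

(** * Euler's expansion, Durfee sums and the Jacobi triple product *)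

Section EulerJacobi.
Variables (R : realType) (q : R[i]).
Hypotheses (q0 : q != 0) (q1 : cnorm q < 1).
Local Notation C := R[i].

Lemma has_sum_shift (f : int -> C) (k : int) s : has_sum f s <-> has_sum (fun n => f (n + k)) s.
Proof.
by apply: (@has_sum_bij _ _ _ (fun n => n + k) (fun n => n - k)) => n; rewrite ?addrK ?subrK.
Qed.

(** The coefficient of z^n in Euler's expansion of (-z;q)_oo. *)
Definition euler_coef n : C := q ^ tri n * rq q n.

Lemma euler_coefS n : euler_coef n = q ^ n * euler_coef n + q ^ (n - 1) * euler_coef (n - 1).
Proof.
rewrite /euler_coef rqS // (triB1 n) !(qexpD q0); ring.
Qed.

Lemma cnorm_rq_theta : exists2 B : R, 0 <= B & forall n, cnorm (rq q n) <= B.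
Proof.
have [B HB] := rq_bounded q1; exists B => //.
by apply: le_trans (HB 0); exact: cnorm_ge0.
Qed.

Lemma abs_summable_euler (z : C) : abs_summable (fun n => euler_coef n * z ^ n).
Proof.
have [B B0 HB] := cnorm_rq_theta; have [K HK] := exp_dominates q0 q1 z.
apply: (abs_summable_le (fun n => q ^ (tri n + K * n)) B); last exact: abs_summable_theta.
move=> n; rewrite !cnormM (qexpD q0) cnormM -exprz_exp.
case: (ltP n 0) => [n0|n0].
  by rewrite rq_neg // cnorm0 mulr0 mul0r !mulr_ge0 ?cnorm_ge0.
have [m ->] : exists m : nat, n = m by exists `|n|%N; lia.
rewrite [X in X * _]mulrC -mulrA; apply: ler_pM => //; rewrite ?mulr_ge0 ?cnorm_ge0 //.
rewrite ler_wpM2l ?cnorm_ge0 // [leLHS]cnormXz [leRHS]cnormXz.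
by rewrite -!exprnP lerXn2r ?nnegrE ?cnorm_ge0.
Qed.

Lemma has_sum_delta (T : choiceType) (t : T) : has_sum (fun n => (n == t)%:R : C) 1.
Proof.
have := @has_sum_finite R T [:: t] (fun n => (n == t)%:R) isT.
rewrite big_seq1 eqxx; apply=> n; rewrite inE => /negbTE -> //.
Qed.

(** The series g satisfies g(w) = (1 + w) g(wq); iteration gives g(z) = (-z;q)_n g(z q^n), and g
    tends to 1 at 0. The convergence of the product comes out of the same argument, so [qpoch_inf]
    is a genuine limit here. *)
Lemma euler (z : C) : z != 0 ->
  tends (qpoch (- z) q) (qpoch_inf (- z) q) /\
  has_sum (fun n => euler_coef n * z ^ n) (qpoch_inf (- z) q).
Proof.
move=> z0.
have /choice[g Hg] : forall w : C, exists s, has_sum (fun n => euler_coef n * w ^ n) s.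
  by move=> w; apply: abs_summable_has_sum; exact: abs_summable_euler.
have gS w : w != 0 -> g w = (1 + w) * g (w * q).
  move=> w0; apply: (has_sum_uniq (Hg w)).
  have /(has_sum_shift _ (-1)) /(has_sumZ w) H := Hg (w * q).
  have := has_sumD (Hg (w * q)) H; rewrite mulrDl mul1r; congr has_sum.
  apply/funext => n; rewrite !expfzMl [in RHS]euler_coefS.
  rewrite (_ : w ^ n = w * w ^ (n - 1)); last first.
    by rewrite -[X in X * _]expr1z -expfzDr // addrC subrK.
  ring.
have gN n : g z = qpoch (- z) q n * g (z * q ^+ n).
  elim: n => [|n ->]; first by rewrite qpoch0 expr0 mulr1 mul1r.
  rewrite gS; last by rewrite mulf_neq0 ?expf_neq0.
  by rewrite qpochS exprSr mulrA; ring.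
have [D HD] := abs_summable_theta q0 q1 0.
have [B B0 HB] := cnorm_rq_theta.
have near1 w : cnorm w <= 1 -> cnorm (g w - 1) <= cnorm w * (B * D).
  move=> w1; apply: (has_sum_nm_le (has_sumB (Hg w) (has_sum_delta (0 : int)))) => A.
  apply: le_trans (_ : cnorm w * (B * \sum_(n <- A) cnorm (q ^ (tri n + 0 * n))) <= _); last first.
    by rewrite !ler_wpM2l ?cnorm_ge0.
  rewrite !mulr_sumr; apply: ler_sum => n _; rewrite mul0r addr0.
  case: (ltgtP n 0) => [n0|n0|->].
  - by rewrite mulr0n /euler_coef rq_neg // mulr0 mul0r subrr cnorm0 !mulr_ge0 ?cnorm_ge0.
  - have [m ->] : exists m : nat, n = m.+1 by exists (`|n|%N.-1); lia.
    rewrite mulr0n subr0 !cnormM.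
    have wm : cnorm (w ^ m.+1) <= cnorm w.
      by rewrite -exprnP cnormX exprS ler_piMr ?cnorm_ge0 ?exprn_ile1 ?cnorm_ge0.
    rewrite [leRHS](_ : _ = cnorm (q ^ tri m.+1) * B * cnorm w); last by ring.
    by rewrite ler_pM ?mulr_ge0 ?cnorm_ge0 // ler_wpM2l ?cnorm_ge0.
  - by rewrite mulr1n /euler_coef (_ : tri 0 = 0) // rq0 !expr0z !mulr1 subrr cnorm0 !mulr_ge0
    ?cnorm_ge0.
have D0 : 0 <= D by have := HD fset0; rewrite big_seq_fset0.
have gt : tends (fun n => g (z * q ^+ n)) 1.
  move=> e e0; have z1 := cnorm_gt0 z0.
  have BD : 0 < B * D + 1 by rewrite ltr_wpDl ?mulr_ge0.
  have [N1 HN1] := expr_small (cnorm_ge0 q) q1 (divr_gt0 ltr01 z1).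
  have [N2 HN2] := expr_small (cnorm_ge0 q) q1 (divr_gt0 (divr_gt0 e0 BD) z1).
  exists (maxn N1 N2) => n; rewrite geq_max => /andP[/HN1 + /HN2].
  rewrite !ltr_pdivlMr // -cnormX -!cnormM mulrC => h1 h2.
  apply: le_lt_trans (near1 _ (ltW h1)) _.
  apply: le_lt_trans h2; rewrite mulrC [q ^+ n * z]mulrC mulrC.
  by rewrite ler_wpM2l ?cnorm_ge0 // lerDl.
have gt2 : tends (qpoch (- z) q) (g z).
  (* Bounding the partial products first avoids a division by g(z), which is zero when z =
     -q^(-r). *)
  have [N HN] := gt (1 / 2) ltac:(by rewrite divr_gt0).
  have bd n : (N <= n)%N -> cnorm (qpoch (- z) q n) <= 2 * cnorm (g z).
    move=> /HN; set u := g _ => h; rewrite (gN n) -/u cnormM.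
    have := cnormD (- (u - 1)) u; rewrite cnormN (_ : - (u - 1) + u = 1); last by ring.
    rewrite cnorm1; have := cnorm_ge0 (qpoch (- z) q n); nra.
  move=> e e0; have gz : 0 < 2 * cnorm (g z) + 1 by have := cnorm_ge0 (g z); lra.
  have [M HM] := gt _ (divr_gt0 e0 gz).
  exists (maxn N M) => n; rewrite geq_max => /andP[/bd h1 /HM].
  rewrite ltr_pdivlMr // => h2; rewrite {1}(gN n).
  set u := g _ in h2 *; set p := qpoch _ _ _ in h1 *.
  have -> : p - p * u = - (p * (u - 1)) by ring.
  rewrite cnormN cnormM; apply: le_lt_trans h2; rewrite mulrC ler_wpM2l ?cnorm_ge0 //; lra.
by rewrite (qpoch_inf_lim gt2); split.
Qed.

Lemma qpoch_tends (a : C) : a != 0 -> tends (qpoch a q) (qpoch_inf a q).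
Proof. by move=> a0; have [] := @euler (- a); rewrite ?oppr_eq0 // opprK. Qed.

Lemma euler_sum (z : C) : z != 0 -> has_sum (fun n => euler_coef n * z ^ n) (qpoch_inf (- z) q).
Proof. by case/euler. Qed.

Lemma qpoch_inf_neq0 (a : C) : a != 0 -> cnorm a < 1 -> qpoch_inf a q != 0.
Proof. by move=> a0 a1; apply: tends_neq0 (qpoch_tends a0). Qed.

Lemma abs_summable_gauss (f : int -> C) (c : R) (M L : int) :
  (forall k, cnorm (f k) <= c * cnorm (q ^ (k ^+ 2 + M * k - L))) -> abs_summable f.
Proof.
move=> Hf; have c0 : 0 <= c.
  by have := le_trans (cnorm_ge0 _) (Hf 0); rewrite pmulr_lge0 // cnorm_gt0 // expfz_neq0.
apply: (abs_summable_int_bound q0 q1 (c := c) (K := (Posz `|M|%N + 1) ^+ 2 + L)) => k.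
apply: le_trans (Hf k) _; rewrite ler_wpM2l // cnorm_exp_le //; nia.
Qed.

(** The k-th contribution to the coefficient of z^N in (-z;q)_oo (-q/z;q)_oo. *)
Definition durfee_term (N k : int) : C := euler_coef (k + N) * (q ^ k * euler_coef k).

Lemma durfee_termE N k : durfee_term N k = q ^ tri N * (q ^ (k ^+ 2 + k * N) * rq q k * rq q (k +
  N)).
Proof.
rewrite /durfee_term /euler_coef (_ : forall a b c d e : C, a * b * (c * (d * e)) = (a * c * d) *
  e * b); last by move=> *; ring.
rewrite !mulrA -!(qexpD q0); congr (_ ^ _ * _ * _).
have := tri2 N; have := tri2 k; have := tri2 (k + N); nia.
Qed.

Lemma cnorm_rq2 (B : R) (x y : int) (e : int) : (forall n, cnorm (rq q n) <= B) ->
  cnorm (q ^ e * rq q x * rq q y) <= B ^+ 2 * cnorm (q ^ e).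
Proof.
move=> HB; rewrite !cnormM -mulrA mulrC ler_wpM2r ?cnorm_ge0 // expr2.
by rewrite ler_pM ?cnorm_ge0.
Qed.

Lemma abs_summable_durfee N : abs_summable (durfee_term N).
Proof.
have [B B0 HB] := cnorm_rq_theta.
apply: (@abs_summable_gauss _ (cnorm (q ^ tri N) * B ^+ 2) N 0) => k.
rewrite durfee_termE cnormM -[leRHS]mulrA ler_wpM2l ?cnorm_ge0 // subr0 [N * k]mulrC.
exact: cnorm_rq2.
Qed.

(** Coefficient form of the functional equation of the theta function under z -> zq. Termwise,
    [durfee_term (N + 1) k] is [A k] plus the value at k + 1 of [q ^ N * durfee_term N - A], so the
    sum of [A] cancels. *)
Lemma durfee_step N s : has_sum (durfee_term N) s -> has_sum (durfee_term (N + 1)) (q ^ N * s).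
Proof.
move=> Hs.
pose A k := q ^ (k + N) * durfee_term N k.
have [a Ha] : exists a, has_sum A a.
  apply: abs_summable_has_sum; have [B B0 HB] := cnorm_rq_theta.
  apply: (@abs_summable_gauss _ (cnorm (q ^ (tri N + N)) * B ^+ 2) (N + 1) 0) => k.
  rewrite /A durfee_termE.
  rewrite (_ : q ^ (k + N) * _ = q ^ (tri N + N) * (q ^ (k ^+ 2 + (N + 1) * k - 0) * rq q k * rq q
    (k + N))); last first.
    rewrite !mulrA -!(qexpD q0); congr (_ ^ _ * _ * _); ring.
  by rewrite cnormM -[leRHS]mulrA ler_wpM2l ?cnorm_ge0 //; exact: cnorm_rq2.
have H1 : has_sum (fun k => q ^ N * durfee_term N k - A k) (q ^ N * s - a) := has_sumB (has_sumZ _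
  Hs) Ha.
have /(has_sumD Ha) := (has_sum_shift _ 1 _).1 H1.
rewrite addrCA subrr addr0; congr has_sum; apply/funext => k; rewrite /A /durfee_term.
rewrite (_ : k + (N + 1) = k + N + 1); last by ring.
rewrite (_ : k + 1 + N = k + N + 1); last by ring.
have := euler_coefS (k + N + 1); rewrite addrK; have := euler_coefS (k + 1); rewrite addrK.
rewrite !(qexpD q0) expr1z.
move: (euler_coef (k + N + 1)) (euler_coef (k + 1)) (euler_coef (k + N)) (euler_coef k) (q ^ k) (q
  ^ N) => e1 d1 e d u v E2 E1.
apply/eqP; rewrite -subr_eq0.
rewrite (_ : _ - _ = v * q * u * e1 * (d1 - (u * q * d1 + u * d))
  - u * d * (e1 - (u * v * q * e1 + u * v * e))); last by ring.
by rewrite -E1 -E2 !subrr !mulr0 subrr.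
Qed.

Lemma qexpK m x : q ^ (- m) * (q ^ m * x) = x.
Proof. by rewrite mulrA -(qexpD q0) addNr expr0z mul1r. Qed.

Lemma durfee_const : exists b, forall N : int, has_sum (fun k => q ^ (k ^+ 2 + k * N) * rq q k *
  rq q (k + N)) b.
Proof.
have H N : exists s, has_sum (fun k => q ^ (k ^+ 2 + k * N) * rq q k * rq q (k + N)) s.
  have [s Hs] := abs_summable_has_sum (abs_summable_durfee N).
  exists (q ^ (- tri N) * s); have := has_sumZ (q ^ (- tri N)) Hs.
  congr has_sum; apply/funext => k; by rewrite durfee_termE qexpK.
have [b Hb] := H 0; exists b => N.
have step (M : int) s : has_sum (fun k => q ^ (k ^+ 2 + k * M) * rq q k * rq q (k + M)) s <->
    has_sum (fun k => q ^ (k ^+ 2 + k * (M + 1)) * rq q k * rq q (k + (M + 1))) s.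
  have {}H s' : has_sum (fun k => q ^ (k ^+ 2 + k * M) * rq q k * rq q (k + M)) s' ->
    has_sum (fun k => q ^ (k ^+ 2 + k * (M + 1)) * rq q k * rq q (k + (M + 1))) s'.
    move=> /(has_sumZ (q ^ tri M)); under [X in has_sum X]eq_fun do rewrite -durfee_termE.
    move=> /durfee_step; rewrite (funext (durfee_termE (M + 1))).
    move=> /(has_sumZ (q ^ (- tri (M + 1)))); rewrite !mulrA -!(qexpD q0).
    rewrite (_ : - tri (M + 1) + M + tri M = 0); last first.
      by have := triB1 (M + 1); rewrite addrK; lia.
    rewrite expr0z mul1r; congr has_sum; apply/funext => k.
    by rewrite qexpK.
  split; first exact: H.
  (* The step only goes upwards. For the converse a sum at [M] exists by summability, and uniqueness
     identifies its image with [s]. *)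
  move=> Hs; have [t Ht] : exists t, has_sum (fun k => q ^ (k ^+ 2 + k * M) * rq q k * rq q (k +
    M)) t.
    have [t Ht] := abs_summable_has_sum (abs_summable_durfee M).
    exists (q ^ (- tri M) * t); have := has_sumZ (q ^ (- tri M)) Ht.
    congr has_sum; apply/funext => k; by rewrite durfee_termE qexpK.
  by rewrite (has_sum_uniq Hs (H _ Ht)).
elim/int_ind: N => [//|n IH|n IH].
- by rewrite intS addrC; exact: (step _ _).1 IH.
- apply: (step _ _).2; rewrite (_ : - n.+1%:Z + 1 = - n%:Z) //; lia.
Qed.

(* The generating-function form of the Durfee rectangle dissection: the sum does not
   depend on N by [durfee_step], and tends to 1/(q;q)_oo as N -> +oo. *)
Lemma durfee N : has_sum (fun k => q ^ (k ^+ 2 + k * N) * rq q k * rq q (k + N)) (qpoch_inf q q)^-1.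
Proof.
have [b Hb] := durfee_const.
suff -> : (qpoch_inf q q)^-1 = b by exact: Hb.
have qi := qpoch_tends q0.
have qi0 := qpoch_inf_neq0 q0 q1.
have [B B0 HB] := cnorm_rq_theta; have [D HD] := abs_summable_theta q0 q1 0.
have D0 : 0 <= D by have := HD fset0; rewrite big_seq_fset0.
(* The term k = 0 is 1/(q;q)_n, and every term with k > 0 carries q^(kn), hence at least one factor
   q^n. *)
have near n : cnorm (rq q (Posz n) - b) <= cnorm q ^+ n * (B ^+ 2 * D).
  rewrite -cnormN opprB; apply: (has_sum_nm_le (has_sumB (Hb (Posz n)) _)).
    by have := has_sumZ (rq q (Posz n)) (has_sum_delta (0 : int)); rewrite mulr1; apply.
  move=> A; apply: le_trans (_ : cnorm q ^+ n * (B ^+ 2 * \sum_(k <- A) cnorm (q ^ (tri k + 0 *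
    k))) <= _); last first.
    by rewrite !ler_wpM2l ?exprn_ge0 ?cnorm_ge0 // mulr_ge0.
  rewrite !mulr_sumr; apply: ler_sum => k _; rewrite mul0r addr0.
  case: (ltgtP k 0) => [k0|k0|->].
  - by rewrite mulr0n (rq_neg _ k0) !mulr0 mul0r subrr cnorm0 !mulr_ge0 ?exprn_ge0 ?cnorm_ge0.
  - rewrite mulr0n mulr0 subr0; apply: le_trans (cnorm_rq2 _ _ _ HB) _.
    rewrite mulrCA ler_wpM2l ?mulr_ge0 // -cnormX -cnormM.
    rewrite (_ : q ^+ n * _ = q ^ (Posz n + tri k)); last by rewrite (qexpD q0).
    by rewrite cnorm_exp_le //; have := tri2 k; nia.
  - by rewrite mulr1n mulr1 mul0r addr0 expr0n expr0z mul1r rq0 add0r mul1r subrr cnorm0 !mulr_ge0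
    ?exprn_ge0 ?cnorm_ge0.
have lim_rq : tends (fun n => rq q (Posz n)) b.
  apply: tends_small near _ => e e0.
  have BD : 0 < B ^+ 2 * D + 1 by rewrite ltr_wpDl ?mulr_ge0.
  have [N0 HN] := expr_small (cnorm_ge0 q) q1 (divr_gt0 e0 BD).
  exists N0 => n /HN; rewrite ltr_pdivlMr // => h.
  by apply: le_lt_trans h; rewrite ler_wpM2l ?exprn_ge0 ?cnorm_ge0 // lerDl.
have := tendsM lim_rq qi; set u := (fun n => _) => Hu.
have : tends u 1.
  rewrite (_ : u = fun=> 1); first exact: tends_cst.
  by apply/funext => n; rewrite /u /= mulVf // qpoch_neq0.
move/(tends_uniq Hu) => bq; apply: (mulIf qi0); rewrite mulVf //; exact/esym.
Qed.

(** The two Euler expansions are multiplied and collected by the total power z^N; each coefficient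
    is a Durfee sum, which explains the factor 1/(q;q)_oo to be cleared. *)
Lemma jacobi_triple (z : C) : z != 0 ->
  has_sum (fun n => q ^ tri n * z ^ n)
     (qpoch_inf q q * qpoch_inf (- z) q * qpoch_inf (- (q / z)) q).
Proof.
move=> z0; have w0 : q / z != 0 by rewrite mulf_neq0 ?invr_eq0.
have := has_sum_prod (abs_summable_euler z) (abs_summable_euler (q / z)) (euler_sum z0) (euler_sum
  w0).
pose h (x : int * int) := (x.2 + x.1, x.2); pose h' (x : int * int) := (x.1 - x.2, x.2).
have hK : cancel h h' by case=> N k; rewrite /h /h' /=; congr pair; ring.
have h'K : cancel h' h by case=> N k; rewrite /h /h' /=; congr pair; ring.
move/(has_sum_bij _ _ hK h'K) => H.
have qi0 := qpoch_inf_neq0 q0 q1.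
have inner N : has_sum (fun k => euler_coef (k + N) * z ^ (k + N) * (euler_coef k * (q / z) ^ k))
    (q ^ tri N * z ^ N * (qpoch_inf q q)^-1).
  have := has_sumZ (q ^ tri N * z ^ N) (durfee N); congr has_sum; apply/funext => k.
  transitivity (z ^ N * durfee_term N k).
    by rewrite durfee_termE; move: (q ^ tri N) (z ^ N) (_ * _ * rq q (k + N)) => a b c; ring.
  have zk : z ^ k != 0 by rewrite expfz_neq0.
  rewrite /durfee_term expfzMl (expfzDr _ _ z0) exprz_inv -invr_expz; field.
  by [].
have := has_sumZ (qpoch_inf q q) (has_sum_fubini H inner).
rewrite mulrA; congr has_sum; apply/funext => N.
by rewrite mulrC mulfVK.
Qed.
End EulerJacobi.

(** * Rogers' Bailey pairs and the Rogers-Ramanujan identities *)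

Section RogersRamanujan.
Variables (R : realType) (q : R[i]).
Hypotheses (q0 : q != 0) (q1 : cnorm q < 1).
Local Notation C := R[i].

Lemma has_sum_reflect (f : int -> C) (k : int) s : has_sum f s <-> has_sum (fun n => f (k - n)) s.
Proof.
by apply: (@has_sum_bij _ _ _ (fun n => k - n) (fun n => k - n)) => n; rewrite opprB addrC subrK.
Qed.

Lemma has_sum_zero (T : choiceType) : has_sum (fun _ : T => 0 : C) 0.
Proof. by have := @has_sum_finite R T [::] (fun=> 0) isT (fun _ _ => erefl); rewrite big_nil. Qed.

Lemma sgnD (m n : int) : (-1) ^ (m + n) = (-1) ^ m * (-1) ^ n :> C.
Proof. by rewrite expfzDr // oppr_eq0 oner_neq0. Qed.

Lemma sgnN (n : int) : (-1) ^ (- n) = (-1) ^ n :> C.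
Proof. by rewrite -exprz_inv invrN1. Qed.

Lemma sgn_sq (n : int) : (-1) ^ n * (-1) ^ n = 1 :> C.
Proof. by rewrite -expfzMl mulrNN mulr1 exp1rz. Qed.

Lemma cnorm_sgn (n : int) : cnorm ((-1) ^ n : C) = 1.
Proof. by rewrite cnormXz cnormN cnorm1 exp1rz. Qed.

(** Summand of Rogers' Bailey pair with beta_N = 1/(q;q)_N relative to a = q^b, b = 0 or 1. The two
    parts of alpha_r are unfolded into one sum over all integers r, whose support is finite. *)
Definition bailey (b N r : int) : C :=
  (-1) ^ r * (q ^ (3 * tri r + (1 + b) * r) * rq q (N - r) * rq q (N + r + b)).

Lemma cnorm_bailey_le (B : R) (b N r e : int) : (forall n, cnorm (rq q n) <= B) ->
  cnorm (q ^ e * bailey b N r) <= B ^+ 2 * cnorm (q ^ (e + (3 * tri r + (1 + b) * r))).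
Proof.
move=> HB; rewrite /bailey mulrCA cnormM cnorm_sgn mul1r !mulrA -(qexpD q0).
exact: cnorm_rq2.
Qed.

Lemma abs_summable_bailey (b N c d : int) : abs_summable (fun r => q ^ (c * r + d) * bailey b N r).
Proof.
have [B B0 HB] := cnorm_rq_theta q1.
apply: (@abs_summable_gauss _ _ q0 q1 _ (B ^+ 2) (b + c) (- d)) => r.
apply: le_trans (cnorm_bailey_le _ _ _ _ HB) _; rewrite ler_wpM2l ?exprn_ge0 //.
rewrite cnorm_exp_le //; have := tri2 r; nia.
Qed.

Lemma has_sum_bailey (b N : int) : exists a, has_sum (bailey b N) a.
Proof.
have [a Ha] := abs_summable_has_sum (abs_summable_bailey b N 0 0); exists a; move: Ha.
by congr has_sum; apply/funext => r; rewrite mul0r addr0 expr0z mul1r.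
Qed.

Lemma bailey_neg (b N r : int) : 2 * N + b < 0 -> bailey b N r = 0.
Proof.
move=> Nb; rewrite /bailey; case: (ltP (N - r) 0) => [h|h].
  by rewrite (rq_neg _ h) mulr0 mul0r mulr0.
by rewrite (_ : rq q (N + r + b) = 0) ?mulr0 // rq_neg //; lia.
Qed.

(** The ratio of consecutive terms, cross-multiplied so that it also holds at the ends of the
    support. *)
Lemma baileyS (b N r : int) :
  bailey b N (r + 1) * (1 - q ^ (N + r + 1 + b))
  = - q ^ (3 * r + 1 + b) * (1 - q ^ (N - r)) * bailey b N r.
Proof.
rewrite /bailey sgnD expr1z triD.
rewrite (_ : N - (r + 1) = N - r - 1) ?(rqS q0 q1 (N - r)); last by ring.
have := rqS q0 q1 (N + r + 1 + b).
rewrite (_ : N + r + 1 + b - 1 = N + r + b); last by ring.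
rewrite (_ : N + (r + 1) + b = N + r + 1 + b); last by ring.
move=> ->.
rewrite (_ : 3 * (tri r + tri 1 + r * 1) + (1 + b) * (r + 1) =
  (3 * tri r + (1 + b) * r) + (3 * r + 1 + b)); last by rewrite (_ : tri 1 = 0) //; ring.
rewrite (qexpD q0 (3 * tri r + _)).
move: ((-1) ^ r) (q ^ (3 * tri r + _)) (q ^ (3 * r + _ + _)) (rq q (N - r)) (rq q _) (q ^ (N + _ +
  _ + _)) (q ^ (N - r)) => *; ring.
Qed.

Lemma baileyB1 (b N r : int) : bailey b (N - 1) r
  = (1 - q ^ (N - r)) * (1 - q ^ (N + r + b)) * bailey b N r.
Proof.
rewrite /bailey (_ : N - 1 - r = N - r - 1); last by ring.
rewrite (_ : N - 1 + r + b = N + r + b - 1); last by ring.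
rewrite !(rqS q0 q1); move: (q ^ (N - r)) (q ^ (N + r + b)) (q ^ _) => *; ring.
Qed.

(** Lowering M multiplies the term by (1 - q^(M-r)) (1 - q^(M+r)), that is, gives (1 - q^(M+r))
    times the term minus [g r]. Reflection r -> -r shows that weighting by q^r does not change the
    sum, and [g] sums to 0 since g(r+1) = -g(-r). *)
Lemma bailey_step0 (M : int) a : has_sum (bailey 0 M) a ->
  has_sum (bailey 0 (M - 1)) ((1 - q ^ M) * a).
Proof.
move=> Ha.
pose g r := q ^ (M - r) * (1 - q ^ (M + r)) * bailey 0 M r.
have [c Hc] : exists c, has_sum g c.
  have [x Hx] := abs_summable_has_sum (abs_summable_bailey 0 M (-1) M).
  have [y Hy] := abs_summable_has_sum (abs_summable_bailey 0 M 0 (M + M)).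
  exists (x - y); have := has_sumB Hx Hy; congr has_sum; apply/funext => r.
  rewrite /g -mulrBl; congr (_ * _); rewrite mulrBr mulr1 -(qexpD q0).
  by congr (q ^ _ - q ^ _); ring.
have refl r : bailey 0 M (- r) = q ^ r * bailey 0 M r.
  rewrite /bailey sgnN tri_reflect opprK addr0 (_ : M - r + 0 = M - r) ?addr0 //.
  rewrite (_ : 3 * (tri r + r) + (1 + 0) * - r = r + (3 * tri r + (1 + 0) * r)); last by ring.
  rewrite (qexpD q0 r); move: (rq q (M + r)) (rq q _) (q ^ r) (q ^ (_ + _)) ((-1) ^ r) => *; ring.
have gS r : g (r + 1) = - g (0 - r).
  rewrite /g sub0r refl opprK (_ : M + (r + 1) = M + r + 1 + 0); last by ring.
  rewrite -mulrA [X in _ * X = _]mulrC baileyS.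
  have : q ^ (M - (r + 1)) * q ^ (3 * r + 1 + 0) = q ^ (M + r) * q ^ r.
    by rewrite -!(qexpD q0); congr (_ ^ _); ring.
  move: (bailey _ _ _) (q ^ (M - (r + 1))) (q ^ (3 * r + 1 + 0)) (q ^ (M + r)) => t x y z E.
  rewrite (_ : x * _ = - (x * y) * (1 - q ^ (M - r)) * t); last by ring.
  rewrite E; ring.
have c0 : c = 0.
  have H1 := (has_sum_shift _ 1 _).1 Hc; have := (has_sum_reflect _ 0 _).1 Hc => /has_sumN H2.
  have /has_sum_uniq/(_ H1) : has_sum (fun n => g (n + 1)) (- c).
    by move: H2; congr has_sum; apply/funext => r; rewrite gS.
  by move=> E; apply/eqP; rewrite -[c == 0](mulrn_eq0 c 2) mulr2n -{1}E addNr.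
rewrite c0 in Hc.
have := has_sumD (has_sumB (has_sumB (has_sumZ (1 - q ^ M) Ha) Hc) (has_sumZ (q ^ M)
  ((has_sum_reflect _ 0 _).1 Ha))) (has_sumZ (q ^ M) Ha).
rewrite subr0 subrK; congr has_sum; apply/funext => r.
rewrite sub0r refl baileyB1 /g addr0 !(qexpD q0) -invr_expz.
have qr : q ^ r != 0 by rewrite expfz_neq0.
by move: (bailey _ _ _) => t; field.
Qed.

Lemma bailey_pair0 (N : int) : has_sum (bailey 0 N) (rq q N).
Proof.
case: (ltP N 0) => [N0|].
  rewrite rq_neg //; have := has_sum_zero int; congr has_sum; apply/funext => r.
  by rewrite bailey_neg //; lia.
case: N => // N _; elim: N => [|N IH].
  rewrite rq0; have := @has_sum_delta R _ (0 : int); congr has_sum; apply/funext => r.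
  case: (ltgtP r 0) => [h|h|->]; rewrite /bailey ?mulr0n ?mulr1n.
  - by rewrite (_ : rq q (0 + r + 0) = 0) ?mulr0 // rq_neg //; lia.
  - by rewrite (_ : rq q (0 - r) = 0) ?(mulr0, mul0r) // rq_neg //; lia.
  - by rewrite subr0 ?addr0 rq0 !mulr0 ?addr0 !expr0z !mulr1.
set M := Posz N.+1; have [a Ha] := has_sum_bailey 0 M.
have := bailey_step0 Ha; rewrite (_ : M - 1 = Posz N); last by rewrite /M; lia.
move/has_sum_uniq/(_ IH); rewrite (_ : Posz N = M - 1); last by rewrite /M; lia.
rewrite (rqS q0 q1) => /mulfI <- //.
exact: oneBq_neq0.
Qed.

(** The reflection is now r -> -1 - r. The sum of g(r) - g(r+1) telescopes to 0, and what it leaves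
    over is absorbed by [u], which is odd under the reflection and so sums to 0. *)
Lemma bailey_step1 (M : int) a : has_sum (bailey 1 M) a ->
  has_sum (bailey 1 (M - 1)) ((1 - q ^ M) * a).
Proof.
move=> Ha.
have sum0 c : c = - c -> c = 0 :> C.
  by move=> E; apply/eqP; rewrite -[c == 0](mulrn_eq0 c 2) mulr2n {1}E addNr.
pose g r := q ^ (M - r) * (1 - q ^ (M + r + 1)) * bailey 1 M r.
have [c Hc] : exists c, has_sum g c.
  have [x Hx] := abs_summable_has_sum (abs_summable_bailey 1 M (-1) M).
  have [y Hy] := abs_summable_has_sum (abs_summable_bailey 1 M 0 (M + M + 1)).
  exists (x - y); have := has_sumB Hx Hy; congr has_sum; apply/funext => r.
  rewrite /g -mulrBl; congr (_ * _); rewrite mulrBr mulr1 -(qexpD q0).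
  by congr (q ^ _ - q ^ _); ring.
have refl r : bailey 1 M (-1 - r) = - (q ^ (2 * r + 1) * bailey 1 M r).
  rewrite /bailey (_ : -1 - r = - (r + 1)) ?sgnN ?sgnD ?tri_reflect ?triD; last by ring.
  rewrite opprK (_ : M - (r + 1) + 1 = M - r) ?addrA; last by ring.
  rewrite (_ : 3 * _ + _ = (2 * r + 1) + (3 * tri r + (1 + 1) * r)); last first.
    by rewrite (_ : tri 1 = 0) //; ring.
  rewrite (qexpD q0 (2 * r + 1)) expr1z.
  move: (rq q (M + r + 1)) (rq q _) (q ^ (2 * r + 1)) (q ^ (_ + _)) ((-1) ^ r) => *; ring.
have gS r : g r - g (r + 1)
    = q ^ M * (q ^ (- r) - q ^ (M + 1) + q ^ (2 * r + 1) - q ^ (M + r + 1)) * bailey 1 M r.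
  rewrite {2}/g (_ : M + (r + 1) + 1 = M + r + 1 + 1); last by ring.
  rewrite -[q ^ (M - (r + 1)) * _ * _]mulrA [X in q ^ (M - (r + 1)) * X]mulrC baileyS.
  have E : q ^ (M - (r + 1)) * q ^ (3 * r + 1 + 1) = q ^ M * q ^ (2 * r + 1).
    by rewrite -!(qexpD q0); congr (_ ^ _); ring.
  have E2 : q ^ (2 * r + 1) * q ^ (M - r) = q ^ (M + r + 1).
    by rewrite -!(qexpD q0); congr (_ ^ _); ring.
  have E3 : q ^ (M - r) * q ^ (M + r + 1) = q ^ M * q ^ (M + 1).
    by rewrite -!(qexpD q0); congr (_ ^ _); ring.
  rewrite /g -E2 (qexpD q0 M (- r)).
  rewrite -E2 (qexpD q0 M (- r)) in E3.
  move: E E3; move: (bailey _ _ _) (q ^ (M - (r + 1))) (q ^ (3 * r + 1 + 1)) (q ^ (2 * r + 1)) (q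
    ^ (M + 1)) (q ^ M) (q ^ (- r)) => t x1 x2 x3 x5 x6 x7 E E3.
  rewrite (_ : x1 * _ = - (x1 * x2) * (1 - x6 * x7) * t); last by ring.
  rewrite E (_ : x6 * x7 * (1 - _) * t = (x6 * x7 - x6 * x7 * (x3 * (x6 * x7))) * t); last by ring.
  rewrite E3; ring.
pose u r := q ^ (r + 1) * bailey 1 M r.
have [e He] : exists e, has_sum u e.
  have [x Hx] := abs_summable_has_sum (abs_summable_bailey 1 M 1 1); exists x; move: Hx.
  by congr has_sum; apply/funext => r; rewrite mul1r.
have e0 : e = 0.
  apply: sum0; apply: (has_sum_uniq He); have := has_sumN ((has_sum_reflect _ (-1) _).1 He).
  congr has_sum; apply/funext => r; rewrite /u refl mulrN opprK mulrA -(qexpD q0).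
  by congr (_ ^ _ * _); ring.
rewrite e0 in He.
have G0 := has_sumB Hc ((has_sum_shift _ 1 _).1 Hc).
have := has_sumB (has_sumD (has_sumB (has_sumB (has_sumZ (1 - q ^ M) Ha) G0)
  (has_sumZ (q ^ M) ((has_sum_reflect _ (-1) _).1 Ha))) (has_sumZ (q ^ M) Ha)) (has_sumZ (q ^ M +
    q ^ (M + M)) He).
rewrite subrr mulr0 !subr0 subrK; congr has_sum; apply/funext => r.
rewrite (gS r).
rewrite refl.
rewrite baileyB1.
rewrite /u.
have q2r : q ^ (2 * r) = q ^ r * q ^ r by rewrite -(qexpD q0); congr (_ ^ _); ring.
rewrite !(qexpD q0).
rewrite q2r expr1z.
rewrite -invr_expz.
have qr : q ^ r != 0 by rewrite expfz_neq0.
by move: (bailey _ _ _) => t; field.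
Qed.

Lemma bailey_pair1 (N : int) : has_sum (bailey 1 N) (rq q N).
Proof.
case: (ltP N 0) => [N0|].
  rewrite rq_neg //; have := has_sum_zero int; congr has_sum; apply/funext => r.
  by rewrite bailey_neg //; lia.
case: N => // N _; elim: N => [|N IH].
  (* For N = 0 only r = 0 and r = -1 survive, with values 1/(1 - q) and -q/(1 - q). *)
  have t0 r : r != 0 -> r != -1 -> bailey 1 0 r = 0.
    move=> r0 r1; rewrite /bailey; case: (ltP r 0) => h.
      by rewrite (_ : rq q (0 + r + 1) = 0) ?mulr0 // rq_neg //; lia.
    by rewrite (_ : rq q (0 - r) = 0) ?(mulr0, mul0r) // rq_neg //; lia.
  have := @has_sum_finite R _ [:: 0; -1 : int] (bailey 1 0) isT.
  rewrite big_cons big_seq1 => H.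
  suff <- : bailey 1 0 0 + bailey 1 0 (-1) = rq q 0.
    by apply: H => r; rewrite !inE negb_or => /andP[]; exact: t0.
  rewrite /bailey (_ : tri 0 = 0) // (_ : tri (-1) = 1) //.
  rewrite !(sub0r, add0r, opprK, subrr, addNr, subr0, mulr0, addr0, rq0, expr0z, mulr1, mul1r).
  rewrite (_ : 3 + (1 + 1) * -1 = 1) // expr1z exprN1 invrN1.
  by have := rqS q0 q1 1; rewrite subrr rq0 expr1z => E; rewrite [RHS]E; ring.
set M := Posz N.+1; have [a Ha] := has_sum_bailey 1 M.
have := bailey_step1 Ha; rewrite (_ : M - 1 = Posz N); last by rewrite /M; lia.
move/has_sum_uniq/(_ IH); rewrite (_ : Posz N = M - 1); last by rewrite /M; lia.
rewrite (rqS q0 q1) => /mulfI <- //.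
exact: oneBq_neq0.
Qed.

(* Sum the Bailey pair against q^(N^2 + b N) by first summing over N. *)
Lemma rr_series (b : int) : (b = 0) \/ (b = 1) -> (forall N, has_sum (bailey b N) (rq q N)) ->
  exists2 s, has_sum (fun r => (-1) ^ r * q ^ (5 * tri r + (2 + 2 * b) * r)) s &
  has_sum (fun n => q ^ (n ^+ 2 + b * n) * rq q n) (s / qpoch_inf q q).
Proof.
move=> b01 Hb.
pose F (x : int * int) := q ^ (x.1 ^+ 2 + b * x.1) * bailey b x.1 x.2.
have [B B0 HB] := cnorm_rq_theta q1.
have sF : abs_summable F.
  have s1 : abs_summable (fun n : int => q ^ (n ^+ 2 + b * n)).
    by apply: (@abs_summable_gauss _ _ q0 q1 _ 1 b 0) => k; rewrite subr0 mul1r.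
  have s2 : abs_summable (fun r : int => q ^ (3 * tri r + (1 + b) * r)).
    apply: (@abs_summable_gauss _ _ q0 q1 _ 1 b 0) => k; rewrite subr0 mul1r cnorm_exp_le //.
    by have := tri2 k; nia.
  apply: (abs_summable_le _ (B ^+ 2) _ (abs_summable_prod s1 s2)) => -[n r];
    rewrite /F /= -(qexpD q0).
  exact: cnorm_bailey_le.
have [S HS] := abs_summable_has_sum sF.
have HS1 := has_sum_fubini HS (fun n => has_sumZ (q ^ (n ^+ 2 + b * n)) (Hb n)).
(* With N = k + r at fixed r, the sum over k is a Durfee sum of shift 2r + b. *)
pose h (x : int * int) := (x.2 + x.1, x.1); pose h' (x : int * int) := (x.2, x.1 - x.2).
have hK : cancel h h' by case=> N k; rewrite /h /h' /=; congr pair; ring.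
have h'K : cancel h' h by case=> N k; rewrite /h /h' /=; congr pair; ring.
have qi0 := qpoch_inf_neq0 q0 q1 q0 q1.
have inner r : has_sum (fun k => F (h (r, k)))
    ((-1) ^ r * q ^ (5 * tri r + (2 + 2 * b) * r) / qpoch_inf q q).
  have := has_sumZ ((-1) ^ r * q ^ (5 * tri r + (2 + 2 * b) * r)) (durfee q0 q1 (2 * r + b)).
  congr has_sum; apply/funext => k; rewrite /F /h /bailey /= addrK.
  rewrite (_ : k + r + r + b = k + (2 * r + b)); last by ring.
  have E : q ^ (5 * tri r + (2 + 2 * b) * r) * q ^ (k ^+ 2 + k * (2 * r + b))
      = q ^ ((k + r) ^+ 2 + b * (k + r)) * q ^ (3 * tri r + (1 + b) * r).
    rewrite -!(qexpD q0); congr (_ ^ _); apply/eqP; rewrite -subr_eq0; apply/eqP.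
    by transitivity (2 * tri r - (r ^+ 2 - r)); [ring | rewrite tri2 subrr].
  move: (rq q (k + _)) (rq q k) ((-1) ^ r) => x y z; move: E;
    move: (q ^ (5 * tri r + _)) (q ^ (k ^+ 2 + _)) (q ^ ((k + r) ^+ 2 + _)) (q ^ (3 * _ + _)).
  move=> c1 c2 c3 c4 E.
  transitivity (z * (c1 * c2) * y * x); first by ring.
  rewrite E; ring.
have := has_sum_fubini ((has_sum_bij _ _ hK h'K).1 HS) inner => Hr.
exists (S * qpoch_inf q q).
  have := has_sumZr (qpoch_inf q q) Hr; congr has_sum; apply/funext => r.
  by rewrite divfK.
by rewrite mulfK.
Qed.

Lemma cnorm_qX_lt1 n : (0 < n)%N -> cnorm (q ^+ n) < 1.
Proof. by move=> n0; rewrite cnormX exprn_ilt1 ?cnorm_ge0 // -lt0n. Qed.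

Lemma exprzX (n : nat) (m : int) : (q ^+ n) ^ m = q ^ (Posz n * m).
Proof. by rewrite exprnP exprz_exp. Qed.

Lemma jacobi_pow (e : C) (m a : nat) : e * e = 1 -> (0 < m)%N -> (a <= m)%N ->
  has_sum (fun n => e ^ n * q ^ (Posz m * tri n + Posz a * n))
     (qpoch_inf (q ^+ m) (q ^+ m) * qpoch_inf (- (e * q ^+ a)) (q ^+ m)
      * qpoch_inf (- (e * q ^+ (m - a))) (q ^+ m)).
Proof.
move=> ee m0 am; have e0 : e != 0.
  by apply/eqP => E; move/eqP: ee; rewrite E mul0r eq_sym oner_eq0.
have qm0 : q ^+ m != 0 by rewrite expf_neq0.
have z0 : e * q ^+ a != 0 by rewrite mulf_neq0 ?expf_neq0.
have := jacobi_triple qm0 (cnorm_qX_lt1 m0) z0.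
rewrite (_ : q ^+ m / (e * q ^+ a) = e * q ^+ (m - a)); last first.
  have qa0 : q ^+ a != 0 by rewrite expf_neq0.
  by apply: (mulIf z0); rewrite divfK // mulrACA ee mul1r -exprD subnK.
by congr has_sum; apply/funext => n; rewrite expfzMl !exprzX mulrCA -(qexpD q0).
Qed.

Lemma rogers_ramanujan1 : has_sum (fun n => q ^ (n ^+ 2) * rq q n)
  (qpoch_inf (q ^+ 5) (q ^+ 5) * qpoch_inf (q ^+ 2) (q ^+ 5) * qpoch_inf (q ^+ 3) (q ^+ 5)
   / qpoch_inf q q).
Proof.
have [s Hs] := rr_series (or_introl erefl) bailey_pair0.
have := @jacobi_pow (-1) 5 2 ltac:(by rewrite mulrNN mulr1) isT isT.
rewrite !mulN1r !opprK; under [X in has_sum X]eq_fun do rewrite ?mul0r ?addr0.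
move/has_sum_uniq => /(_ s) ->.
  by congr has_sum; apply/funext => n; rewrite mul0r addr0.
by move: Hs; congr has_sum; apply/funext => n; rewrite mulr0 addr0.
Qed.

Lemma rogers_ramanujan2 : has_sum (fun n => q ^ (n ^+ 2 + n) * rq q n)
  (qpoch_inf (q ^+ 5) (q ^+ 5) * qpoch_inf (q ^+ 4) (q ^+ 5) * qpoch_inf q (q ^+ 5)
   / qpoch_inf q q).
Proof.
have [s Hs] := rr_series (or_intror erefl) bailey_pair1.
have := @jacobi_pow (-1) 5 4 ltac:(by rewrite mulrNN mulr1) isT isT.
rewrite !mulN1r !opprK; change (q ^+ (5 - 4)) with q.
move/has_sum_uniq => /(_ s) ->.
  by congr has_sum; apply/funext => n; rewrite mul1r.
by move: Hs; congr has_sum; apply/funext => n; rewrite mulr1.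
Qed.
End RogersRamanujan.

Lemma has_sum_range (R : realType) (K : nat) (f : int -> R[i]) :
  (forall m : int, (K < `|m|)%N -> f m = 0) -> exists s, has_sum f s.
Proof.
move=> fK; pose r := undup ([seq Posz i | i <- iota 0 K.+1] ++ [seq - Posz i | i <- iota 0 K.+1]).
exists (\sum_(x <- r) f x); apply: has_sum_finite; first exact: undup_uniq.
move=> m mr; apply: fK; rewrite ltnNge; apply: contra mr => mK.
rewrite mem_undup mem_cat; case: (ltP m 0) => m0; apply/orP; [right|left];
  by apply/mapP; exists `|m|%N; rewrite ?mem_iota; lia.
Qed.

(** * Gauss's alternating sums and the splitting of 1/(q;q)_n *)

Section Gauss.
Variables (R : realType) (q : R[i]).
Hypotheses (q0 : q != 0) (q1 : cnorm q < 1).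
Local Notation C := R[i].

Lemma oneBqz_neq0 (n : int) : 0 < n -> 1 - q ^ n != 0.
Proof. by case: n => [n|//] n0; rewrite -exprnP; exact: oneBq_neq0. Qed.

Lemma rq_conv0 (N m : int) : (N < 0) || (`|N| < `|m|)%N -> rq q (N - m) * rq q m = 0.
Proof.
move=> h; case: (ltP m 0) => m0; first by rewrite (rq_neg _ m0) mulr0.
by rewrite rq_neg ?mul0r //; lia.
Qed.

Definition gauss_term (N m : int) : C := (-1) ^ m * (rq q (N - m) * rq q m).

Lemma has_sum_gauss_neg N : N < 0 -> has_sum (gauss_term N) 0.
Proof.
move=> N0; have := @has_sum_zero R int; congr has_sum; apply/funext => m.
by rewrite /gauss_term rq_conv0 ?N0 ?mulr0.
Qed.

(** Both sides equal [b - w]: in one reading the recurrence lowers N - 1 - m, in the other [W] is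
    first shifted by one in m. *)
Lemma gauss_term_step N s a : has_sum (gauss_term (N - 1 - 1)) s -> has_sum (gauss_term N) a -> (1
  - q ^ N) * a = s.
Proof.
move=> Hs Ha.
have [b Hb] : exists b, has_sum (gauss_term (N - 1)) b.
  apply: (@has_sum_range _ `|N - 1|%N) => m h.
  by rewrite /gauss_term rq_conv0 ?h ?orbT ?mulr0.
pose W m := q ^ (N - 1 - m) * gauss_term (N - 1) m.
have [w Hw] : exists w, has_sum W w.
  apply: (@has_sum_range _ `|N - 1|%N) => m h.
  by rewrite /W /gauss_term rq_conv0 ?h ?orbT ?mulr0.
have -> : s = b - w.
  apply: (has_sum_uniq Hs); have := has_sumB Hb Hw; congr has_sum; apply/funext => m.
  rewrite /W /gauss_term (_ : N - 1 - 1 - m = N - 1 - m - 1) ?(rqS q0 q1 (N - 1 - m)); last by ring.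
  ring.
apply: (has_sum_uniq (has_sumZ (1 - q ^ N) Ha)).
have := has_sumB Hb ((has_sum_shift _ (-1) _).1 Hw); congr has_sum; apply/funext => m.
rewrite /W /gauss_term (_ : N - 1 - m = N - m - 1) ?(rqS q0 q1 (N - m)); last by ring.
rewrite (_ : N - 1 - (m + -1) = N - m); last by ring.
rewrite (_ : m + -1 = m - 1) // (rqS q0 q1 m) sgnD exprN1 invrN1.
have -> : q ^ N = q ^ (N - m) * q ^ m by rewrite -(qexpD q0) subrK.
move: ((-1) ^ m) (q ^ (N - m)) => *; ring.
Qed.

(** Coefficients of 1/((z;q)_oo (-z;q)_oo) = 1/(z^2;q^2)_oo, which is even in z. *)
Lemma gauss_even_odd (M : nat) : has_sum (gauss_term (2 * Posz M)) (rq (q ^+ 2) (Posz M)) /\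
  has_sum (gauss_term (2 * Posz M + 1)) 0.
Proof.
have q20 : q ^+ 2 != 0 by rewrite expf_neq0.
have q21 := cnorm_qX_lt1 q1 (isT : (0 < 2)%N).
have ex N : exists b, has_sum (gauss_term N) b.
  apply: (@has_sum_range _ `|N|%N) => m h.
  by rewrite /gauss_term rq_conv0 ?h ?orbT ?mulr0.
elim: M => [|M [IHe IHo]].
  split.
    rewrite mulr0 rq0; have := @has_sum_delta R _ (0 : int); congr has_sum; apply/funext => m.
    rewrite /gauss_term; case: eqP => [->|m0]; first by rewrite subr0 rq0 expr0z !mulr1.
    by rewrite rq_conv0 ?mulr0 //; lia.
  have [a Ha] := ex (2 * 0 + 1); rewrite mulr0 add0r in Ha *.
  have := gauss_term_step (has_sum_gauss_neg (_ : 1 - 1 - 1 < 0)) Ha.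
  have m1 : 1 - q ^ 1 != 0 by exact: oneBqz_neq0.
  by move=> /(_ isT)/eqP; rewrite mulf_eq0 (negbTE m1) => /eqP <-.
split.
- have [a Ha] := ex (2 * Posz M.+1).
  have E : (2 * Posz M.+1 - 1 - 1) = 2 * Posz M by lia.
  have := @gauss_term_step (2 * Posz M.+1) _ _ _ Ha; rewrite E => /(_ _ IHe).
  rewrite (_ : Posz M = Posz M.+1 - 1) ?(rqS q20 q21); last by lia.
  by rewrite exprzX => /mulfI <- //; exact: oneBqz_neq0.
- have [a Ha] := ex (2 * Posz M.+1 + 1).
  have E : (2 * Posz M.+1 + 1 - 1 - 1) = 2 * Posz M + 1 by lia.
  have := @gauss_term_step (2 * Posz M.+1 + 1) _ _ _ Ha; rewrite E => /(_ _ IHo).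
  have m1 : 1 - q ^ (2 * Posz M.+1 + 1) != 0 by exact: oneBqz_neq0.
  by move/eqP; rewrite mulf_eq0 (negbTE m1) => /eqP <-.
Qed.

(* Coefficient form of (-z;q)_oo / (z^2;q^2)_oo = 1/(z;q)_oo. *)
Lemma rq_split (n : int) : has_sum (fun r => rq (q ^+ 2) r * euler_coef q (n - 2 * r)) (rq q n).
Proof.
have q20 : q ^+ 2 != 0 by rewrite expf_neq0.
have q21 := cnorm_qX_lt1 q1 (isT : (0 < 2)%N).
pose f (n r : int) : C := rq (q ^+ 2) r * euler_coef q (n - 2 * r).
have f0 (m r : int) : (m < 0) || (`|m| < `|r|)%N -> f m r = 0.
  move=> h; case: (ltP r 0) => r0; first by rewrite /f rq_neg ?mul0r.
  by rewrite /f /euler_coef (@rq_neg _ _ (m - 2 * r)) ?mulr0 //; lia.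
have neg (m : int) : m < 0 -> has_sum (f m) (rq q m).
  move=> m0; rewrite rq_neg //; have := @has_sum_zero R int; congr has_sum; apply/funext => r.
  by rewrite f0 ?m0.
have step (m : int) : 0 < m -> has_sum (f (m - 1)) (rq q (m - 1)) -> has_sum (f (m - 1 - 1)) (rq q
  (m - 1 - 1)) ->
    has_sum (f m) (rq q m).
  move=> m0 H1 H2; have [a Ha] : exists a, has_sum (f m) a.
    by apply: (@has_sum_range _ `|m|%N) => r h; rewrite f0 ?h ?orbT.
  suff <- : a = rq q m by [].
  have m1 := oneBqz_neq0 m0.
  apply: (mulfI m1); rewrite -(rqS q0 q1).
  apply: (has_sum_uniq (has_sumZ _ Ha)).
  rewrite (_ : rq q (m - 1) = rq q (m - 1 - 1) + q ^ (m - 1) * rq q (m - 1)); last first.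
    by rewrite (rqS q0 q1 (m - 1)); ring.
  have := has_sumD ((has_sum_shift _ (-1) _).1 H2) (has_sumZ (q ^ (m - 1)) H1).
  congr has_sum; apply/funext => r; rewrite /f.
  rewrite (_ : m - 1 - 1 - 2 * (r + -1) = m - 2 * r); last by ring.
  rewrite (_ : m - 1 - 2 * r = m - 2 * r - 1); last by ring.
  rewrite (rqS q20 q21 r) exprzX.
  have := euler_coefS q0 q1 (m - 2 * r) => E.
  have -> : q ^ (m - 1) = q ^ (2 * r) * q ^ (m - 2 * r - 1).
    by rewrite -(qexpD q0); congr (_ ^ _); ring.
  have -> : q ^ m = q ^ (2 * r) * q ^ (m - 2 * r).
    by rewrite -(qexpD q0); congr (_ ^ _); ring.
  move: E; move: (euler_coef _ _) (euler_coef _ _) (rq _ _) (q ^ (2 * r)) (q ^ (m - 2 * r)) (q ^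
    (m - _ - _)).
  move=> e2 e1 c x y z E.
  apply/eqP; rewrite -subr_eq0.
  rewrite (_ : _ - _ = - (c * x) * (e1 - (y * e1 + z * e2))); last by ring.
  by rewrite -E subrr mulr0.
suff H (m : nat) : has_sum (f (Posz m)) (rq q (Posz m)) /\ has_sum (f (Posz m - 1)) (rq q (Posz m
  - 1)).
  case: (ltP n 0) => [n0|n0]; first exact: neg.
  have [k ->] : exists k : nat, n = k by exists `|n|%N; lia.
  exact: (H k).1.
elim: m => [|m [IH1 IH2]].
  split; last exact: neg.
  rewrite rq0; have := @has_sum_delta R _ (0 : int); congr has_sum; apply/funext => m.
  case: eqP => [->|m0]; last by rewrite f0 //; lia.
  by rewrite /f rq0 mulr0 subr0 /euler_coef (_ : tri 0 = 0) // rq0 expr0z !mulr1.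
have E : Posz m.+1 - 1 = m by lia.
split; last by rewrite E; exact: IH1.
apply: step; first exact: (isT : 0 < Posz m.+1).
  by rewrite E; exact: IH1.
by rewrite E; exact: IH2.
Qed.
End Gauss.

(** Coefficients of 1/((z;p^2)_oo (pz;p^2)_oo) = 1/(z;p)_oo. *)
Lemma gauss_alt (R : realType) (p : R[i]) : p != 0 -> cnorm p < 1 -> forall N : int,
  has_sum (fun m => p ^ m * (rq (p ^+ 2) (N - m) * rq (p ^+ 2) m)) (rq p N).
Proof.
move=> p0 p1; have p20 : p ^+ 2 != 0 by rewrite expf_neq0.
have p21 := cnorm_qX_lt1 p1 (isT : (0 < 2)%N).
pose f (N m : int) := p ^ m * (rq (p ^+ 2) (N - m) * rq (p ^+ 2) m).
have neg (N : int) : N < 0 -> has_sum (f N) (rq p N).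
  move=> N0; rewrite rq_neg //; have := @has_sum_zero R int; congr has_sum; apply/funext => m.
  by rewrite /f rq_conv0 ?N0 ?mulr0.
move=> N; case: (ltP N 0) => [/neg //|]; case: N => // N _.
elim: N => [|N IH].
  rewrite rq0; have := @has_sum_delta R _ (0 : int); congr has_sum; apply/funext => m.
  case: eqP => [->|m0]; first by rewrite subr0 rq0 expr0z !mulr1.
  by rewrite rq_conv0 ?mulr0 //; lia.
have [a Ha] : exists a, has_sum (f N.+1) a.
  by apply: (@has_sum_range _ N.+1) => m h; rewrite /f rq_conv0 ?h ?orbT ?mulr0.
suff <- : a = rq p N.+1 by [].
apply: (mulfI (oneBq_neq0 p1 (isT : (0 < N.+1)%N))).
have := rqS p0 p1 N.+1; rewrite (_ : Posz N.+1 - 1 = N) => [<-|]; last by lia.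
(* Subtracting p^(N+1) times the reflected sum creates the factor 1 - p^(2(N+1-m)), which lowers the
   index N + 1 - m by one. *)
have := has_sumB Ha (has_sumZ (p ^+ N.+1) ((has_sum_reflect _ N.+1 _).1 Ha)).
rewrite -{1}[a]mul1r -mulrBl => /has_sum_uniq; apply.
move: IH; congr has_sum; apply/funext => m.
rewrite /f (_ : Posz N.+1 - (Posz N.+1 - m) = m); last by ring.
rewrite (_ : Posz N - m = Posz N.+1 - m - 1); last by lia.
rewrite (rqS p20 p21) exprzX.
have E : p ^+ N.+1 * p ^ (Posz N.+1 - m) = p ^ (2 * (Posz N.+1 - m)) * p ^ m.
  by rewrite exprnP -!(qexpD p0); congr (_ ^ _); ring.
transitivity (p ^ m * (rq (p ^+ 2) (Posz N.+1 - m) * rq (p ^+ 2) m)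
  - p ^+ N.+1 * p ^ (Posz N.+1 - m) * (rq (p ^+ 2) (Posz N.+1 - m) * rq (p ^+ 2) m)).
  rewrite E; ring.
ring.
Qed.

(** * Splitting infinite products by residue classes *)

Section InfiniteProducts.
Variable R : realType.
Local Notation C := R[i].
Implicit Types (a q : C).

Lemma qpoch_cat a q n m : qpoch a q (n + m) = qpoch a q n * qpoch (a * q ^+ n) q m.
Proof.
rewrite /qpoch big_split_ord /=; congr (_ * _).
by apply: eq_bigr => k _; rewrite exprD mulrA.
Qed.

Lemma qpoch_inf_cat a q n : a != 0 -> q != 0 -> cnorm q < 1 ->
  qpoch_inf a q = qpoch a q n * qpoch_inf (a * q ^+ n) q.
Proof.
move=> a0 q0 q1; have aq0 : a * q ^+ n != 0 by rewrite mulf_neq0 ?expf_neq0.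
apply: (tends_uniq (tends_shift n (qpoch_tends q0 q1 a0))).
have := tendsM (tends_cst (qpoch a q n)) (qpoch_tends q0 q1 aq0).
by congr tends; apply/funext => m; rewrite addnC qpoch_cat.
Qed.

Lemma qpoch_dissect a q m n : qpoch a q (m * n) = \prod_(i < m) qpoch (a * q ^+ i) (q ^+ m) n.
Proof.
elim: n => [|n IH].
  by rewrite muln0 qpoch0 big1 // => i _; rewrite qpoch0.
rewrite mulnS addnC qpoch_cat IH {2}/qpoch -big_split /=; apply: eq_bigr => i _.
by rewrite qpochS -!exprM -!mulrA -!exprD addnC.
Qed.

Lemma tends_prod (m : nat) (u : nat -> nat -> C) (l : nat -> C) :
  (forall i, tends (u i) (l i)) -> tends (fun n => \prod_(i < m) u i n) (\prod_(i < m) l i).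
Proof.
move=> H; elim: m => [|m IH].
  by rewrite big_ord0; under [X in tends X]eq_fun do rewrite big_ord0; exact: tends_cst.
by rewrite big_ord_recr; under [X in tends X]eq_fun do rewrite big_ord_recr; exact: tendsM.
Qed.

Lemma qpoch_inf_dissect a q m : (0 < m)%N -> a != 0 -> q != 0 -> cnorm q < 1 ->
  qpoch_inf a q = \prod_(i < m) qpoch_inf (a * q ^+ i) (q ^+ m).
Proof.
move=> m0 a0 q0 q1; have qm0 : q ^+ m != 0 by rewrite expf_neq0.
have H1 := qpoch_tends q0 q1 a0.
have H2 : tends (fun n => qpoch a q (m * n)) (qpoch_inf a q).
  by apply: (tends_sub (h := fun n => (m * n)%N)) H1 => n; rewrite leq_pmull.
apply: (tends_uniq H2); under [X in tends X]eq_fun do rewrite qpoch_dissect.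
apply: (@tends_prod m (fun i n => qpoch (a * q ^+ i) (q ^+ m) n)
  (fun i => qpoch_inf (a * q ^+ i) (q ^+ m))) => i.
by apply: qpoch_tends => //; rewrite ?cnorm_qX_lt1 // mulf_neq0 ?expf_neq0.
Qed.

Lemma qpoch_inf_sqr a q : a != 0 -> q != 0 -> cnorm q < 1 ->
  qpoch_inf (a ^+ 2) (q ^+ 2) = qpoch_inf a q * qpoch_inf (- a) q.
Proof.
move=> a0 q0 q1.
have := tendsM (qpoch_tends q0 q1 a0) (qpoch_tends q0 q1 (_ : - a != 0)).
move=> /(_ ltac:(by rewrite oppr_eq0)); apply: tends_uniq.
rewrite (_ : (fun n => _) = qpoch (a ^+ 2) (q ^+ 2)).
  by apply: qpoch_tends; rewrite ?cnorm_qX_lt1 ?expf_neq0.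
apply/funext => n; rewrite /qpoch -big_split /=; apply: eq_bigr => k _.
rewrite exprAC; ring.
Qed.
End InfiniteProducts.

(** * Slater-type sums over (q;q)_(2n) and (q;q)_(2n+1) *)

Section SlaterSums.
Variables (R : realType) (q : R[i]).
Hypotheses (q0 : q != 0) (q1 : cnorm q < 1).
Local Notation C := R[i].
Local Notation rq2 := (rq (q ^+ 2)).

Let q20 : q ^+ 2 != 0. Proof. by rewrite expf_neq0. Qed.
Let q21 : cnorm (q ^+ 2) < 1. Proof. exact: cnorm_qX_lt1. Qed.

Lemma qpoch_odd_even (d n : nat) : (d <= 1)%N ->
  qpoch q q (2 * n + d) = qpoch q (q ^+ 2) (n + d) * qpoch (q ^+ 2) (q ^+ 2) n.
Proof.
move=> d1; rewrite qpoch_cat qpoch_dissect 2!big_ord_recl big_ord0 mulr1.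
change (q ^+ bump 0 0) with q; rewrite expr0 mulr1 -expr2 qpoch_cat mulrAC; congr (_ * _ * _).
case: d d1 => [_|[_|d Hd]]; last by discriminate Hd.
  by rewrite (qpoch0 _ q) (qpoch0 _ (q ^+ 2)).
by rewrite /qpoch !big_ord1 !expr0 -exprM.
Qed.

(** Multiplying by (q;q^2)_oo cancels the odd factors of (q;q)_(2n+d). What remains besides
    1/(q^2;q^2)_n is a tail of the odd product, to which Euler's expansion applies. *)
Lemma odd_prod_rq (d : nat) (n : int) : (d <= 1)%N -> 0 <= n ->
  qpoch_inf q (q ^+ 2) * rq q (2 * n + Posz d)
  = rq2 n * qpoch_inf (q ^ (2 * n + 2 * Posz d + 1)) (q ^+ 2).
Proof.
case: n => // n d1 _; rewrite (qpoch_inf_cat (n + d) q0 q20 q21).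
rewrite (_ : 2 * Posz n + Posz d = (2 * n + d)%N) // /rq qpoch_odd_even //.
rewrite (_ : q * (q ^+ 2) ^+ (n + d) = q ^ (2 * Posz n + 2 * Posz d + 1)); last first.
  by rewrite -exprM -exprS exprnP; congr (_ ^ _); lia.
have n1 : qpoch q (q ^+ 2) (n + d) != 0 by exact: qpoch_neq0.
have n2 : qpoch (q ^+ 2) (q ^+ 2) n != 0 by exact: qpoch_neq0.
by rewrite invfM; move: n1 n2; (do 2 move: (qpoch _ _ _) => ?) => n1 n2; field; rewrite ?n1 ?n2.
Qed.

(* Euler's expansion of (q^(2n+1);q^2)_oo turns the sum into a double sum over n, m,
   which is then collected along n + m = N. *)
Lemma slater_reduction (k : int) (d : nat) (g : int -> C) V : (d <= 1)%N ->
  (forall N, has_sum (fun m => (-1) ^ m * q ^ ((2 * Posz d - k) * m) * (rq2 (N - m) * rq2 m)) (g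
    N)) ->
  has_sum (fun N => q ^ (N ^+ 2 + k * N) * g N) V ->
  has_sum (fun n => q ^ (n ^+ 2 + k * n) * rq q (2 * n + Posz d)) (V / qpoch_inf q (q ^+ 2)).
Proof.
move=> d1 Hg HV; set e := Posz d.
pose F (x : int * int) : C := (-1) ^ x.2 * q ^ ((x.1 + x.2) ^+ 2 + k * x.1 + 2 * e * x.2)
   * (rq2 x.1 * rq2 x.2).
have [B B0 HB] := cnorm_rq_theta q21.
have sF : abs_summable F.
  have s1 : abs_summable (fun n : int => q ^ (n ^+ 2 + k * n)).
    by apply: (@abs_summable_gauss _ _ q0 q1 _ 1 k 0) => j; rewrite subr0 mul1r.
  have s2 : abs_summable (fun n : int => q ^ (n ^+ 2 + 2 * e * n)).
    by apply: (@abs_summable_gauss _ _ q0 q1 _ 1 (2 * e) 0) => j; rewrite subr0 mul1r.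
  apply: (abs_summable_le _ (B ^+ 2) _ (abs_summable_prod s1 s2)) => -[n m]; rewrite /F /=.
  case: (ltP n 0) => n0.
    by rewrite (rq_neg _ n0) mul0r mulr0 cnorm0 mulr_ge0 ?sqr_ge0 ?cnorm_ge0.
  case: (ltP m 0) => m0.
    by rewrite (rq_neg _ m0) !mulr0 cnorm0 mulr_ge0 ?sqr_ge0 ?cnorm_ge0.
  rewrite -(qexpD q0) -mulrA cnormM cnorm_sgn mul1r [X in cnorm X](mulrA (q ^ _)).
  rewrite !cnormM -mulrA mulrC; apply: ler_pM;
    rewrite ?mulr_ge0 ?cnorm_ge0 ?expr2 ?ler_pM ?cnorm_ge0 //.
  by apply: cnorm_exp_le => //; nia.
have [S HS] := abs_summable_has_sum sF.
have inner1 n : has_sum (fun m => F (n, m))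
    (q ^ (n ^+ 2 + k * n) * rq q (2 * n + e) * qpoch_inf q (q ^+ 2)).
  case: (ltP n 0) => n0.
    rewrite (@rq_neg _ _ (2 * n + e)) ?mulr0 ?mul0r; last by rewrite /e; lia.
    have := @has_sum_zero R int; congr has_sum; apply/funext => m.
    by rewrite /F /= (rq_neg _ n0) mul0r mulr0.
  have O := odd_prod_rq d1 n0; rewrite -/e in O.
  rewrite [X in has_sum _ X](_ : _ = q ^ (n ^+ 2 + k * n) * rq2 n
    * qpoch_inf (q ^ (2 * n + 2 * e + 1)) (q ^+ 2)); last first.
    transitivity (q ^ (n ^+ 2 + k * n) * (qpoch_inf q (q ^+ 2) * rq q (2 * n + e))).
      by rewrite -mulrA [X in _ * X]mulrC.
    by rewrite O mulrA.
  have z0 : - q ^ (2 * n + 2 * e + 1) != 0 by rewrite oppr_eq0 expfz_neq0.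
  have := has_sumZ (q ^ (n ^+ 2 + k * n) * rq2 n) (euler_sum q20 q21 z0).
  rewrite opprK; congr has_sum; apply/funext => m.
  rewrite /F /= /euler_coef exprzX tri2 -[- q ^ _]mulN1r expfzMl exprz_exp.
  have E : q ^ ((n + m) ^+ 2 + k * n + 2 * e * m)
      = q ^ (n ^+ 2 + k * n) * q ^ (m ^+ 2 - m) * q ^ ((2 * n + 2 * e + 1) * m).
    by rewrite -!(qexpD q0); congr (_ ^ _); ring.
  rewrite E; ring.
have HS1 := has_sum_fubini HS inner1.
pose h (x : int * int) := (x.1 - x.2, x.2); pose h' (x : int * int) := (x.1 + x.2, x.2).
have hK : cancel h h' by case=> N m; rewrite /h /h' /=; congr pair; ring.
have h'K : cancel h' h by case=> N m; rewrite /h /h' /=; congr pair; ring.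
have inner2 N : has_sum (fun m => F (h (N, m))) (q ^ (N ^+ 2 + k * N) * g N).
  have := has_sumZ (q ^ (N ^+ 2 + k * N)) (Hg N); congr has_sum; apply/funext => m.
  rewrite /F /h /= subrK.
  have -> : q ^ (N ^+ 2 + k * (N - m) + 2 * e * m)
      = q ^ (N ^+ 2 + k * N) * q ^ ((2 * e - k) * m).
    by rewrite -!(qexpD q0); congr (_ ^ _); ring.
  rewrite /e; ring.
rewrite (has_sum_uniq HV (has_sum_fubini ((has_sum_bij _ _ hK h'K).1 HS) inner2)).
have P0 := qpoch_inf_neq0 q20 q21 q0 q1.
have := has_sumZr (qpoch_inf q (q ^+ 2))^-1 HS1; congr has_sum; apply/funext => n.
by rewrite mulfK.
Qed.

(** The Rogers-Ramanujan functions G and H as quotients of a theta product by (x;x)_oo, left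
    uncancelled; they are used at x = q^4 and x = -q. *)
Definition rrG (x : C) := qpoch_inf (x ^+ 5) (x ^+ 5) * qpoch_inf (x ^+ 2) (x ^+ 5)
  * qpoch_inf (x ^+ 3) (x ^+ 5) / qpoch_inf x x.
Definition rrH (x : C) := qpoch_inf (x ^+ 5) (x ^+ 5) * qpoch_inf (x ^+ 4) (x ^+ 5)
  * qpoch_inf x (x ^+ 5) / qpoch_inf x x.

Definition gauss_val (N : int) : C :=
  if N is Posz n then (if odd n then 0 else rq (q ^+ 4) (Posz n./2)) else 0.

Lemma gauss_valE N : has_sum (fun m => (-1) ^ m * (rq2 (N - m) * rq2 m)) (gauss_val N).
Proof.
case: N => N; last by apply: has_sum_gauss_neg.
have [He Ho] := gauss_even_odd q20 q21 N./2.
rewrite /gauss_val; case: ifP => oN.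
  have E : 2 * Posz N./2 + 1 = Posz N by have := odd_double_half N; rewrite oN; lia.
  by rewrite E in Ho; exact: Ho.
rewrite (_ : q ^+ 4 = (q ^+ 2) ^+ 2); last by rewrite -exprM.
have E : 2 * Posz N./2 = Posz N by have := odd_double_half N; rewrite oN; lia.
by rewrite E in He; exact: He.
Qed.

Lemma has_sum_gauss_val (k : int) s : has_sum (fun M => q ^ (4 * M ^+ 2 + 2 * k * M) * rq (q ^+ 4)
  M) s ->
  has_sum (fun N => q ^ (N ^+ 2 + k * N) * gauss_val N) s.
Proof.
move=> H; apply: (@has_sum_inj _ _ _ (fun M : int => 2 * M) _ _ _ _).2.
- by move=> x y; lia.
- move=> [N|N] HN; last by rewrite mulr0.
  rewrite /gauss_val; case: ifP => oN; first by rewrite mulr0.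
  case: (HN (Posz N./2)); have := odd_double_half N; rewrite oN; lia.
- move: H; congr has_sum; apply/funext => M; congr (_ ^ _ * _); first by ring.
  case: M => M //; rewrite (_ : 2 * Posz M = (2 * M)%N) // /gauss_val.
  by rewrite mul2n odd_double doubleK.
Qed.

(** For k = d = 0 the inner weight is (-1)^m alone: odd N drop out, and N = 2M gives the G-series in
    base q^4. *)
Lemma slater_X : has_sum (fun n => q ^ (n ^+ 2) * rq q (2 * n)) (rrG (q ^+ 4) / qpoch_inf q (q ^+
  2)).
Proof.
have H1 N : has_sum (fun m => (-1) ^ m * q ^ ((2 * Posz 0 - 0) * m) * (rq2 (N - m) * rq2 m))
  (gauss_val N).
  have := @gauss_valE N; congr has_sum; apply/funext => m.
  by rewrite mulr0 subr0 mul0r expr0z mulr1.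
have /(slater_reduction (d := 0) isT H1) : has_sum (fun N => q ^ (N ^+ 2 + 0 * N) * gauss_val N)
  (rrG (q ^+ 4)); last first.
  by congr has_sum; apply/funext => n; rewrite mul0r !addr0.
apply: has_sum_gauss_val; have q40 : q ^+ 4 != 0 by rewrite expf_neq0.
have := rogers_ramanujan1 q40 (cnorm_qX_lt1 q1 (isT : (0 < 4)%N)); congr has_sum; apply/funext => M.
by rewrite exprzX mulr0 mul0r addr0.
Qed.

Lemma slater_Y' : has_sum (fun n => q ^ (n ^+ 2 + 2 * n) * rq q (2 * n + 1)) (rrH (q ^+ 4) /
  qpoch_inf q (q ^+ 2)).
Proof.
apply: (@slater_reduction 2 1 gauss_val (rrH (q ^+ 4)) isT).
  move=> N; have := @gauss_valE N; congr has_sum; apply/funext => m.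
  by rewrite subrr mul0r expr0z mulr1.
apply: has_sum_gauss_val; have q40 : q ^+ 4 != 0 by rewrite expf_neq0.
have := rogers_ramanujan2 q40 (cnorm_qX_lt1 q1 (isT : (0 < 4)%N)); congr has_sum; apply/funext => M.
by rewrite exprzX; congr (_ ^ _ * _); ring.
Qed.

Let p0 : - q != 0. Proof. by rewrite oppr_eq0. Qed.
Let p1 : cnorm (- q) < 1. Proof. by rewrite cnormN. Qed.

Lemma signq (n m : int) : (exists t, n - m = 2 * t) -> (- q) ^ n = (-1) ^ m * q ^ n.
Proof.
case=> t E; rewrite -[- q]mulN1r expfzMl; congr (_ * _).
have -> : n = m + (t + t) by lia.
by rewrite !sgnD sgn_sq mulr1.
Qed.

(** The inner weight is (-q)^m, with sum 1/(-q;-q)_N. As N^2 + N is even, q may be replaced by -q in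
    the outer power too. *)
Lemma slater_Y : has_sum (fun n => q ^ (n ^+ 2 + n) * rq q (2 * n + 1)) (rrH (- q) / qpoch_inf q
  (q ^+ 2)).
Proof.
have H1 N : has_sum (fun m => (-1) ^ m * q ^ ((2 * Posz 1 - 1) * m) * (rq2 (N - m) * rq2 m)) (rq
  (- q) N).
  have := gauss_alt p0 p1 (N := N); rewrite sqrrN; congr has_sum; apply/funext => m.
  by rewrite -[- q]mulN1r expfzMl (_ : 2 * 1 - 1 = 1) // mul1r.
have /(slater_reduction (d := 1) isT H1) : has_sum (fun N => q ^ (N ^+ 2 + 1 * N) * rq (- q) N)
  (rrH (- q)); last first.
  by congr has_sum; apply/funext => n; rewrite mul1r.
rewrite /rrH; have := rogers_ramanujan2 p0 p1; congr (has_sum _ _); apply/funext => n.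
congr (_ * _); rewrite mul1r (@signq _ 0); last by have [t ->] := sqrz_subl_even n;
  exists (t + n); ring.
by rewrite expr0z !mul1r.
Qed.

(** The inner weight (-1)^m q^(-m) becomes (-q)^m after m -> N - m, at the price of (-1)^N q^(-N);
    this price turns q^(N^2+N) into (-q)^(N^2). *)
Lemma slater_X' : has_sum (fun n => q ^ (n ^+ 2 + n) * rq q (2 * n)) (rrG (- q) / qpoch_inf q (q
  ^+ 2)).
Proof.
have H1 N : has_sum (fun m => (-1) ^ m * q ^ ((2 * Posz 0 - 1) * m) * (rq2 (N - m) * rq2 m))
    ((-1) ^ N * q ^ (- N) * rq (- q) N).
  have := has_sumZ ((-1) ^ N * q ^ (- N)) (gauss_alt p0 p1 (N := N)).
  move/(has_sum_reflect _ N); rewrite sqrrN; congr has_sum; apply/funext => m.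
  rewrite (_ : N - (N - m) = m); last by ring.
  rewrite -[- q]mulN1r expfzMl mulr0 sub0r.
  have -> : q ^ (-1 * m) = q ^ (- N) * q ^ (N - m).
    by rewrite -(qexpD q0); congr (_ ^ _); ring.
  rewrite sgnD sgnN; have := sgn_sq R N; move: ((-1) ^ N) => s E.
  rewrite (_ : s * _ * _ = (s * s) * ((-1) ^ m * (q ^ (- N) * q ^ (N - m)) * (rq2 (N - m) * rq2
    m))); last by ring.
  by rewrite E mul1r.
have /(slater_reduction (d := 0) isT H1) : has_sum (fun N => q ^ (N ^+ 2 + 1 * N) * ((-1) ^ N * q
  ^ (- N) * rq (- q) N))
    (rrG (- q)); last first.
  by congr has_sum; apply/funext => n; rewrite mul1r addr0.
rewrite /rrG; have := rogers_ramanujan1 p0 p1; congr (has_sum _ _); apply/funext => n.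
rewrite (@signq _ n); last by have [t ->] := sqrz_subl_even n; exists t; ring.
have -> : q ^ (n ^+ 2 + 1 * n) = q ^ (n ^+ 2) * q ^ n.
  by rewrite -(qexpD q0); congr (_ ^ _); ring.
have : q ^ n * q ^ (- n) = 1 by rewrite -(qexpD q0) subrr expr0z.
move: (q ^ n) (q ^ (- n)) => a b E.
transitivity ((-1) ^ n * q ^ (n ^+ 2) * (a * b) * rq (- q) n); last by ring.
by rewrite E mulr1.
Qed.
End SlaterSums.

(** * Euler's sum at negative powers of q, by parity *)

Section ShiftedEuler.
Variables (R : realType) (q : R[i]).
Hypotheses (q0 : q != 0) (q1 : cnorm q < 1).
Local Notation C := R[i].

Lemma qpoch_inf_neg_power (r : nat) : qpoch_inf (q ^ (- Posz r)) q = 0.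
Proof.
rewrite (@qpoch_inf_cat _ _ _ r.+1) ?expfz_neq0 // qpochS [q ^+ r]exprnP.
by rewrite -(qexpD q0) addNr expr0z subrr mulr0 mul0r.
Qed.

(** The factors with exponents -r to -1 give q^(-r(r+1)/2) (-q;q)_r, and the factor with exponent 0
    is 2. *)
Lemma qpoch_inf_opp_neg_power (r : nat) : qpoch_inf (- q ^ (- Posz r)) q
  = 2 * qpoch_inf (- q) q * (q ^ (- tri (Posz r + 1)) * qpoch (- q) q r).
Proof.
have nz x : - q ^ x != 0 by rewrite oppr_eq0 expfz_neq0.
elim: r => [|r IH].
  rewrite (_ : tri (Posz 0 + 1) = 0) // (_ : - Posz 0 = 0) // !expr0z.
  rewrite (@qpoch_inf_cat _ _ _ 1) ?oppr_eq0 ?oner_neq0 // qpochS !qpoch0 expr0 expr1.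
  rewrite mulr1 mul1r opprK mulN1r !mulr1.
  by congr (_ * _).
rewrite (@qpoch_inf_cat _ _ _ 1) // qpochS qpoch0 expr0 expr1 mulr1 mul1r.
rewrite mulNr (_ : q ^ (- Posz r.+1) * q = q ^ (- Posz r)); last first.
  by rewrite -[X in _ * X]expr1z -(qexpD q0); congr (_ ^ _); lia.
rewrite IH qpochS.
have -> : q ^ (- tri (Posz r.+1 + 1)) = q ^ (- tri (Posz r + 1)) * q ^ (- Posz r.+1).
  rewrite -(qexpD q0); congr (_ ^ _).
  by have := triB1 (Posz r.+1 + 1); rewrite addrK (_ : Posz r + 1 = Posz r.+1) => [->|]; lia.
have E : q ^ (- Posz r.+1) * (q * q ^+ r) = 1.
  by rewrite -exprS exprnP -(qexpD q0) addNr expr0z.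
move: E; rewrite opprK;
  move: (q ^ (- Posz r.+1)) (q ^+ r) (qpoch_inf _ _) (qpoch _ _ _) (q ^ (- tri _)).
move=> a b x y z E.
transitivity (2 * x * (z * (y * (a + a * (q * b))))); first by rewrite E; ring.
ring.
Qed.

Lemma rq_sqr (r : nat) : rq (q ^+ 2) r * qpoch (- q) q r = rq q r.
Proof.
have -> : rq (q ^+ 2) r = (qpoch q q r * qpoch (- q) q r)^-1.
  rewrite /rq /qpoch -big_split /=; congr (_^-1); apply: eq_bigr => k _.
  rewrite -!exprM mulnC exprM; ring.
rewrite invfM -mulrA mulVf ?mulr1 // qpoch_neq0 ?cnormN //.
Qed.

(* The sum over one parity class of j equals half of the full sum, because the
   alternating sum is (q^-r; q)_oo = 0. *)
Lemma euler_half (r : nat) (e : int) :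
  has_sum (fun j => (1 + (-1) ^ (j + e)) / 2 * (q ^ (tri j - Posz r * j) * rq q j))
     (qpoch_inf (- q) q * (q ^ (- tri (Posz r + 1)) * qpoch (- q) q r)).
Proof.
have z0 : q ^ (- Posz r) != 0 by rewrite expfz_neq0.
have z1 : - q ^ (- Posz r) != 0 by rewrite oppr_eq0.
have := has_sumZ (1 / 2) (has_sumD (euler_sum q0 q1 z0) (has_sumZ ((-1) ^ e) (euler_sum q0 q1 z1))).
rewrite opprK qpoch_inf_neg_power mulr0 addr0 qpoch_inf_opp_neg_power.
rewrite (_ : 1 / 2 * _ = qpoch_inf (- q) q * (q ^ (- tri (Posz r + 1)) * qpoch (- q) q r));
  last by field.
congr has_sum; apply/funext => j.
rewrite -[- q ^ _]mulN1r expfzMl exprz_exp mulNr sgnD (qexpD q0) /euler_coef.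
by field.
Qed.
End ShiftedEuler.

(** * Reduction of the triple sum to a theta series times a single sum *)

Section NahmSum.
Variables (R : realType) (q : R[i]).
Hypotheses (q0 : q != 0) (q1 : cnorm q < 1).
Local Notation C := R[i].
Local Notation Q := (q ^+ 5).
Let Q0 : Q != 0. Proof. by rewrite expf_neq0. Qed.
Let Q1 : cnorm Q < 1. Proof. exact: cnorm_qX_lt1. Qed.
Let Q21 : cnorm (Q ^+ 2) < 1. Proof. exact: cnorm_qX_lt1. Qed.

(* c = 0 and c = 1 are the two exponents of the theorem. *)
Variables (c : int) (E : int -> int -> int -> int).
Hypothesis E2 : forall i j k, 2 * E i j k = 3 * i ^+ 2 + 7 * j ^+ 2 + 8 * k ^+ 2
  - 8 * i * j - 6 * i * k + 8 * j * k + (1 + 4 * c) * i - (3 + 2 * c) * j + 4 * (1 - c) * k.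
Hypothesis E_growth : forall i j k : int, 0 <= i -> 0 <= j -> 0 <= k -> 2 * (i + j + k) - 10 <= E
  i j k.

Definition nahm3 (x : int * int * int) : C :=
  q ^ E x.1.1 x.1.2 x.2 * (rq Q x.1.1 * rq Q x.1.2 * rq Q x.2).

Definition nahm4 (x : int * int * int * int) : C :=
  q ^ E x.1.1.1 x.1.1.2 x.1.2 * (rq (Q ^+ 2) x.2 * euler_coef Q (x.1.1.1 - 2 * x.2) * rq Q x.1.1.2
    * rq Q x.1.2).

Lemma has_sum_nahm3 S : has_sum nahm4 S -> has_sum nahm3 S.
Proof.
move=> H; apply: (has_sum_fubini H) => -[[i j] k]; rewrite /nahm4 /nahm3 /=.
have := has_sumZ (q ^ E i j k * (rq Q j * rq Q k)) (rq_split Q0 Q1 (n := i)).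
rewrite (_ : q ^ E i j k * (rq Q j * rq Q k) * rq Q i = q ^ E i j k * (rq Q i * rq Q j * rq Q k));
  last by ring.
by congr has_sum; apply/funext => r; ring.
Qed.

Lemma cnorm_mul3_le (x y z B : R) : 0 <= x -> 0 <= y -> 0 <= z -> x <= B -> y <= B -> z <= B ->
  x * y * z <= B ^+ 3.
Proof.
move=> x0 y0 z0 xB yB zB; rewrite exprS expr2 mulrA.
by rewrite ler_pM ?mulr_ge0 // ler_pM.
Qed.

(** On the support 0 <= 2r <= i, so the slope 2 of [E_growth] also pays for the fourth index r, and
    a fourfold geometric series dominates. *)
Lemma abs_summable_nahm4 : abs_summable nahm4.
Proof.
have sg : abs_summable (fun n : int => q ^ Posz `|n|%N).
  by apply: (abs_summable_int_bound q0 q1 (c := 1) (K := 0)) => n; rewrite mul1r subr0.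
have s4 := abs_summable_prod (abs_summable_prod (abs_summable_prod sg sg) sg) sg.
have [B1 B10 HB1] := cnorm_rq_theta Q1; have [B2 B20 HB2] := cnorm_rq_theta Q21.
apply: (abs_summable_le _ (cnorm (q ^ (- 10)) * (B2 * B1 ^+ 3)) _ s4) => -[[[i j] k] r].
rewrite /nahm4 /=.
have rhs0 : 0 <= cnorm (q ^ (- 10)) * (B2 * B1 ^+ 3) *
   cnorm (q ^ Posz `|i|%N * q ^ Posz `|j|%N * q ^ Posz `|k|%N * q ^ Posz `|r|%N).
  by rewrite !mulr_ge0 ?cnorm_ge0 ?exprn_ge0.
case: (ltP r 0) => r0; first by rewrite (rq_neg _ r0) !mul0r mulr0 cnorm0.
case: (ltP (i - 2 * r) 0) => s0.
  by rewrite /euler_coef (rq_neg _ s0) !(mulr0, mul0r) cnorm0.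
case: (ltP j 0) => j0; first by rewrite (rq_neg _ j0) !(mulr0, mul0r) cnorm0.
case: (ltP k 0) => k0; first by rewrite (rq_neg _ k0) !(mulr0, mul0r) cnorm0.
rewrite -!(qexpD q0) /euler_coef exprzX.
set a := rq _ r; set b := rq _ (i - _); set d := rq _ j; set f := rq _ k.
rewrite (_ : q ^ E i j k * _ = q ^ (E i j k + 5 * tri (i - 2 * r)) * (a * (b * d * f))); last first.
  rewrite (qexpD q0); ring.
rewrite cnormM [leRHS]mulrAC ler_pM ?cnorm_ge0 //.
  rewrite -cnormM -(qexpD q0) cnorm_exp_le //.
  have i0 : 0 <= i by clear - r0 s0; lia.
  have t0 : 0 <= tri (i - 2 * r) by have := tri2 (i - 2 * r); clear - s0; nia.
  have := E_growth i0 j0 k0; clear - i0 j0 k0 r0 s0 t0; lia.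
rewrite cnormM ler_pM ?cnorm_ge0 //; first exact: HB2.
by rewrite !cnormM cnorm_mul3_le ?cnorm_ge0 ?HB1.
Qed.

(** Coordinates (rho, j, M, k) with i = M - 2j + k and r = 2 rho + b. The parity of r is fixed
    because the square completed later in M involves 5r/2. *)
Definition parity_param (b : bool) (y : int * int * int * int) : int * int * int * int :=
  (y.1.2 - 2 * y.1.1.2 + y.2, y.1.1.2, y.2, 2 * y.1.1.1 + Posz b).

Lemma parity_param_inj b : injective (parity_param b).
Proof. by clear; move=> [[[? ?] ?] ?] [[[? ?] ?] ?] [] *; congr (_, _, _, _); lia. Qed.

Lemma nahm4_split S : has_sum nahm4 S -> exists S0 S1, [/\ S = S0 + S1,
  has_sum (fun y => nahm4 (parity_param false y)) S0 & has_sum (fun y => nahm4 (parity_param true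
    y)) S1].
Proof.
move=> HS; have [S0 H0] := abs_summable_has_sum (abs_summable_inj (@parity_param_inj false)
  abs_summable_nahm4).
have [S1 H1] := abs_summable_has_sum (abs_summable_inj (@parity_param_inj true) abs_summable_nahm4).
exists S0, S1; split=> //.
pose h (x : bool * (int * int * int * int)) := parity_param x.1 x.2.
pose h' (x : int * int * int * int) : bool * (int * int * int * int) :=
  ((x.2 %% 2)%Z == 1, ((x.2 %/ 2)%Z, x.1.1.2, x.1.1.1 + 2 * x.1.1.2 - x.1.2, x.1.2)).
have hK : cancel h h'.
  clear.
  move=> [b [[[r j] M] k]]; rewrite /h /h' /parity_param /=; congr (_, (_, _, _, _)); case: b; lia.
have h'K : cancel h' h.
  clear.
  move=> [[[i j] k] r]; rewrite /h /h' /parity_param /=; congr (_, _, _, _); lia.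
have H2 : forall b : bool, has_sum (fun y => nahm4 (h (b, y))) (if b then S1 else S0) by case;
  [exact: H1 | exact: H0].
have H3 := has_sum_fubini ((has_sum_bij _ _ hK h'K).1 HS) H2.
apply: (has_sum_uniq H3).
have := @has_sum_finite R _ [:: false; true] (fun b : bool => if b then S1 else S0) isT.
by rewrite big_cons big_seq1; apply; case.
Qed.

Lemma expr5z (m : int) : Q ^ m = q ^ (5 * m).
Proof. exact: exprzX. Qed.

(** With N = M - 2r - 2j, the exponent gains 5k(k+1)/2 from [E] and 5(tri(k+N) - tri N) from the
    Euler coefficient, together 5(k^2 + kN): a Durfee sum in base Q. *)
Lemma nahm4_inner (b : bool) (rho j M : int) : let r := 2 * rho + Posz b in
  has_sum (fun k => nahm4 (parity_param b (rho, j, M, k)))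
     ((qpoch_inf Q Q)^-1 * (rq (Q ^+ 2) r * rq Q j) * q ^ (E (M - 2 * j) j 0 + 5 * tri (M - 2 * r
       - 2 * j))).
Proof.
move=> r; set N := M - 2 * r - 2 * j.
have := has_sumZ (rq (Q ^+ 2) r * rq Q j * q ^ (E (M - 2 * j) j 0 + 5 * tri N)) (durfee Q0 Q1 N).
rewrite [X in has_sum _ X -> _](_ : _ = (qpoch_inf Q Q)^-1 * (rq (Q ^+ 2) r * rq Q j) *
  q ^ (E (M - 2 * j) j 0 + 5 * tri N)); last by rewrite mulrC mulrA.
congr has_sum; apply/funext => k; rewrite /nahm4 /parity_param /= -/r /euler_coef !expr5z.
rewrite (_ : M - 2 * j + k - 2 * r = k + N); last by rewrite /N; ring.
have X : q ^ (E (M - 2 * j) j 0 + 5 * tri N) * q ^ (5 * (k ^+ 2 + k * N))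
    = q ^ E (M - 2 * j + k) j k * q ^ (5 * tri (k + N)).
  rewrite -!(qexpD q0); congr (_ ^ _); apply: (@mulfI _ 2) => //.
  rewrite (triD k N).
  transitivity (2 * E (M - 2 * j) j 0 + 5 * (2 * tri N) + 10 * (k ^+ 2 + k * N)); first by ring.
  transitivity (2 * E (M - 2 * j + k) j k + 5 * (2 * tri k) + 5 * (2 * tri N) + 10 * k * N);
    last by ring.
  rewrite !E2 !tri2; ring.
move: X; move: (q ^ (E (M - 2 * j) j 0 + 5 * tri N)) (q ^ (5 * (k ^+ 2 + k * N)))
  (q ^ E (M - 2 * j + k) j k) (q ^ (5 * tri (k + N))) => x1 x2 x3 x4 X.
transitivity (x1 * x2 * (rq (Q ^+ 2) r * rq Q (k + N) * rq Q j * rq Q k)); first by ring.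
rewrite X; ring.
Qed.

Lemma sgn_even (n : int) : (-1) ^ (2 * n) = 1 :> C.
Proof. by rewrite mulrDl mul1r sgnD sgn_sq. Qed.

(* With n = 2 M - 5 (j + rho) - s the exponent of q separates into a part in n and
   a part in (rho, j); the pairs (j, n) are constrained only by parity. *)
Lemma nahm_half (b : bool) (s t : int) (K : int -> int) V S :
  (forall rho j M, let r := 2 * rho + Posz b in let n := 2 * M - 5 * (j + rho) - s in
    8 * M ^+ 2 + (4 * c - 4) * M + 55 * j ^+ 2 + (5 - 10 * c) * j - 40 * M * j - 20 * M * r
      + 20 * r ^+ 2 + 40 * r * j + 10 * r
    = 2 * (n ^+ 2 - t * n) + 5 * (j ^+ 2 - j) - 10 * r * j + 2 * K rho) ->
  has_sum (fun n => q ^ (n ^+ 2 - t * n)) V ->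
  has_sum (fun y => nahm4 (parity_param b y)) S ->
  has_sum (fun rho => qpoch_inf (- Q) Q / qpoch_inf Q Q * V *
       (q ^ (K rho - 5 * tri (2 * rho + Posz b + 1)) * rq Q (2 * rho + Posz b))) S.
Proof.
move=> HK HV HS.
have H2 := has_sum_fubini HS (fun x => @nahm4_inner b x.1.1 x.1.2 x.2).
pose r rho := 2 * rho + Posz b.
pose P := (qpoch_inf Q Q)^-1.
(* The factor (1 + (-1)^_)/2 is the indicator of the range of [h], where n + 5(j + rho) + s is even.
   It extends the sum by zero to all (rho, n, j), so that j can be summed at fixed n. *)
pose f (x : int * int * int) : C := P * rq (Q ^+ 2) (r x.1.1) * q ^ (x.1.2 ^+ 2 - t * x.1.2 + K
  x.1.1)
  * ((1 + (-1) ^ (x.2 + (x.1.2 + x.1.1 + s))) / 2 * (Q ^ (tri x.2 - r x.1.1 * x.2) * rq Q x.2)).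
pose h (y : int * int * int) := (y.1.1, 2 * y.2 - 5 * (y.1.2 + y.1.1) - s, y.1.2).
have hI : injective h.
  by clear; move=> [[? ?] ?] [[? ?] ?] [] *; congr (_, _, _); lia.
have f_off x : (forall y, x <> h y) -> f x = 0.
  case: x => [[rho n] j] off; rewrite /f /=.
    case: (boolP ((n + 5 * (j + rho) + s) %% 2 == 0)%Z) => [/eqP ev|od].
      case: (off (rho, j, ((n + 5 * (j + rho) + s) %/ 2)%Z)); rewrite /h /=.
      by congr (_, _, _); clear - ev; lia.
    have [u Hu] : exists u : int, j + (n + rho + s) = 2 * u + 1.
      by exists (((j + (n + rho + s)) %/ 2)%Z); clear - od; lia.
    by rewrite Hu sgnD sgn_even expr1z mul1r subrr !mul0r mulr0.
have H3 : has_sum f S.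
  apply: (@has_sum_inj R _ _ h f S hI f_off).2.
  move: H2; congr has_sum; apply/funext => -[[rho j] M]; rewrite /f /h /=.
  set n := 2 * M - _ - s.
  have -> : j + (n + rho + s) = 2 * (M - 2 * j - 2 * rho) by rewrite /n; ring.
  rewrite sgn_even -/(r rho) (_ : (1 + 1) / 2 = 1 :> C) ?mul1r; last by field.
  rewrite expr5z -/P.
  have -> : q ^ (E (M - 2 * j) j 0 + 5 * tri (M - 2 * r rho - 2 * j))
     = q ^ (n ^+ 2 - t * n + K rho) * q ^ (5 * (tri j - r rho * j)).
    rewrite -!(qexpD q0); congr (_ ^ _); apply: (@mulfI _ 2) => //.
    (* The left-hand side of [HK] is 2E(M - 2j, j, 0) + 10 tri(M - 2r - 2j), written out. *)
    have HKr : 2 * K rho = 8 * M ^+ 2 + (4 * c - 4) * M + 55 * j ^+ 2 + (5 - 10 * c) * j - 40 * M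
      * j - 20 * M * r rho
      + 20 * r rho ^+ 2 + 40 * r rho * j + 10 * r rho - (2 * (n ^+ 2 - t * n) + 5 * (j ^+ 2 - j) -
        10 * r rho * j).
      by have := HK rho j M; rewrite /= -/(r rho) -/n => ->; ring.
    transitivity (2 * E (M - 2 * j) j 0 + 5 * (2 * tri (M - 2 * r rho - 2 * j))); first by ring.
    transitivity (2 * (n ^+ 2 - t * n) + 2 * K rho + 5 * (2 * tri j) - 10 * r rho * j);
      last by ring.
    rewrite E2 !tri2 HKr; ring.
  ring.
have H4 := has_sum_fubini H3.
have inner x : has_sum (fun j => f (x, j)) (qpoch_inf (- Q) Q / qpoch_inf Q Q *
     (q ^ (K x.1 - 5 * tri (r x.1 + 1)) * rq Q (r x.1)) * q ^ (x.2 ^+ 2 - t * x.2)).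
  case: x => rho n /=.
  case rE : (r rho) => [m|m]; last first.
    rewrite !mulr0 mul0r; have := @has_sum_zero R int; congr has_sum; apply/funext => j.
    by rewrite /f /= rE mulr0 !mul0r.
  have := has_sumZ (P * rq (Q ^+ 2) m * q ^ (n ^+ 2 - t * n + K rho)) (@euler_half _ _ Q0 Q1 m (n
    + rho + s)).
  rewrite (_ : P * _ * _ * _ = qpoch_inf (- Q) Q / qpoch_inf Q Q *
     (q ^ (K rho - 5 * tri (Posz m + 1)) * rq Q m) * q ^ (n ^+ 2 - t * n)).
    by congr has_sum; apply/funext => j; rewrite /f /= rE.
  (* The factor (-Q;Q)_r produced by [euler_half] turns 1/(Q^2;Q^2)_r into 1/(Q;Q)_r. *)
  rewrite -(rq_sqr Q1) expr5z !(qexpD q0) mulrN /P.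
  move: (q ^ (n ^+ 2)) (q ^ (- (t * n))) (q ^ K rho) (q ^ (- _)) (rq _ _) (qpoch _ _ _) => *; ring.
have H5 := H4 _ inner.
apply: (has_sum_fubini H5) => rho /=.
have := has_sumZ (qpoch_inf (- Q) Q / qpoch_inf Q Q * (q ^ (K rho - 5 * tri (r rho + 1)) * rq Q (r
  rho))) HV.
by congr (has_sum _ _); rewrite -/(r rho) mulrAC.
Qed.
End NahmSum.

(** * Theta series: dissection modulo 5 and products of two *)

Section ThetaIdentities.
Variables (R : realType) (q : R[i]).
Hypotheses (q0 : q != 0) (q1 : cnorm q < 1).
Local Notation C := R[i].

Lemma has_sum_dissect5 (f : int -> C) (l : int) (s : 'I_5 -> C) S : has_sum f S ->
  (forall b : 'I_5, has_sum (fun a => f (5 * a + Posz b + l)) (s b)) -> S = \sum_b s b.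
Proof.
move=> Hf Hs.
pose h (x : 'I_5 * int) : int := 5 * x.2 + Posz x.1 + l.
pose h' (n : int) : 'I_5 * int := (inord `|((n - l) %% 5)%Z|, ((n - l) %/ 5)%Z).
have hK : cancel h h'.
  move=> [b a]; rewrite /h /h' /=; have b5 := ltn_ord b.
  have -> : ((5 * a + Posz b + l - l) %/ 5)%Z = a by clear - b5; lia.
  suff -> : inord `|((5 * a + Posz b + l - l) %% 5)%Z| = b by [].
  by apply: val_inj; rewrite /= inordK; clear - b5; lia.
have h'K : cancel h' h.
  by clear; move=> n; rewrite /h /h' /= inordK; lia.
have := has_sum_fubini ((has_sum_bij _ _ hK h'K).1 Hf) Hs => /has_sum_uniq; apply.
have := @has_sum_finite R _ (index_enum 'I_5) s (index_enum_uniq _); apply => x.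
by rewrite mem_index_enum.
Qed.

Lemma has_sum_dissect5_explicit (f : int -> C) (l b1 b2 b3 b4 : int) S s0 s1 s2 s3 s4 : has_sum f
  S ->
  b1 = 1 + l -> b2 = 2 + l -> b3 = 3 + l -> b4 = 4 + l ->
  has_sum (fun a => f (5 * a + l)) s0 -> has_sum (fun a => f (5 * a + b1)) s1 ->
  has_sum (fun a => f (5 * a + b2)) s2 -> has_sum (fun a => f (5 * a + b3)) s3 ->
  has_sum (fun a => f (5 * a + b4)) s4 -> S = s0 + s1 + s2 + s3 + s4.
Proof.
move=> Hf -> -> -> -> H0 H1 H2 H3 H4.
pose s (b : 'I_5) := tnth [tuple s0; s1; s2; s3; s4] b.
rewrite (@has_sum_dissect5 f l s S Hf) => [|b].
  by rewrite !big_ord_recl big_ord0 /s /tnth /= addr0 !addrA.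
have addE (m : int) t : has_sum (fun a => f (5 * a + (m + l))) t -> has_sum (fun a => f (5 * a + m
  + l)) t.
  by congr (has_sum _ t); apply/funext => a; rewrite addrA.
case: b => i Hi; apply: addE; rewrite /s (tnth_nth 0).
case: i Hi => [|[|[|[|[|i]]]]] Hi.
- by rewrite add0r; exact: H0.
- exact: H1.
- exact: H2.
- exact: H3.
- exact: H4.
- by exfalso.
Qed.

Definition theta (m k : nat) : C :=
  qpoch_inf (q ^+ m) (q ^+ m) * qpoch_inf (- q ^+ k) (q ^+ m) * qpoch_inf (- q ^+ (m - k)) (q ^+ m).

Lemma has_sum_theta (m k : nat) : (0 < m)%N -> (k <= m)%N ->
  has_sum (fun n => q ^ (Posz m * tri n + Posz k * n)) (theta m k).
Proof.
move=> m0 km; have := jacobi_pow q0 q1 (mul1r (1 : C)) m0 km.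
by rewrite !mul1r; congr has_sum; apply/funext => n; rewrite exp1rz mul1r.
Qed.

Lemma theta_sym (m k : nat) : (k <= m)%N -> theta m (m - k) = theta m k.
Proof. by move=> km; rewrite /theta (subKn km); exact: mulrAC. Qed.

Lemma abs_summable_theta_pow (m k : nat) : (0 < m)%N -> abs_summable (fun n => q ^ (Posz m * tri n
  + Posz k * n)).
Proof.
move=> m0; have qm0 : q ^+ m != 0 by rewrite expf_neq0.
apply: (abs_summable_int_bound q0 q1 (c := 1) (K := (Posz k + 2) ^+ 2)) => n.
rewrite mul1r cnorm_exp_le //; have := tri_growth k n.
have : 0 <= tri n by have := tri2 n; clear; nia.
move=> t0; rewrite absz_nat => h; apply: le_trans h _; rewrite lerD2r; clear - t0 m0; nia.
Qed.

(** In the odd class u = x + y - 1 and v = x - y, so the term x = y = 0 has exponent 5 - k, hence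
    the prefactor. The inequalities on k and l make every natural subtraction exact. *)
Lemma theta_product (k l : nat) : (k <= 5)%N -> (l <= k)%N -> (5 <= k + l)%N ->
  theta 5 k * theta 5 l = theta 10 (k + l) * theta 10 (5 + k - l)
    + q ^+ (5 - k) * (theta 10 (k + l - 5) * theta 10 (k - l)).
Proof.
move=> k5 lk kl5; have l5 : (l <= 5)%N := leq_trans lk k5.
have H := has_sum_prod (abs_summable_theta_pow k (isT : (0 < 5)%N)) (abs_summable_theta_pow l (isT
  : (0 < 5)%N))
  (has_sum_theta (isT : (0 < 5)%N) k5) (has_sum_theta (isT : (0 < 5)%N) l5).
pose h (x : bool * (int * int)) : int * int := (x.2.1 + x.2.2 - Posz x.1, x.2.1 - x.2.2).
pose h' (x : int * int) : bool * (int * int) :=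
  (((x.1 + x.2) %% 2)%Z == 1, ((x.1 + x.2 + 1) %/ 2, (x.1 - x.2 + 1) %/ 2)%Z).
have hK : cancel h h'.
  clear; move=> [b [x y]]; rewrite /h /h' /=; congr (_, (_, _)); case: b => /=; lia.
have h'K : cancel h' h.
  clear; move=> [x y]; rewrite /h /h' /=; congr (_, _); lia.
have triE (a b : int) : tri (a + b) + tri (a - b) = 2 * tri a + 2 * tri b + b.
  apply: (@mulfI _ 2) => //; transitivity (2 * tri (a + b) + 2 * tri (a - b)); first by ring.
  rewrite !tri2; ring.
have inner (b : bool) : has_sum (fun y => q ^ (Posz 5 * tri (h (b, y)).1 + Posz k * (h (b, y)).1)
     * q ^ (Posz 5 * tri (h (b, y)).2 + Posz l * (h (b, y)).2))
   (if b then q ^+ (5 - k) * (theta 10 (k + l - 5) * theta 10 (k - l))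
    else theta 10 (k + l) * theta 10 (5 + k - l)).
  case: b; rewrite /h /=.
  - have A1 : (k + l - 5 <= 10)%N by lia.
    have A2 : (k - l <= 10)%N by lia.
    have := has_sumZ (q ^+ (5 - k)) (has_sum_prod (abs_summable_theta_pow (k + l - 5) (isT : (0 <
      10)%N))
      (abs_summable_theta_pow (k - l) (isT : (0 < 10)%N))
      (has_sum_theta (isT : (0 < 10)%N) A1) (has_sum_theta (isT : (0 < 10)%N) A2)).
    congr has_sum; apply/funext => -[x y] /=; rewrite exprnP -!(qexpD q0); congr (_ ^ _).
    have -> : tri (x - y) = 2 * tri x + 2 * tri y + y - (tri (x + y - 1) + (x + y - 1)).
      by rewrite -triE -triB1; ring.
    rewrite -!subzn // PoszD /=; ring.
  - have A1 : (k + l <= 10)%N by lia.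
    have A2 : (5 + k - l <= 10)%N by lia.
    have := has_sum_prod (abs_summable_theta_pow (k + l) (isT : (0 < 10)%N))
      (abs_summable_theta_pow (5 + k - l) (isT : (0 < 10)%N))
      (has_sum_theta (isT : (0 < 10)%N) A1) (has_sum_theta (isT : (0 < 10)%N) A2).
    congr has_sum; apply/funext => -[x y] /=; rewrite -!(qexpD q0); congr (_ ^ _).
    have -> : tri (x - y) = 2 * tri x + 2 * tri y + y - tri (x + y) by rewrite -triE; ring.
    rewrite subr0 -subzn ?PoszD; last by rewrite (leq_trans l5) ?leq_addr.
    ring.
have Hb := has_sum_fubini ((has_sum_bij _ _ hK h'K).1 H) inner.
apply: (has_sum_uniq Hb).
have := @has_sum_finite R _ [:: false;
  true] (fun b : bool => if b then q ^+ (5 - k) * (theta 10 (k + l - 5) * theta 10 (k - l))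
    else theta 10 (k + l) * theta 10 (5 + k - l)) isT.
by rewrite big_cons big_seq1; apply; case.
Qed.
End ThetaIdentities.

(** * The square series split modulo 5 *)

Section ThetaDissections.
Variables (R : realType) (q : R[i]).
Hypotheses (q0 : q != 0) (q1 : cnorm q < 1).
Local Notation C := R[i].
Local Notation Q := (q ^+ 5).
Let Q0 : Q != 0. Proof. by rewrite expf_neq0. Qed.
Let Q1 : cnorm Q < 1. Proof. exact: cnorm_qX_lt1. Qed.

Lemma has_sum_square (t : int) : exists V, has_sum (fun n => q ^ (n ^+ 2 - t * n)) V.
Proof.
apply: abs_summable_has_sum; apply: (@abs_summable_gauss _ _ q0 q1 _ 1 (- t) 0) => k.
by rewrite mul1r subr0 mulNr.
Qed.

(** The part of the exponent depending on a is 25a^2 + 5(2b - t)a = 5(10 tri(a) + (2b + 5 - t)a). *)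
Lemma has_sum_square_class (t b : int) (e k : nat) : (k <= 10)%N ->
  Posz e = b ^+ 2 - t * b -> Posz k = 2 * b + 5 - t ->
  has_sum (fun a => q ^ ((5 * a + b) ^+ 2 - t * (5 * a + b))) (q ^+ e * theta Q 10 k).
Proof.
move=> k10 He Hk; have := has_sumZ (q ^+ e) (has_sum_theta Q0 Q1 (isT : (0 < 10)%N) k10).
congr has_sum; apply/funext => a; rewrite exprzX exprnP -(qexpD q0); congr (_ ^ _).
rewrite He Hk; have := tri2 a; clear; nia.
Qed.

Lemma square_dissection0 : has_sum (fun n => q ^ (n ^+ 2 - 0 * n))
  (theta Q 10 5 + 2 * q * theta Q 10 3 + 2 * q ^+ 4 * theta Q 10 1).
Proof.
have [V HV] := has_sum_square 0; move: (HV).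
(* The residues -2 to 2 are those for which the theta index 2b + 5 lies between 0 and 10; the
   indices 7 and 9 then fold onto 3 and 1. *)
rewrite (has_sum_dissect5_explicit (l := -2) HV (erefl (-1)) (erefl 0) (erefl 1) (erefl 2)
  (@has_sum_square_class 0 (-2) 4 1 isT erefl erefl) (@has_sum_square_class 0 (-1) 1 3 isT erefl
    erefl)
  (@has_sum_square_class 0 0 0 5 isT erefl erefl) (@has_sum_square_class 0 1 1 7 isT erefl erefl)
  (@has_sum_square_class 0 2 4 9 isT erefl erefl)).
rewrite -(theta_sym _ (isT : (3 <= 10)%N)) -(theta_sym _ (isT : (1 <= 10)%N)).
move: (theta _ _ _) (theta _ _ _) (theta _ _ _) => x y z.
rewrite expr0 expr1; congr (has_sum _ _); ring.
Qed.

Lemma square_dissection1 : has_sum (fun n => q ^ (n ^+ 2 - 1 * n))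
  (2 * theta Q 10 4 + 2 * q ^+ 2 * theta Q 10 2 + q ^+ 6 * theta Q 10 0).
Proof.
have [V HV] := has_sum_square 1; move: (HV).
rewrite (has_sum_dissect5_explicit (l := -1) HV (erefl 0) (erefl 1) (erefl 2) (erefl 3)
  (@has_sum_square_class 1 (-1) 2 2 isT erefl erefl) (@has_sum_square_class 1 0 0 4 isT erefl erefl)
  (@has_sum_square_class 1 1 0 6 isT erefl erefl) (@has_sum_square_class 1 2 2 8 isT erefl erefl)
  (@has_sum_square_class 1 3 6 10 isT erefl erefl)).
rewrite -(theta_sym _ (isT : (2 <= 10)%N)) -(theta_sym _ (isT : (4 <= 10)%N)) -(theta_sym _ (isT :
  (0 <= 10)%N)).
move: (theta _ _ _) (theta _ _ _) (theta _ _ _) => x y z.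
rewrite expr0; congr (has_sum _ _); ring.
Qed.
End ThetaDissections.

Section ExplicitProducts.
Variables (K : comPzRingType) (F : nat -> K).
Lemma prod_ord2 k m : \prod_(i < 2) F (k + m * i) = F k * F (k + m)%N.
Proof. by rewrite !big_ord_recl big_ord0 /= muln0 muln1 addn0 mulr1. Qed.
Lemma prod_ord5 m : \prod_(i < 5) F (m + m * i)
  = F m * F (2 * m)%N * F (3 * m)%N * F (4 * m)%N * F (5 * m)%N.
Proof.
rewrite !big_ord_recl big_ord0 /= mulr1 !mulrA.
by congr (F _ * F _ * F _ * F _ * F _); rewrite /bump /=; lia.
Qed.
Lemma prod_ord5_odd : \prod_(i < 5) F (1 + 2 * i) = F 1 * F 3 * F 5 * F 7 * F 9.
Proof. by rewrite !big_ord_recl big_ord0 /= mulr1 !mulrA. Qed.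
Lemma prod_ord10 : \prod_(i < 10) F (1 + 1 * i)
  = F 1 * F 2 * F 3 * F 4 * F 5 * F 6 * F 7 * F 8 * F 9 * F 10.
Proof. by rewrite !big_ord_recl big_ord0 /= mulr1 !mulrA. Qed.
End ExplicitProducts.

(** * Every product expressed by residues modulo 10 *)

Section ProductEvaluations.
Variables (R : realType).
Local Notation C := R[i].

Lemma qpoch_inf_residues (x e : C) (m d k n : nat) : x != 0 -> cnorm x < 1 -> e != 0 ->
  (0 < m)%N -> (0 < d)%N -> (m * d = n)%N ->
  qpoch_inf (e * x ^+ k) (x ^+ m) = \prod_(i < d) qpoch_inf (e * x ^+ (k + m * i)) (x ^+ n).
Proof.
move=> x0 x1 e0 m0 d0 <-.
have a0 : e * x ^+ k != 0 by rewrite mulf_neq0 ?expf_neq0.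
rewrite (qpoch_inf_dissect d0 a0 (expf_neq0 m x0) (cnorm_qX_lt1 x1 m0)).
by rewrite -exprM; apply: eq_bigr => i _; rewrite -mulrA -exprM -exprD.
Qed.

Lemma qpoch_inf_opp1 (y : C) : y != 0 -> cnorm y < 1 -> qpoch_inf (-1) y = 2 * qpoch_inf (- y) y.
Proof.
move=> y0 y1; have N1 : -1 != 0 :> C by rewrite oppr_eq0 oner_neq0.
rewrite (qpoch_inf_cat 1 N1 y0 y1) /qpoch big_ord1 expr0 expr1 mulr1 opprK.
by rewrite mulN1r.
Qed.

Variable x : C.
Hypotheses (x0 : x != 0) (x1 : cnorm x < 1).

Definition qA (k : nat) := qpoch_inf (x ^+ k) (x ^+ 10).
Definition qB (k : nat) := qpoch_inf (- x ^+ k) (x ^+ 10).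

Let x10 : x ^+ 10 != 0. Proof. exact: expf_neq0. Qed.
Let x101 : cnorm (x ^+ 10) < 1. Proof. exact: cnorm_qX_lt1. Qed.

Lemma qA_neq0 k : (0 < k)%N -> qA k != 0.
Proof.
by move=> k0; apply: (qpoch_inf_neq0 x10 x101); [exact: expf_neq0 | exact: cnorm_qX_lt1].
Qed.

Lemma qB_neq0 k : (0 < k)%N -> qB k != 0.
Proof.
move=> k0; apply: (qpoch_inf_neq0 x10 x101); first by rewrite oppr_eq0 expf_neq0.
by rewrite cnormN cnorm_qX_lt1.
Qed.

Lemma qA_split (m d k : nat) : (0 < m)%N -> (0 < d)%N -> (m * d = 10)%N ->
  qpoch_inf (x ^+ k) (x ^+ m) = \prod_(i < d) qA (k + m * i).
Proof.
move=> m0 d0 md; rewrite -[x ^+ k]mul1r (qpoch_inf_residues k x0 x1 (oner_neq0 C) m0 d0 md).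
by apply: eq_bigr => i _; rewrite mul1r.
Qed.

Lemma qB_split (m d k : nat) : (0 < m)%N -> (0 < d)%N -> (m * d = 10)%N ->
  qpoch_inf (- x ^+ k) (x ^+ m) = \prod_(i < d) qB (k + m * i).
Proof.
move=> m0 d0 md; have N1 : -1 != 0 :> C by rewrite oppr_eq0 oner_neq0.
rewrite -[- x ^+ k]mulN1r (qpoch_inf_residues k x0 x1 N1 m0 d0 md).
by apply: eq_bigr => i _; rewrite mulN1r.
Qed.

Lemma qA_mod5 k : qpoch_inf (x ^+ k) (x ^+ 5) = qA k * qA (k + 5).
Proof. rewrite (@qA_split 5 2 k isT isT erefl); exact: (prod_ord2 qA k 5). Qed.

Lemma qB_mod5 k : qpoch_inf (- x ^+ k) (x ^+ 5) = qB k * qB (k + 5).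
Proof. rewrite (@qB_split 5 2 k isT isT erefl); exact: (prod_ord2 qB k 5). Qed.

Lemma qpoch_inf_sqr_pow k m n : (0 < m)%N -> (m * 2 = n)%N ->
  qpoch_inf (x ^+ (k * 2)) (x ^+ n) = qpoch_inf (x ^+ k) (x ^+ m) * qpoch_inf (- x ^+ k) (x ^+ m).
Proof.
move=> m0 <-; rewrite !exprM.
exact: (qpoch_inf_sqr (expf_neq0 _ x0) (expf_neq0 _ x0) (cnorm_qX_lt1 x1 m0)).
Qed.

Lemma qAB_sqr k : qpoch_inf (x ^+ (k * 2)) (x ^+ 20) = qA k * qB k.
Proof. exact: qpoch_inf_sqr_pow. Qed.

(** From (a^2;y^2)_oo = (a;y)_oo (-a;y)_oo at y = x^5. These relations, for k = 1 to 5, are the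
    source of [rel] in the product algebra. *)
Lemma qA_double k : qA (k * 2) = qA k * qA (k + 5) * (qB k * qB (k + 5)).
Proof.
rewrite -qA_mod5 -qB_mod5; exact: qpoch_inf_sqr_pow.
Qed.

Lemma qB0 : qB 0 = 2 * qB 10.
Proof. by rewrite /qB -(qpoch_inf_opp1 x10 x101). Qed.

Lemma theta5E k : theta x 5 k = qA 5 * qA 10 * (qB k * qB (k + 5)) * (qB (5 - k) * qB (5 - k + 5)).
Proof.
rewrite /theta; congr (_ * _ * _); [exact: (qA_mod5 5) | exact: qB_mod5 | exact: qB_mod5].
Qed.

Lemma qpoch_inf_x4 : qpoch_inf (x ^+ 4) (x ^+ 4)
  = qA 2 * qB 2 * (qA 4 * qB 4) * (qA 6 * qB 6) * (qA 8 * qB 8) * (qA 10 * qB 10).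
Proof.
have H := @qpoch_inf_residues x 1 4 5 4 20 x0 x1 (oner_neq0 C) isT isT erefl.
rewrite mul1r in H; apply: (etrans H);
  apply: (etrans (prod_ord5 (fun k => qpoch_inf (1 * x ^+ k) (x ^+ 20)) 4)).
rewrite !mul1r; congr (_ * _ * _ * _ * _).
- exact: (qAB_sqr 2).
- exact: (qAB_sqr 4).
- exact: (qAB_sqr 6).
- exact: (qAB_sqr 8).
- exact: (qAB_sqr 10).
Qed.

Let nz := (qA_neq0 (isT : (0 < 1)%N), qA_neq0 (isT : (0 < 2)%N), qA_neq0 (isT : (0 < 3)%N),
  qA_neq0 (isT : (0 < 4)%N), qA_neq0 (isT : (0 < 5)%N), qA_neq0 (isT : (0 < 6)%N),
  qA_neq0 (isT : (0 < 7)%N), qA_neq0 (isT : (0 < 8)%N), qA_neq0 (isT : (0 < 9)%N),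
  qA_neq0 (isT : (0 < 10)%N), (qB_neq0 (isT : (0 < 1)%N), qB_neq0 (isT : (0 < 2)%N),
  qB_neq0 (isT : (0 < 3)%N), qB_neq0 (isT : (0 < 4)%N), qB_neq0 (isT : (0 < 5)%N),
  qB_neq0 (isT : (0 < 6)%N), qB_neq0 (isT : (0 < 7)%N), qB_neq0 (isT : (0 < 8)%N),
  qB_neq0 (isT : (0 < 9)%N), qB_neq0 (isT : (0 < 10)%N))).

(** The cancellation is stated for abstract letters, so that [field] never meets the infinite
    products themselves. *)
Lemma rr4_field (a b c d e f g h i j : C) : a != 0 -> b != 0 -> c != 0 -> d != 0 -> e != 0 ->
  f != 0 -> g != 0 -> h != 0 -> i != 0 -> j != 0 ->
  i * j * (c * d) * (e * f) / (a * b * (c * d) * (e * f) * (g * h) * (i * j)) = (a * b * (g *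
    h))^-1.
Proof. by move=> *; field; do ?[apply/andP; split]. Qed.

Lemma rrG4E : rrG (x ^+ 4) = (qA 2 * qB 2 * (qA 8 * qB 8))^-1.
Proof.
rewrite -(@rr4_field (qA 2) (qB 2) (qA 4) (qB 4) (qA 6) (qB 6) (qA 8) (qB 8) (qA 10) (qB 10)) ?nz
  //.
rewrite /rrG -!(exprM x); congr (_ * _ * _ / _); last exact: qpoch_inf_x4.
- exact: (qAB_sqr 10).
- exact: (qAB_sqr 4).
- exact: (qAB_sqr 6).
Qed.

Lemma rrH4E : rrH (x ^+ 4) = (qA 4 * qB 4 * (qA 6 * qB 6))^-1.
Proof.
have E := @rr4_field (qA 4) (qB 4) (qA 8) (qB 8) (qA 2) (qB 2) (qA 6) (qB 6) (qA 10) (qB 10).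
rewrite -E ?nz // /rrH -!(exprM x); congr (_ * _ * _ / _).
- exact: (qAB_sqr 10).
- exact: (qAB_sqr 8).
- exact: (qAB_sqr 2).
- rewrite qpoch_inf_x4.
  move: (qA 2) (qB 2) (qA 4) (qB 4) (qA 6) (qB 6) (qA 8) (qB 8) (qA 10) (qB 10).
  by move=> *; ring.
Qed.

Lemma expN_odd n : odd n -> (- x) ^+ n = - x ^+ n.
Proof. by move=> on; rewrite exprNn -signr_odd on expr1 mulN1r. Qed.

Lemma expN_even n : ~~ odd n -> (- x) ^+ n = x ^+ n.
Proof. by move=> on; rewrite exprNn -signr_odd (negbTE on) expr0 mul1r. Qed.

(** In base -x the modulus is unchanged because (-x)^10 = x^10, while odd residues acquire a
    sign. *)
Definition qS (k : nat) := if odd k then qB k else qA k.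

Lemma qSE k : qpoch_inf ((- x) ^+ k) ((- x) ^+ 10) = qS k.
Proof.
rewrite (expN_even (isT : ~~ odd 10)) /qS; case: ifP => ok; first by rewrite expN_odd.
by rewrite expN_even ?ok.
Qed.

Let nx0 : - x != 0. Proof. by rewrite oppr_eq0. Qed.
Let nx1 : cnorm (- x) < 1. Proof. by rewrite cnormN. Qed.

Lemma qS_mod5 k : qpoch_inf ((- x) ^+ k) ((- x) ^+ 5) = qS k * qS (k + 5).
Proof.
rewrite -!qSE -[(- x) ^+ k in LHS]mul1r.
rewrite (@qpoch_inf_residues _ 1 5 2 k 10 nx0 nx1 (oner_neq0 C) isT isT erefl).
rewrite (prod_ord2 (fun k => qpoch_inf (1 * (- x) ^+ k) ((- x) ^+ 10)) k 5).
by rewrite !mul1r.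
Qed.

Lemma qS_mod1 : qpoch_inf (- x) (- x)
  = qS 1 * qS 2 * qS 3 * qS 4 * qS 5 * qS 6 * qS 7 * qS 8 * qS 9 * qS 10.
Proof.
have := @qpoch_inf_residues (- x) 1 1 10 1 10 nx0 nx1 (oner_neq0 C) isT isT erefl.
rewrite mul1r !expr1 => ->.
rewrite (prod_ord10 (fun k => qpoch_inf (1 * (- x) ^+ k) ((- x) ^+ 10))).
by rewrite !mul1r !qSE.
Qed.

Lemma rrN_field (a b c d e f g h i j : C) : a != 0 -> b != 0 -> c != 0 -> d != 0 -> e != 0 ->
  f != 0 -> g != 0 -> h != 0 -> i != 0 -> j != 0 ->
  (e * j) * (b * g) * (c * h) / (a * b * c * d * e * f * g * h * i * j) = (a * d * f * i)^-1.
Proof. by move=> *; field; do ?[apply/andP; split]. Qed.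

Lemma rrGNE : rrG (- x) = (qB 1 * qA 4 * qA 6 * qB 9)^-1.
Proof.
have E := @rrN_field (qB 1) (qA 2) (qB 3) (qA 4) (qB 5) (qA 6) (qB 7) (qA 8) (qB 9) (qA 10).
rewrite -E ?nz // /rrG; congr (_ * _ * _ / _).
- exact: (qS_mod5 5).
- exact: (qS_mod5 2).
- exact: (qS_mod5 3).
- exact: qS_mod1.
Qed.

Lemma rrHNE : rrH (- x) = (qA 2 * qB 3 * qB 7 * qA 8)^-1.
Proof.
have E := @rrN_field (qA 2) (qA 4) (qB 1) (qB 3) (qB 5) (qB 7) (qB 9) (qA 6) (qA 8) (qA 10).
rewrite -E ?nz // /rrH; congr (_ * _ * _ / _).
- exact: (qS_mod5 5).
- exact: (qS_mod5 4).
- exact: (qS_mod5 1).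
- rewrite qS_mod1 /qS /=.
  move: (qB 1) (qA 2) (qB 3) (qA 4) (qB 5) (qA 6) (qB 7) (qA 8) (qB 9) (qA 10).
  by move=> *; ring.
Qed.

Lemma qpoch_inf_xx : qpoch_inf x x
  = qA 1 * qA 2 * qA 3 * qA 4 * qA 5 * qA 6 * qA 7 * qA 8 * qA 9 * qA 10.
Proof.
have := @qA_split 1 10 1 isT isT erefl.
by rewrite !expr1 => ->; rewrite (prod_ord10 qA).
Qed.

Lemma qpoch_inf_Nxx : qpoch_inf (- x) x
  = qB 1 * qB 2 * qB 3 * qB 4 * qB 5 * qB 6 * qB 7 * qB 8 * qB 9 * qB 10.
Proof.
have := @qB_split 1 10 1 isT isT erefl.
by rewrite !expr1 => ->; rewrite (prod_ord10 qB).
Qed.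

Lemma qpoch_inf_xx2 : qpoch_inf x (x ^+ 2) = qA 1 * qA 3 * qA 5 * qA 7 * qA 9.
Proof.
have := @qA_split 2 5 1 isT isT erefl.
by rewrite expr1 => ->; rewrite (prod_ord5_odd qA).
Qed.
End ProductEvaluations.

(** * Collapse of the six pairs of theta products, in an arbitrary field *)

Section ProductAlgebra.
Variables (F : fieldType) (x a1 a2 a3 a4 a5 a6 a7 a8 a9 a10 b1 b2 b3 b4 b5 b6 b7 b8 b9 b10 : F).
Hypothesis nz : all (fun y => y != 0)
  [:: a1; a2; a3; a4; a5; a6; a7; a8; a9; a10; b1; b2; b3; b4; b5; b6; b7; b8; b9; b10].
Hypothesis rel : [/\ a2 = a1 * a6 * (b1 * b6), a4 = a2 * a7 * (b2 * b7),
  a6 = a3 * a8 * (b3 * b8), a8 = a4 * a9 * (b4 * b9) & a10 = a5 * a10 * (b5 * b10)].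

Local Ltac nonzero := by do ?[apply/andP; split]; move: nz => /=;
  do 19 (case/andP=> ? + ); rewrite ?andbT.

(** The relations are solved for [b6] to [b10]; the remaining letters are treated as free, and the
    monomial identities fall to [field]. *)
Let b6E : b6 = a2 / (a1 * a6 * b1).
Proof. by have [E _ _ _ _] := rel; rewrite [in RHS]E; field; nonzero. Qed.
Let b7E : b7 = a4 / (a2 * a7 * b2).
Proof. by have [_ E _ _ _] := rel; rewrite [in RHS]E; field; nonzero. Qed.
Let b8E : b8 = a6 / (a3 * a8 * b3).
Proof. by have [_ _ E _ _] := rel; rewrite [in RHS]E; field; nonzero. Qed.
Let b9E : b9 = a8 / (a4 * a9 * b4).
Proof. by have [_ _ _ E _] := rel; rewrite [in RHS]E; field; nonzero. Qed.
Let b10E : b10 = (a5 * b5)^-1.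
Proof.
have [_ _ _ _ E] := rel; have n : a10 * (a5 * b5) != 0 by rewrite !mulf_eq0 !negb_or; nonzero.
apply: (mulfI n); transitivity a10; first by rewrite [RHS]E; ring.
by rewrite mulfK // mulf_eq0 negb_or; nonzero.
Qed.

Definition pochratio := (b1 * b2 * b3 * b4 * b5 * b6 * b7 * b8 * b9 * b10)
  / (a1 * a2 * a3 * a4 * a5 * a6 * a7 * a8 * a9 * a10) / (a1 * a3 * a5 * a7 * a9).

Local Ltac finish := rewrite /pochratio b6E b7E b8E b9E b10E; field; nonzero.

(** Over a common denominator the bracket is the right-hand side of the theta relation; replacing it
    by the left-hand side leaves an identity between monomials. *)
Lemma product_A0 :
  a5 * a10 * (b4 * b9) * (b1 * b6) * (a5 * a10 * (b3 * b8) * (b2 * b7))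
    = a10 * b7 * b3 * (a10 * b6 * b4) + x * (a10 * b2 * b8 * (a10 * b1 * b9)) ->
  pochratio * (a10 * b4 * b6 * (a2 * b2 * (a8 * b8))^-1 + x * (a10 * b1 * b9) * (a2 * b3 * b7 *
    a8)^-1)
  = a10 ^+ 11 / ((a1 * a9 * a10) ^+ 4 * (a2 * a8 * a10) * (a3 * a7 * a10) ^+ 3
      * (a4 * a6 * a10) ^+ 2 * (a5 * a10)).
Proof.
move=> th.
transitivity (pochratio / (a10 * a2 * a8 * b2 * b8 * b3 * b7)
   * (a10 * b7 * b3 * (a10 * b6 * b4) + x * (a10 * b2 * b8 * (a10 * b1 * b9)))).
  by rewrite -[RHS]mulrA; congr (_ * _); field; nonzero.
rewrite -th; finish.
Qed.

Lemma product_A1 :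
  a5 * a10 * (b4 * b9) * (b1 * b6) * (a5 * a10 * (b1 * b6) * (b4 * b9))
    = a10 * b5 * b5 * (a10 * b8 * b2) + x * (a10 * (2 * b10) * b10 * (a10 * b3 * b7)) ->
  pochratio * (x * (a10 * (2 * b10) * b10) * (a2 * b2 * (a8 * b8))^-1 + a10 * b5 * b5 * (a2 * b3 *
    b7 * a8)^-1)
  = a10 ^+ 11 * (a2 * a8 * a10) / ((a1 * a9 * a10) ^+ 5 * (a3 * a7 * a10) ^+ 2
      * (a4 * a6 * a10) ^+ 4 * (a5 * a10)).
Proof.
move=> th.
transitivity (pochratio / (a10 * a2 * a8 * b2 * b8 * b3 * b7)
   * (a10 * b5 * b5 * (a10 * b8 * b2) + x * (a10 * (2 * b10) * b10 * (a10 * b3 * b7)))).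
  by rewrite -[RHS]mulrA; congr (_ * _); field; nonzero.
rewrite -th; finish.
Qed.

(** Both summands equal a10/(a2 a8). This doubling and the 2 already present in the dissection make
    up the coefficient 4 of the theorem. *)
Lemma product_A2 :
  pochratio * (a10 * b2 * b8 * (a2 * b2 * (a8 * b8))^-1 + a10 * b3 * b7 * (a2 * b3 * b7 * a8)^-1)
  = 2 * (a10 ^+ 12 / ((a1 * a9 * a10) ^+ 3 * (a2 * a8 * a10) ^+ 2 * (a3 * a7 * a10) ^+ 3
      * (a4 * a6 * a10) * (a5 * a10) ^+ 3)).
Proof.
transitivity (pochratio * (2 * a10 / (a2 * a8))).
  by congr (_ * _); field; nonzero.
finish.
Qed.

Lemma product_B0 :
  a5 * a10 * (b3 * b8) * (b2 * b7) * (a5 * a10 * (b2 * b7) * (b3 * b8))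
    = a10 * b5 * b5 * (a10 * b6 * b4) + x ^+ 2 * (a10 * (2 * b10) * b10 * (a10 * b1 * b9)) ->
  pochratio * (a10 * b5 * b5 * (b1 * a4 * a6 * b9)^-1 + x ^+ 2 * (a10 * (2 * b10) * b10) * (a4 *
    b4 * (a6 * b6))^-1)
  = (a4 * a6 * a10) * a10 ^+ 11 / ((a1 * a9 * a10) ^+ 2 * (a2 * a8 * a10) ^+ 4
      * (a3 * a7 * a10) ^+ 5 * (a5 * a10)).
Proof.
move=> th.
transitivity (pochratio / (a10 * a4 * a6 * b1 * b9 * b4 * b6)
   * (a10 * b5 * b5 * (a10 * b6 * b4) + x ^+ 2 * (a10 * (2 * b10) * b10 * (a10 * b1 * b9)))).
  by rewrite -[RHS]mulrA; congr (_ * _); field; nonzero.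
rewrite -th; finish.
Qed.

Lemma product_B1 :
  a5 * a10 * (b4 * b9) * (b1 * b6) * (a5 * a10 * (b3 * b8) * (b2 * b7))
    = a10 * b7 * b3 * (a10 * b6 * b4) + x * (a10 * b2 * b8 * (a10 * b1 * b9)) ->
  pochratio * (a10 * b3 * b7 * (b1 * a4 * a6 * b9)^-1 + x * (a10 * b2 * b8) * (a4 * b4 * (a6 *
    b6))^-1)
  = a10 ^+ 11 / ((a1 * a9 * a10) ^+ 3 * (a2 * a8 * a10) ^+ 2
      * (a3 * a7 * a10) ^+ 4 * (a4 * a6 * a10) * (a5 * a10)).
Proof.
move=> th.
transitivity (pochratio / (a10 * a4 * a6 * b1 * b9 * b4 * b6)
   * (a10 * b7 * b3 * (a10 * b6 * b4) + x * (a10 * b2 * b8 * (a10 * b1 * b9)))).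
  by rewrite -[RHS]mulrA; congr (_ * _); field; nonzero.
rewrite -th; finish.
Qed.

Lemma product_B2 :
  pochratio * (a10 * b1 * b9 * (b1 * a4 * a6 * b9)^-1 + a10 * b4 * b6 * (a4 * b4 * (a6 * b6))^-1)
  = 2 * (a10 ^+ 12 / ((a1 * a9 * a10) ^+ 3 * (a2 * a8 * a10) * (a3 * a7 * a10) ^+ 3
      * (a4 * a6 * a10) ^+ 2 * (a5 * a10) ^+ 3)).
Proof.
transitivity (pochratio * (2 * a10 / (a4 * a6))).
  by congr (_ * _); field; nonzero.
finish.
Qed.

Variable q : F.
Hypothesis xE : x = q ^+ 5.

(** Terms are sorted by the power of q modulo 5, with q^5 = x and q^6 = q x: class 0 is
    [product_A0], class 1 is [product_A1], class 2 is [product_A2]. *)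
Lemma combine_A :
  a5 * a10 * (b4 * b9) * (b1 * b6) * (a5 * a10 * (b3 * b8) * (b2 * b7))
    = a10 * b7 * b3 * (a10 * b6 * b4) + x * (a10 * b2 * b8 * (a10 * b1 * b9)) ->
  a5 * a10 * (b4 * b9) * (b1 * b6) * (a5 * a10 * (b1 * b6) * (b4 * b9))
    = a10 * b5 * b5 * (a10 * b8 * b2) + x * (a10 * (2 * b10) * b10 * (a10 * b3 * b7)) ->
  (b1 * b2 * b3 * b4 * b5 * b6 * b7 * b8 * b9 * b10)
    / (a1 * a2 * a3 * a4 * a5 * a6 * a7 * a8 * a9 * a10)
  * (2 * (a10 * b4 * b6) + 2 * q ^+ 2 * (a10 * b2 * b8) + q ^+ 6 * (a10 * (2 * b10) * b10))
  * (q ^+ 0 * ((a2 * b2 * (a8 * b8))^-1 / (a1 * a3 * a5 * a7 * a9)))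
  + (b1 * b2 * b3 * b4 * b5 * b6 * b7 * b8 * b9 * b10)
    / (a1 * a2 * a3 * a4 * a5 * a6 * a7 * a8 * a9 * a10)
  * (a10 * b5 * b5 + 2 * q * (a10 * b3 * b7) + 2 * q ^+ 4 * (a10 * b1 * b9))
  * (q ^+ 1 * ((a2 * b3 * b7 * a8)^-1 / (a1 * a3 * a5 * a7 * a9)))
  = 2 * (a10 ^+ 11 / ((a1 * a9 * a10) ^+ 4 * (a2 * a8 * a10) * (a3 * a7 * a10) ^+ 3
      * (a4 * a6 * a10) ^+ 2 * (a5 * a10)))
  + q * (a10 ^+ 11 * (a2 * a8 * a10) / ((a1 * a9 * a10) ^+ 5 * (a3 * a7 * a10) ^+ 2
      * (a4 * a6 * a10) ^+ 4 * (a5 * a10)))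
  + 4 * q ^+ 2 * (a10 ^+ 12 / ((a1 * a9 * a10) ^+ 3 * (a2 * a8 * a10) ^+ 2 * (a3 * a7 * a10) ^+ 3
      * (a4 * a6 * a10) * (a5 * a10) ^+ 3)).
Proof.
move=> /product_A0 <- /product_A1 <-.
rewrite [4 * q ^+ 2 * _](_ : _ = 2 * q ^+ 2 * (2 * (a10 ^+ 12 / ((a1 * a9 * a10) ^+ 3 * (a2 * a8 *
  a10) ^+ 2
  * (a3 * a7 * a10) ^+ 3 * (a4 * a6 * a10) * (a5 * a10) ^+ 3)))); last by ring.
rewrite -product_A2 /pochratio xE; ring.
Qed.

(** The classes are now 0, 1 and 4; the term of power q^10 accounts for the x^2 in [product_B0]. *)
Lemma combine_B :
  a5 * a10 * (b3 * b8) * (b2 * b7) * (a5 * a10 * (b2 * b7) * (b3 * b8))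
    = a10 * b5 * b5 * (a10 * b6 * b4) + x ^+ 2 * (a10 * (2 * b10) * b10 * (a10 * b1 * b9)) ->
  a5 * a10 * (b4 * b9) * (b1 * b6) * (a5 * a10 * (b3 * b8) * (b2 * b7))
    = a10 * b7 * b3 * (a10 * b6 * b4) + x * (a10 * b2 * b8 * (a10 * b1 * b9)) ->
  (b1 * b2 * b3 * b4 * b5 * b6 * b7 * b8 * b9 * b10)
    / (a1 * a2 * a3 * a4 * a5 * a6 * a7 * a8 * a9 * a10)
  * (a10 * b5 * b5 + 2 * q * (a10 * b3 * b7) + 2 * q ^+ 4 * (a10 * b1 * b9))
  * (q ^+ 0 * ((b1 * a4 * a6 * b9)^-1 / (a1 * a3 * a5 * a7 * a9)))
  + (b1 * b2 * b3 * b4 * b5 * b6 * b7 * b8 * b9 * b10)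
    / (a1 * a2 * a3 * a4 * a5 * a6 * a7 * a8 * a9 * a10)
  * (2 * (a10 * b4 * b6) + 2 * q ^+ 2 * (a10 * b2 * b8) + q ^+ 6 * (a10 * (2 * b10) * b10))
  * (q ^+ 4 * ((a4 * b4 * (a6 * b6))^-1 / (a1 * a3 * a5 * a7 * a9)))
  = (a4 * a6 * a10) * a10 ^+ 11 / ((a1 * a9 * a10) ^+ 2 * (a2 * a8 * a10) ^+ 4
      * (a3 * a7 * a10) ^+ 5 * (a5 * a10))
  + 2 * q * (a10 ^+ 11 / ((a1 * a9 * a10) ^+ 3 * (a2 * a8 * a10) ^+ 2
      * (a3 * a7 * a10) ^+ 4 * (a4 * a6 * a10) * (a5 * a10)))
  + 4 * q ^+ 4 * (a10 ^+ 12 / ((a1 * a9 * a10) ^+ 3 * (a2 * a8 * a10) * (a3 * a7 * a10) ^+ 3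
      * (a4 * a6 * a10) ^+ 2 * (a5 * a10) ^+ 3)).
Proof.
move=> /product_B0 <- /product_B1 <-.
rewrite [4 * q ^+ 4 * _](_ : _ = 2 * q ^+ 4 * (2 * (a10 ^+ 12 / ((a1 * a9 * a10) ^+ 3 * (a2 * a8 *
  a10)
  * (a3 * a7 * a10) ^+ 3 * (a4 * a6 * a10) ^+ 2 * (a5 * a10) ^+ 3)))); last by ring.
rewrite -product_B2 /pochratio xE; ring.
Qed.
End ProductAlgebra.

(** Six times the difference splits into quadratics in 3i - 4j - 3k, in j and in k, bounded below by
    -2, -55 and -3; their total -60 is the origin of the constant 10. *)
Lemma exponent1_growth (i j k : int) : 0 <= i -> 0 <= j -> 0 <= k ->
  2 * (i + j + k) - 10 <= exponent1 i j k.
Proof.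
move=> i0 j0 k0; have := double_exponent1 i j k; move: (exponent1 i j k) => e He.
have : 6 * (e - 2 * (i + j + k)) = (3 * i - 4 * j - 3 * k) * ((3 * i - 4 * j - 3 * k) - 3)
    + j * (5 * j - 33) + 3 * k * (5 * k - 3).
  transitivity (3 * (2 * e) - 12 * (i + j + k)); first by ring.
  by rewrite He; ring.
have L (x : int) : -2 <= x * (x - 3).
  by clear; have [h | h] : x <= 1 \/ 2 <= x; [lia | nia | nia].
have J : -55 <= j * (5 * j - 33) by have := sqr_ge0 (10 * j - 33); clear; nia.
have K : -3 <= 3 * k * (5 * k - 3) by have := sqr_ge0 (10 * k - 3); clear; nia.
move: (L (3 * i - 4 * j - 3 * k)) J K.
move: ((3 * i - 4 * j - 3 * k) * _) (j * _) (3 * k * _) => a b d; clear; lia.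
Qed.

Lemma exponent2_growth (i j k : int) : 0 <= i -> 0 <= j -> 0 <= k ->
  2 * (i + j + k) - 10 <= exponent2 i j k.
Proof.
move=> i0 j0 k0; have := double_exponent2 i j k; move: (exponent2 i j k) => e He.
have : 6 * (e - 2 * (i + j + k)) = (3 * i - 4 * j - 3 * k) * ((3 * i - 4 * j - 3 * k) + 1)
    + j * (5 * j - 23) + 3 * k * (5 * k - 3).
  transitivity (3 * (2 * e) - 12 * (i + j + k)); first by ring.
  by rewrite He; ring.
have L (x : int) : 0 <= x * (x + 1).
  by clear; have [h | h] : x <= -1 \/ 0 <= x; [lia | nia | nia].
have J : -27 <= j * (5 * j - 23) by have := sqr_ge0 (10 * j - 23); clear; nia.
have K : -3 <= 3 * k * (5 * k - 3) by have := sqr_ge0 (10 * k - 3); clear; nia.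
move: (L (3 * i - 4 * j - 3 * k)) J K.
move: ((3 * i - 4 * j - 3 * k) * _) (j * _) (3 * k * _) => a b d; clear; lia.
Qed.

(** * Both triple sums as theta series times Slater sums *)

Section SumEvaluation.
Variables (R : realType) (q : R[i]).
Hypotheses (q0 : q != 0) (q1 : cnorm q < 1).
Local Notation C := R[i].
Local Notation Q := (q ^+ 5).
Let Q0 : Q != 0. Proof. by rewrite expf_neq0. Qed.
Let Q1 : cnorm Q < 1. Proof. exact: cnorm_qX_lt1. Qed.

Definition square_sum0 : C := theta Q 10 5 + 2 * q * theta Q 10 3 + 2 * q ^+ 4 * theta Q 10 1.
Definition square_sum1 : C := 2 * theta Q 10 4 + 2 * q ^+ 2 * theta Q 10 2 + q ^+ 6 * theta Q 10 0.

(** The condition on [e] says that after removing 5 tri(r + 1), with r = 2 rho + b, the exponent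
    K(rho) is k + 5e(rho): a prefactor q^k and a single sum in base Q. *)
Lemma nahm_half_value (c : int) (E : int -> int -> int -> int) (b : bool) (s t : int) (K e : int
  -> int)
    (k : nat) (V X S : C) :
  (forall i j k, 2 * E i j k = 3 * i ^+ 2 + 7 * j ^+ 2 + 8 * k ^+ 2
    - 8 * i * j - 6 * i * k + 8 * j * k + (1 + 4 * c) * i - (3 + 2 * c) * j + 4 * (1 - c) * k) ->
  (forall rho j M, let r := 2 * rho + Posz b in let n := 2 * M - 5 * (j + rho) - s in
    8 * M ^+ 2 + (4 * c - 4) * M + 55 * j ^+ 2 + (5 - 10 * c) * j - 40 * M * j - 20 * M * r
      + 20 * r ^+ 2 + 40 * r * j + 10 * r
    = 2 * (n ^+ 2 - t * n) + 5 * (j ^+ 2 - j) - 10 * r * j + 2 * K rho) ->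
  (forall rho, 2 * K rho = 5 * ((2 * rho + Posz b + 1) ^+ 2 - (2 * rho + Posz b + 1))
     + 2 * Posz k + 10 * e rho) ->
  has_sum (fun n => q ^ (n ^+ 2 - t * n)) V ->
  has_sum (fun rho => Q ^ e rho * rq Q (2 * rho + Posz b)) X ->
  has_sum (fun y => nahm4 q E (parity_param b y)) S ->
  S = qpoch_inf (- Q) Q / qpoch_inf Q Q * V * (q ^+ k * X).
Proof.
move=> HE HK He HV HX HS; apply: (has_sum_uniq (nahm_half q0 q1 HE HK HV HS)).
have := has_sumZ (qpoch_inf (- Q) Q / qpoch_inf Q Q * V) (has_sumZ (q ^+ k) HX).
congr (has_sum _ _); apply/funext => rho; congr (_ * _).
rewrite mulrA exprzX exprnP -(qexpD q0); congr (_ ^ _ * _).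
apply: (@mulfI _ 2) => //.
transitivity (2 * K rho - 5 * (2 * tri (2 * rho + Posz b + 1))); last by ring.
by rewrite tri2 He; ring.
Qed.

Lemma has_sum_exponent1 : has_sum (nahm3 q exponent1)
  (qpoch_inf (- Q) Q / qpoch_inf Q Q * square_sum1 * (q ^+ 0 * (rrG (Q ^+ 4) / qpoch_inf Q (Q ^+
    2)))
  + qpoch_inf (- Q) Q / qpoch_inf Q Q * square_sum0 * (q ^+ 1 * (rrH (- Q) / qpoch_inf Q (Q ^+
    2)))).
Proof.
have HE i j k : 2 * exponent1 i j k = 3 * i ^+ 2 + 7 * j ^+ 2 + 8 * k ^+ 2
    - 8 * i * j - 6 * i * k + 8 * j * k + (1 + 4 * 0) * i - (3 + 2 * 0) * j + 4 * (1 - 0) * k.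
  by rewrite double_exponent1; ring.
have [S HS] := abs_summable_has_sum (abs_summable_nahm4 q0 q1 exponent1_growth).
have [S0 [S1 [SE H0 H1]]] := nahm4_split q0 q1 exponent1_growth HS.
have := has_sum_nahm3 q0 q1 HS; rewrite SE.
have HX : has_sum (fun rho => Q ^ (rho ^+ 2) * rq Q (2 * rho + Posz false)) (rrG (Q ^+ 4) /
  qpoch_inf Q (Q ^+ 2)).
  by have := slater_X Q0 Q1; congr (has_sum _ _); apply/funext => n; rewrite addr0.
(* Comparing the coefficients of M in the completed square gives 2s + t = 1 - c + 5b, which
   determines s and t once t is 0 or 1; here c = 0. *)
rewrite (@nahm_half_value 0 _ false 0 1 (fun r => 15 * r ^+ 2 + 5 * r) (fun r => r ^+ 2) 0 _ _ S0
  HE _ _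
  (square_dissection1 q0 q1) HX H0) => [|rho j M /=|rho]; try by rewrite /=; ring.
rewrite (@nahm_half_value 0 _ true 3 0 (fun r => 15 * r ^+ 2 + 20 * r + 6) (fun r => r ^+ 2 + r) 1
  _ _ S1 HE _ _
  (square_dissection0 q0 q1) (slater_Y Q0 Q1) H1) => [//|rho j M /=|rho]; by rewrite /=; ring.
Qed.

Lemma has_sum_exponent2 : has_sum (nahm3 q exponent2)
  (qpoch_inf (- Q) Q / qpoch_inf Q Q * square_sum0 * (q ^+ 0 * (rrG (- Q) / qpoch_inf Q (Q ^+ 2)))
  + qpoch_inf (- Q) Q / qpoch_inf Q Q * square_sum1 * (q ^+ 4 * (rrH (Q ^+ 4) / qpoch_inf Q (Q ^+
    2)))).
Proof.
have HE i j k : 2 * exponent2 i j k = 3 * i ^+ 2 + 7 * j ^+ 2 + 8 * k ^+ 2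
    - 8 * i * j - 6 * i * k + 8 * j * k + (1 + 4 * 1) * i - (3 + 2 * 1) * j + 4 * (1 - 1) * k.
  by rewrite double_exponent2; ring.
have [S HS] := abs_summable_has_sum (abs_summable_nahm4 q0 q1 exponent2_growth).
have [S0 [S1 [SE H0 H1]]] := nahm4_split q0 q1 exponent2_growth HS.
have := has_sum_nahm3 q0 q1 HS; rewrite SE.
have HX : has_sum (fun rho => Q ^ (rho ^+ 2 + rho) * rq Q (2 * rho + Posz false)) (rrG (- Q) /
  qpoch_inf Q (Q ^+ 2)).
  by have := slater_X' Q0 Q1; congr (has_sum _ _); apply/funext => n; rewrite addr0.
rewrite (@nahm_half_value 1 _ false 0 0 (fun r => 15 * r ^+ 2 + 10 * r) (fun r => r ^+ 2 + r) 0 _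
  _ S0 HE _ _
  (square_dissection0 q0 q1) HX H0) => [|rho j M /=|rho]; try by rewrite /=; ring.
rewrite (@nahm_half_value 1 _ true 2 1 (fun r => 15 * r ^+ 2 + 25 * r + 9) (fun r => r ^+ 2 + 2 *
  r) 4 _ _ S1 HE _ _
  (square_dissection1 q0 q1) (slater_Y' Q0 Q1) H1) => [//|rho j M /=|rho]; by rewrite /=; ring.
Qed.
End SumEvaluation.

(** * Translation into the products J and J2 *)

Section ClosedForms.
Variables (R : realType) (q : R[i]).
Hypotheses (q0 : q != 0) (q1 : cnorm q < 1).
Local Notation C := R[i].
Local Notation Q := (q ^+ 5).
Let Q0 : Q != 0. Proof. by rewrite expf_neq0. Qed.
Let Q1 : cnorm Q < 1. Proof. exact: cnorm_qX_lt1. Qed.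
Local Notation a := (qA Q).
Local Notation b := (qB Q).

Lemma J_mul5 m : J (5 * m) q = qpoch_inf (Q ^+ m) (Q ^+ m).
Proof. by rewrite /J !exprM. Qed.

Lemma J2_mul5 m : J2 (5 * m) (5 * 10) q = a m * a (10 - m) * a 10.
Proof. by rewrite /J2 -mulnBr !exprM. Qed.

Lemma J50E : J 50 q = a 10. Proof. exact: (J_mul5 10). Qed.
Lemma J25E : J 25 q = a 5 * a 10.
Proof. exact: etrans (J_mul5 5) (qA_mod5 Q0 Q1 5). Qed.
Lemma J2_5E : J2 5 50 q = a 1 * a 9 * a 10. Proof. exact: (J2_mul5 1). Qed.
Lemma J2_10E : J2 10 50 q = a 2 * a 8 * a 10. Proof. exact: (J2_mul5 2). Qed.
Lemma J2_15E : J2 15 50 q = a 3 * a 7 * a 10. Proof. exact: (J2_mul5 3). Qed.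
Lemma J2_20E : J2 20 50 q = a 4 * a 6 * a 10. Proof. exact: (J2_mul5 4). Qed.

Lemma theta10_0E : theta Q 10 0 = a 10 * (2 * b 10) * b 10.
Proof. by rewrite -(qB0 Q0 Q1). Qed.

Lemma theta_product43 :
  a 5 * a 10 * (b 4 * b 9) * (b 1 * b 6) * (a 5 * a 10 * (b 3 * b 8) * (b 2 * b 7))
    = a 10 * b 7 * b 3 * (a 10 * b 6 * b 4) + Q * (a 10 * b 2 * b 8 * (a 10 * b 1 * b 9)).
Proof.
have E := @theta_product _ Q Q0 Q1 4 3 isT isT isT.
by rewrite !(theta5E Q0 Q1) in E; exact: E.
Qed.

Lemma theta_product41 :
  a 5 * a 10 * (b 4 * b 9) * (b 1 * b 6) * (a 5 * a 10 * (b 1 * b 6) * (b 4 * b 9))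
    = a 10 * b 5 * b 5 * (a 10 * b 8 * b 2)
      + Q * (a 10 * (2 * b 10) * b 10 * (a 10 * b 3 * b 7)).
Proof.
have E := @theta_product _ Q Q0 Q1 4 1 isT isT isT.
by rewrite !(theta5E Q0 Q1) theta10_0E in E; exact: E.
Qed.

Lemma theta_product32 :
  a 5 * a 10 * (b 3 * b 8) * (b 2 * b 7) * (a 5 * a 10 * (b 2 * b 7) * (b 3 * b 8))
    = a 10 * b 5 * b 5 * (a 10 * b 6 * b 4)
      + Q ^+ 2 * (a 10 * (2 * b 10) * b 10 * (a 10 * b 1 * b 9)).
Proof.
have E := @theta_product _ Q Q0 Q1 3 2 isT isT isT.
by rewrite !(theta5E Q0 Q1) theta10_0E in E; exact: E.
Qed.

Let nz : all (fun y => y != 0) [:: a 1; a 2; a 3; a 4; a 5; a 6; a 7; a 8; a 9; a 10;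
  b 1; b 2; b 3; b 4; b 5; b 6; b 7; b 8; b 9; b 10].
Proof.
by do 10 (apply/andP; split; first exact: (qA_neq0 Q0 Q1));
   do 10 (apply/andP; split; first exact: (qB_neq0 Q0 Q1)).
Qed.

Let rel : [/\ a 2 = a 1 * a 6 * (b 1 * b 6), a 4 = a 2 * a 7 * (b 2 * b 7),
  a 6 = a 3 * a 8 * (b 3 * b 8), a 8 = a 4 * a 9 * (b 4 * b 9) & a 10 = a 5 * a 10 * (b 5 * b 10)].
Proof.
by split; [exact: (qA_double Q0 Q1 1) | exact: (qA_double Q0 Q1 2) | exact: (qA_double Q0 Q1 3)
  | exact: (qA_double Q0 Q1 4) | exact: (qA_double Q0 Q1 5)].
Qed.

Lemma square_sum0E : square_sum0 q
  = a 10 * b 5 * b 5 + 2 * q * (a 10 * b 3 * b 7) + 2 * q ^+ 4 * (a 10 * b 1 * b 9).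
Proof. by []. Qed.

Lemma square_sum1E : square_sum1 q
  = 2 * (a 10 * b 4 * b 6) + 2 * q ^+ 2 * (a 10 * b 2 * b 8) + q ^+ 6 * (a 10 * (2 * b 10) * b 10).
Proof. by rewrite /square_sum1 theta10_0E. Qed.

Lemma closed_form1 :
  qpoch_inf (- Q) Q / qpoch_inf Q Q * square_sum1 q * (q ^+ 0 * (rrG (Q ^+ 4) / qpoch_inf Q (Q ^+
    2)))
  + qpoch_inf (- Q) Q / qpoch_inf Q Q * square_sum0 q * (q ^+ 1 * (rrH (- Q) / qpoch_inf Q (Q ^+
    2)))
  = 2 * (J 50 q ^+ 11
          / (J2 5 50 q ^+ 4 * J2 10 50 q * J2 15 50 q ^+ 3 * J2 20 50 q ^+ 2 * J 25 q))
     + q * (J 50 q ^+ 11 * J2 10 50 q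
            / (J2 5 50 q ^+ 5 * J2 15 50 q ^+ 2 * J2 20 50 q ^+ 4 * J 25 q))
     + 4 * q ^+ 2
       * (J 50 q ^+ 12
          / (J2 5 50 q ^+ 3 * J2 10 50 q ^+ 2 * J2 15 50 q ^+ 3 * J2 20 50 q
             * J 25 q ^+ 3)).
Proof.
rewrite J50E J25E J2_5E J2_10E J2_15E J2_20E square_sum0E square_sum1E.
rewrite (rrG4E Q0 Q1) (rrHNE Q0 Q1) (qpoch_inf_xx Q0 Q1) (qpoch_inf_Nxx Q0 Q1) (qpoch_inf_xx2 Q0
  Q1).
exact: (combine_A nz rel (erefl Q) theta_product43 theta_product41).
Qed.

Lemma closed_form2 :
  qpoch_inf (- Q) Q / qpoch_inf Q Q * square_sum0 q * (q ^+ 0 * (rrG (- Q) / qpoch_inf Q (Q ^+ 2)))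
  + qpoch_inf (- Q) Q / qpoch_inf Q Q * square_sum1 q * (q ^+ 4 * (rrH (Q ^+ 4) / qpoch_inf Q (Q
    ^+ 2)))
  = J2 20 50 q * J 50 q ^+ 11
       / (J2 5 50 q ^+ 2 * J2 10 50 q ^+ 4 * J2 15 50 q ^+ 5 * J 25 q)
     + 2 * q
       * (J 50 q ^+ 11
          / (J2 5 50 q ^+ 3 * J2 10 50 q ^+ 2 * J2 15 50 q ^+ 4 * J2 20 50 q * J 25 q))
     + 4 * q ^+ 4
       * (J 50 q ^+ 12
          / (J2 5 50 q ^+ 3 * J2 10 50 q * J2 15 50 q ^+ 3 * J2 20 50 q ^+ 2
             * J 25 q ^+ 3)).
Proof.
rewrite J50E J25E J2_5E J2_10E J2_15E J2_20E square_sum0E square_sum1E.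
rewrite (rrGNE Q0 Q1) (rrH4E Q0 Q1) (qpoch_inf_xx Q0 Q1) (qpoch_inf_Nxx Q0 Q1) (qpoch_inf_xx2 Q0
  Q1).
exact: (combine_B nz rel (erefl Q) theta_product32 theta_product43).
Qed.
End ClosedForms.

Lemma has_sum3_nahm3 (R : realType) (q : R[i]) (E : int -> int -> int -> int) (S : R[i]) :
  has_sum (nahm3 q E) S ->
  has_sum3 (fun i j k : nat => q ^ E i j k
    / (qpoch (q ^+ 5) (q ^+ 5) i * qpoch (q ^+ 5) (q ^+ 5) j * qpoch (q ^+ 5) (q ^+ 5) k)) S.
Proof.
pose h (t : nat * nat * nat) : int * int * int := (Posz t.1.1, Posz t.1.2, Posz t.2).
have hI : injective h by move=> [[? ?] ?] [[? ?] ?] [-> -> ->].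
have off x : (forall t, x <> h t) -> nahm3 q E x = 0.
  case: x => [[[i|i] [j|j]] [k|k]] H; rewrite /nahm3 /=; try by rewrite !(mulr0, mul0r).
  by case: (H (i, j, k)).
move/(@has_sum_inj R _ _ h (nahm3 q E) S hI off).1; congr (has_sum _ _);
  apply/funext => -[[i j] k] /=.
by rewrite /nahm3 /= /rq !invfM.
Qed.

(** * The degenerate case q = 0 *)

Section AtZero.
Variable R : realType.
Local Notation C := R[i].

Lemma qpoch00 n : qpoch 0 0 n = 1 :> C.
Proof. by rewrite /qpoch big1 // => i _; rewrite mul0r subr0. Qed.

Lemma qpoch_inf00 : qpoch_inf 0 0 = 1 :> C.
Proof.
apply: qpoch_inf_lim; rewrite (_ : qpoch 0 0 = fun=> 1); first exact: tends_cst.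
by apply/funext => n; rewrite qpoch00.
Qed.

Lemma J_at0 m : (0 < m)%N -> J m (0 : C) = 1.
Proof. by move=> m0; rewrite /J expr0n gtn_eqF // qpoch_inf00. Qed.

Lemma J2_at0 k m : (0 < k < m)%N -> J2 k m (0 : C) = 1.
Proof.
move=> /andP[k0 km]; rewrite /J2 !expr0n !gtn_eqF ?subn_gt0 //; last exact: leq_ltn_trans km.
by rewrite qpoch_inf00 !mulr1.
Qed.

(** At q = 0 the denominators are 1 and 0^E is 1 or 0 according as E vanishes or not, so the sum
    counts the zeros of E. *)
Lemma has_sum3_at0 (E : int -> int -> int -> int) (r : seq (nat * nat * nat)) : uniq r ->
  (forall i j k : nat, (E i j k == 0) = ((i, j, k) \in r)) ->
  has_sum3 (fun i j k : nat => 0 ^ E i j k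
    / (qpoch (0 ^+ 5) (0 ^+ 5) i * qpoch (0 ^+ 5) (0 ^+ 5) j * qpoch (0 ^+ 5) (0 ^+ 5) k)) ((size
      r)%:R : C).
Proof.
move=> Ur Er.
have := @has_sum_finite R _ r (fun t : nat * nat * nat => (t \in r)%:R) Ur.
rewrite (eq_big_seq (fun=> 1)) ?big_const_seq ?iter_addr_0 ?count_predT => [H|x ->//].
have {H} : has_sum (fun t : nat * nat * nat => (t \in r)%:R) ((size r)%:R : C).
  by apply: H => x /negbTE ->.
congr (has_sum _ _); apply/funext => -[[i j] k] /=.
by rewrite expr0n /= !qpoch00 !mulr1 divr1 exp0rz Er.
Qed.

Lemma exponent1_eq0 (i j k : nat) :
  (exponent1 i j k == 0) = ((i, j, k) \in [:: (0, 0, 0); (1, 1, 0)]%N).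
Proof.
have := double_exponent1 i j k; move: (exponent1 i j k) => e He.
rewrite !inE !xpair_eqE; apply/eqP/idP => [e0|]; last first.
  by case/orP => /andP[/andP[/eqP Ei /eqP Ej] /eqP Ek]; move: He; rewrite Ei Ej Ek; lia.
have : (3 * Posz i - 4 * Posz j - 3 * Posz k) * (3 * Posz i - 4 * Posz j - 3 * Posz k + 1)
    + 5 * (Posz j * (Posz j - 1)) + 15 * (Posz k * (Posz k + 1)) = 0.
  by transitivity (3 * (2 * e)); [rewrite He; ring | rewrite e0].
have L (x : int) : 0 <= x * (x + 1).
  by clear; have [h | h] : x <= -1 \/ 0 <= x; [lia | nia | nia].
have J0 : 0 <= Posz j * (Posz j - 1) by clear; nia.
have k0 : k = 0%N \/ 15 <= 15 * (Posz k * (Posz k + 1)) by clear; nia.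
have j0 : j = 0%N \/ j = 1%N \/ 2 <= Posz j * (Posz j - 1) by clear; nia.
have := L (3 * Posz i - 4 * Posz j - 3 * Posz k).
case: k0 => [-> | hk]; last first.
  move: hk J0; move: (_ * (_ + 1)) (Posz j * _) (15 * _) => *; lia.
case: j0 => [-> | [-> | hj]] Lx Ex; first by clear - Ex; nia.
  by clear - Ex; nia.
by move: hj Lx Ex; clear; move: (_ * (_ + 1)) (Posz j * _) => *; lia.
Qed.

Lemma exponent2_eq0 (i j k : nat) :
  (exponent2 i j k == 0) = ((i, j, k) \in [:: (0, 0, 0)]%N).
Proof.
have := double_exponent2 i j k; move: (exponent2 i j k) => e He.
rewrite !inE !xpair_eqE; apply/eqP/idP => [e0|]; last first.
  by case/andP => /andP[/eqP Ei /eqP Ej] /eqP Ek; move: He; rewrite Ei Ej Ek; lia.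
have : (3 * Posz i - 4 * Posz j - 3 * Posz k) * (3 * Posz i - 4 * Posz j - 3 * Posz k + 5)
    + 5 * (Posz j * (Posz j + 1)) + 15 * (Posz k * (Posz k + 1)) = 0.
  by transitivity (3 * (2 * e)); [rewrite He; ring | rewrite e0].
have L (x : int) : -6 <= x * (x + 5).
  by clear; have [h | h] : x <= -3 \/ -2 <= x; [lia | nia | nia].
have k0 : k = 0%N \/ 15 <= 15 * (Posz k * (Posz k + 1)) by clear; nia.
have j0 : j = 0%N \/ 2 <= Posz j * (Posz j + 1) by clear; nia.
have J0 : 0 <= Posz j * (Posz j + 1) by clear; nia.
have := L (3 * Posz i - 4 * Posz j - 3 * Posz k).
case: k0 => [-> | hk]; last first.
  move: hk J0; move: (_ * (_ + 5)) (Posz j * _) (15 * _) => *; lia.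
case: j0 => [-> | hj] Lx Ex; first by clear - Ex; nia.
by move: hj Lx Ex; clear; move: (_ * (_ + 5)) (Posz j * _) => *; lia.
Qed.
End AtZero.

Theorem theorem1p3 (R : realType) (q : R[i]) (hq : `|q| < 1) :
  has_sum3
    (fun i j k : nat =>
       q ^ exponent1 i j k
       / (qpoch (q ^+ 5) (q ^+ 5) i * qpoch (q ^+ 5) (q ^+ 5) j
          * qpoch (q ^+ 5) (q ^+ 5) k))
    (2 * (J 50 q ^+ 11
          / (J2 5 50 q ^+ 4 * J2 10 50 q * J2 15 50 q ^+ 3 * J2 20 50 q ^+ 2 * J 25 q))
     + q * (J 50 q ^+ 11 * J2 10 50 q
            / (J2 5 50 q ^+ 5 * J2 15 50 q ^+ 2 * J2 20 50 q ^+ 4 * J 25 q))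
     + 4 * q ^+ 2
       * (J 50 q ^+ 12
          / (J2 5 50 q ^+ 3 * J2 10 50 q ^+ 2 * J2 15 50 q ^+ 3 * J2 20 50 q
             * J 25 q ^+ 3)))
  /\
  has_sum3
    (fun i j k : nat =>
       q ^ exponent2 i j k
       / (qpoch (q ^+ 5) (q ^+ 5) i * qpoch (q ^+ 5) (q ^+ 5) j
          * qpoch (q ^+ 5) (q ^+ 5) k))
    (J2 20 50 q * J 50 q ^+ 11
       / (J2 5 50 q ^+ 2 * J2 10 50 q ^+ 4 * J2 15 50 q ^+ 5 * J 25 q)
     + 2 * q
       * (J 50 q ^+ 11
          / (J2 5 50 q ^+ 3 * J2 10 50 q ^+ 2 * J2 15 50 q ^+ 4 * J2 20 50 q * J 25 q))
     + 4 * q ^+ 4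
       * (J 50 q ^+ 12
          / (J2 5 50 q ^+ 3 * J2 10 50 q * J2 15 50 q ^+ 3 * J2 20 50 q ^+ 2
             * J 25 q ^+ 3))).
Proof.
(* The general argument inverts powers of q. At q = 0 all J are 1, and the constant terms 2 and 1 of
   the right-hand sides match the numbers of zeros of the exponents. *)
have [->|q0] := eqVneq q 0.
  split.
  - rewrite [X in has_sum3 _ X](_ : _ = 2%:R).
      have H := @has_sum3_at0 R exponent1 [:: (0, 0, 0); (1, 1, 0)]%N isT exponent1_eq0.
      exact: H.
    by rewrite !J_at0 // !J2_at0 // !expr1n !mulr1 invr1 !mulr1 expr0n mulr0 !addr0.
  - rewrite [X in has_sum3 _ X](_ : _ = 1%:R).
      have H := @has_sum3_at0 R exponent2 [:: (0, 0, 0)]%N isT exponent2_eq0.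
      exact: H.
    by rewrite !J_at0 // !J2_at0 // !expr1n !mulr1 invr1 !mulr1 expr0n !mulr0 !addr0.
have q1 := cnorm_lt1 hq; split; apply: has_sum3_nahm3.
- by rewrite -(closed_form1 q0 q1); exact: has_sum_exponent1.
- by rewrite -(closed_form2 q0 q1); exact: has_sum_exponent2.
Qed.
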